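(* Let $\mathbf{F}$ denote $\mathbf{R}$, $\mathbf{C}$ or the field $\mathbf{H}$ of quaternions. Let $V$ be a real algebraic variety, $L\subset V$ a compact subset, and $l\le k$ nonnegative integers. Then each $\mathbf{F}$-vector bundle on $L$ of class $\mathcal{C}^l$ is $\mathcal{C}^l$ isomorphic to a $\mathcal{C}^k$ piecewise-algebraic $\mathbf{F}$-vector bundle on $L$. The latter bundle is uniquely determined up to $\mathcal{C}^k$ piecewise-algebraic isomorphism.
   Context: Real algebraic varieties. A real algebraic variety is a locally ringed space isomorphic to an algebraic subset of some $\mathbf{R}^m$, endowed with the Zariski topology and the sheaf of real-valued regular functions; it may be singular. It also carries the Euclidean topology, to which all topological notions refer unless ''Zariski'' is specified. An algebraic embedding $e:V\to\mathbf{R}^n$ is a map such that $e(V)$ is a Zariski locally closed subvariety of $\mathbf{R}^n$ and $e:V\to e(V)$ is a biregular isomorphism. A stratification of $V$ is a finite collection of pairwise disjoint Zariski locally closed subvarieties whose union equals $V$. Vector bundles. All $\mathbf{F}$-vector spaces are left vector spaces. $E(\xi)$ denotes the total space of a bundle $\xi$, and $\varepsilon^m_X(\mathbf{F})$ the product bundle on $X$ with total space $X\times\mathbf{F}^m$. For a morphism $\psi:\theta\to\omega$ of topological $\mathbf{F}$-vector bundles on $Y$ and $X\subset Y$, $\psi_X:\theta|_X\to\omega|_X$ denotes its restriction. For a continuous map $f:X\to Y$ and a subbundle $\theta$ of $\varepsilon^m_Y(\mathbf{F})$, the pullback $f^*\theta$ is the subbundle of $\varepsilon^m_X(\mathbf{F})$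 with $E(f^*\theta)=\{(x,v)\in X\times\mathbf{F}^m:(f(x),v)\in E(\theta)\}$; for a morphism $\phi:\theta\to\omega$ with $\omega$ a subbundle of $\varepsilon^p_Y(\mathbf{F})$, the pullback morphism $f^*\phi:f^*\theta\to f^*\omega$ is $(f^*\phi)(x,v)=(x,\pi(\phi(f(x),v)))$, where $\pi:Y\times\mathbf{F}^p\to\mathbf{F}^p$ is the projection. Algebraic bundles. An algebraic $\mathbf{F}$-vector bundle on a real algebraic variety $V$ is an algebraic vector subbundle of $\varepsilon_V^m(\mathbf{F})$ for some $m$ (where $V\times\mathbf{F}^m$ is regarded as a real algebraic variety), i.e. Zariski locally on $V$ its fibers have a basis given by regular sections; algebraic morphisms are bundle morphisms that are regular maps of total spaces. Let $X\subset V$ be nonempty with Zariski closure $Z$ in $V$. An algebraic $\mathbf{F}$-vector bundle on $X$ (algebraic $\mathbf{F}$-vector subbundle of $\varepsilon^m_X(\mathbf{F})$) is a topological $\mathbf{F}$-vector subbundle $\xi$ of $\varepsilon_X^m(\mathbf{F})$, for some $m$, for which there exist a Zariski open neighborhood $Z_0\subset Z$ of $X$ and an algebraic $\mathbf{F}$-vector subbundle $\tilde\xi$ of $\varepsilon^m_{Z_0}(\mathbf{F})$ with $\tilde\xi|_X=\xi$; $(Z_0,\tilde\xi)$ is an algebraic extension of $\xi$. An algebraic morphism $\phi:\xi\to\eta$ of such bundles is a topological morphism for which there are algebraic extensions $(Z_0,\tilde\xi)$, $(Z_0,\tilde\eta)$ and an algebraic morphism $\tilde\phi:\tilde\xi\to\tilde\eta$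 with $\tilde\phi_X=\phi$. Piecewise-algebraic bundles. Let $\mathcal{S}$ be a stratification of $V$. A piecewise $\mathcal{S}$-algebraic $\mathbf{F}$-vector bundle on $X\subset V$ is a topological $\mathbf{F}$-vector subbundle $\xi$ of $\varepsilon_X^m(\mathbf{F})$, for some $m$, such that for every $S\in\mathcal{S}$ and each connected component $\Sigma$ of $X\cap S$ the restriction $\xi|_\Sigma$ is an algebraic $\mathbf{F}$-vector subbundle of $\varepsilon^m_\Sigma(\mathbf{F})$. A piecewise $\mathcal{S}$-algebraic morphism $\phi:\xi\to\eta$ of such bundles is a topological morphism such that for all such $\Sigma$ the restriction $\phi_\Sigma:\xi|_\Sigma\to\eta|_\Sigma$ is an algebraic morphism. Bundles of class $\mathcal{C}^k$ ($k\geq 0$ an integer). Let first $L\subset\mathbf{R}^n$ be compact. A topological $\mathbf{F}$-vector bundle $\xi$ on $L$ is of class $\mathcal{C}^k$ if it is a subbundle of $\varepsilon^m_L(\mathbf{F})$, for some $m$, and there exist an open neighborhood $U$ of $L$ in $\mathbf{R}^n$ and an $\mathbf{F}$-vector subbundle $\hat\xi$ of $\varepsilon_U^m(\mathbf{F})$ of class $\mathcal{C}^k$ (in the usual sense over the manifold $U$) with $\xi=\hat\xi|_L$; $(U,\hat\xi)$ is a $\mathcal{C}^k$ extension of $\xi$, and $\xi$ is called a subbundle of $\varepsilon^m_L(\mathbf{F})$ of class $\mathcal{C}^k$. A $\mathcal{C}^k$ morphism $\phi:\xi\to\eta$ of such bundles is a topological morphism for which there are $\mathcal{C}^k$ extensions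 $(U,\hat\xi)$, $(U,\hat\eta)$ and a $\mathcal{C}^k$ morphism $\hat\phi:\hat\xi\to\hat\eta$ with $\hat\phi_L=\phi$. If $L$ is a compact subset of a real algebraic variety $V$, fix an algebraic embedding $e:V\to\mathbf{R}^n$ with restriction $e_L:L\to e(L)$. A topological $\mathbf{F}$-vector bundle $\xi$ on $L$ is of class $\mathcal{C}^k$ if it is a subbundle of some $\varepsilon_L^m(\mathbf{F})$ and $(e_L^{-1})^*\xi$ is a subbundle of $\varepsilon^m_{e(L)}(\mathbf{F})$ of class $\mathcal{C}^k$; a $\mathcal{C}^k$ morphism $\phi:\xi\to\eta$ of bundles of class $\mathcal{C}^k$ is a topological morphism such that $(e_L^{-1})^*\phi$ is of class $\mathcal{C}^k$. These notions are independent of $e$. $\mathcal{C}^k$ piecewise-algebraic bundles. Let $L\subset V$ be compact. A $\mathcal{C}^k$ piecewise $\mathcal{S}$-algebraic $\mathbf{F}$-vector bundle on $L$ is a piecewise $\mathcal{S}$-algebraic $\mathbf{F}$-vector subbundle of $\varepsilon_L^m(\mathbf{F})$, for some $m$, which is of class $\mathcal{C}^k$; a $\mathcal{C}^k$ piecewise $\mathcal{S}$-algebraic morphism is a morphism that is both a $\mathcal{C}^k$ morphism and a piecewise $\mathcal{S}$-algebraic morphism. A $\mathcal{C}^k$ piecewise-algebraic $\mathbf{F}$-vector bundle on $L$ is a $\mathcal{C}^k$ piecewise $\mathcal{T}$-algebraic one for some stratification $\mathcal{T}$ of $V$. A $\mathcal{C}^k$ piecewise-algebraic morphism $\phi:\xi\to\eta$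 is a $\mathcal{C}^k$ piecewise $\mathcal{T}$-algebraic morphism for some stratification $\mathcal{T}$ of $V$ such that both $\xi$ and $\eta$ are $\mathcal{C}^k$ piecewise $\mathcal{T}$-algebraic. Isomorphisms ($\mathcal{C}^l$, respectively $\mathcal{C}^k$ piecewise-algebraic) are morphisms of the given kind having an inverse of the same kind. *)

(* Defs.v *)
From HB Require Import structures.
From mathcomp Require Import all_boot all_order all_algebra.
From mathcomp Require Import ring.
From mathcomp Require Import all_classical all_reals all_analysis.
From mathcomp Require mpoly.
From mathcomp Require Import (canonicals) complex.

Set Implicit Arguments.
Unset Strict Implicit.
Unset Printing Implicit Defensive.

Import Order.TTheory GRing.Theory Num.Theory.
Import numFieldNormedType.Exports.

Local Open Scope classical_set_scope.
Local Open Scope ring_scope.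

(* Quaternion a b c d is a + b i + c j + d k. *)
Record quaternion (R : Type) : Type :=
  Quaternion { qre : R; qi : R; qj : R; qk : R }.

Module QuaternionRing.
Section QuaternionEncoding.
Variable R : Type.
Definition encode (x : quaternion R) : R * R * R * R :=
  (qre x, qi x, qj x, qk x).
Definition decode (t : R * R * R * R) : quaternion R :=
  Quaternion t.1.1.1 t.1.1.2 t.1.2 t.2.
Lemma encodeK : cancel encode decode. Proof. by case. Qed.
End QuaternionEncoding.

Section QuaternionOps.
Variable R : comNzRingType.
Local Notation H := (quaternion R).

Definition zeroq : H := Quaternion 0 0 0 0.
Definition oneq : H := Quaternion 1 0 0 0.
Definition oppq (x : H) : H := Quaternion (- qre x) (- qi x) (- qj x) (- qk x).
Definition addq (x y : H) : H :=
  Quaternion (qre x + qre y) (qi x + qi y) (qj x + qj y) (qk x + qk y).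
Definition mulq (x y : H) : H :=
  Quaternion
    (qre x * qre y - qi x * qi y - qj x * qj y - qk x * qk y)
    (qre x * qi y + qi x * qre y + qj x * qk y - qk x * qj y)
    (qre x * qj y - qi x * qk y + qj x * qre y + qk x * qi y)
    (qre x * qk y + qi x * qj y - qj x * qi y + qk x * qre y).

Lemma addqA : associative addq.
Proof. by move=> x y z; rewrite /addq /= !addrA. Qed.
Lemma addqC : commutative addq.
Proof. by move=> x y; congr Quaternion; rewrite addrC. Qed.
Lemma add0q : left_id zeroq addq.
Proof. by case=> a b c d; rewrite /addq /= !add0r. Qed.
Lemma addNq : left_inverse zeroq oppq addq.
Proof. by move=> x; rewrite /addq /= !addNr. Qed.
Lemma mulqA : associative mulq.
Proof. by move=> x y z; congr Quaternion => /=; ring. Qed.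
Lemma mul1q : left_id oneq mulq.
Proof. by case=> a b c d; congr Quaternion => /=; ring. Qed.
Lemma mulq1 : right_id oneq mulq.
Proof. by case=> a b c d; congr Quaternion => /=; ring. Qed.
Lemma mulqDl : left_distributive mulq addq.
Proof. by move=> x y z; congr Quaternion => /=; ring. Qed.
Lemma mulqDr : right_distributive mulq addq.
Proof. by move=> x y z; congr Quaternion => /=; ring. Qed.
End QuaternionOps.
End QuaternionRing.

HB.instance Definition _ (R : eqType) := Equality.copy (quaternion R)
  (can_type (@QuaternionRing.encodeK R)).
HB.instance Definition _ (R : choiceType) := Choice.copy (quaternion R)
  (can_type (@QuaternionRing.encodeK R)).

Section QuaternionInstances.
Import QuaternionRing.
Variable R : comNzRingType.
HB.instance Definition _ := GRing.isZmodule.Build (quaternion R)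
  (@addqA R) (@addqC R) (@add0q R) (@addNq R).
Lemma oneq_neq0 : oneq R != 0 :> quaternion R.
Proof. by apply/eqP => /(congr1 (@qre R)) /eqP; rewrite /= oner_eq0. Qed.
HB.instance Definition _ := GRing.Zmodule_isNzRing.Build (quaternion R)
  (@mulqA R) (@mul1q R) (@mulq1 R) (@mulqDl R) (@mulqDr R) oneq_neq0.
End QuaternionInstances.

Inductive scalar_kind := Reals | Complexes | Quaternions.

(* The field F: R, C or the skew field of quaternions. *)
Definition scalar (R : realType) (K : scalar_kind) : nzRingType :=
  match K with
  | Reals => R
  | Complexes => complex.complex R
  | Quaternions => quaternion R
  end.

Definition rdim (K : scalar_kind) : nat :=
  match K with Reals => 1 | Complexes => 2 | Quaternions => 4 end.

Definition scalar_of_real (R : realType) (K : scalar_kind) :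
    'rV[R]_(rdim K) -> scalar R K :=
  match K return 'rV[R]_(rdim K) -> scalar R K with
  | Reals => fun t => t 0 (inord 0)
  | Complexes => fun t => complex.Complex (t 0 (inord 0)) (t 0 (inord 1))
  | Quaternions => fun t =>
      Quaternion (t 0 (inord 0)) (t 0 (inord 1)) (t 0 (inord 2)) (t 0 (inord 3))
  end.

Definition real_of_scalar (R : realType) (K : scalar_kind) :
    scalar R K -> 'rV[R]_(rdim K) :=
  match K return scalar R K -> 'rV[R]_(rdim K) with
  | Reals => fun a => \row_i a
  | Complexes => fun a => \row_i nth 0 [:: complex.Re a; complex.Im a] i
  | Quaternions => fun a => \row_i nth 0 [:: qre a; qi a; qj a; qk a] i
  end.

Lemma real_of_scalarK (R : realType) (K : scalar_kind) :
  cancel (@real_of_scalar R K) (@scalar_of_real R K).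
Proof. by case: K => [a|[a b]|[a b c d]]; rewrite /= !mxE ?inordK. Qed.

Lemma scalar_of_realK (R : realType) (K : scalar_kind) :
  cancel (@scalar_of_real R K) (@real_of_scalar R K).
Proof.
by case: K => t; apply/rowP => i; rewrite !mxE;
  case: i => [[|[|[|[|i]]]] //= Hi]; congr (t _ _); apply: val_inj;
  rewrite /= inordK.
Qed.

(* F^m is the left F-vector space 'rV[scalar R K]_m; wherever a topology or a
   notion of regular or C^k function is needed on it, it is replaced by the
   real vector space 'M[R]_(m, rdim K) by means of real coordinates. *)
Definition vec_of_real (R : realType) (K : scalar_kind) (m : nat)
    (t : 'M[R]_(m, rdim K)) : 'rV[scalar R K]_m :=
  \row_j scalar_of_real (row j t).

Definition peval (R : realType) (n : nat) (P : mpoly.mpoly n R)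
    (x : 'rV[R]_n) : R :=
  mpoly.meval (fun i => x 0 i) P.

Definition zariski_closed (R : realType) (n : nat) (A : set 'rV[R]_n) : Prop :=
  exists I : set (mpoly.mpoly n R),
    A = [set x | forall P, I P -> peval P x = 0].

Definition zariski_open (R : realType) (n : nat) (A : set 'rV[R]_n) : Prop :=
  zariski_closed (~` A).

Definition zariski_locally_closed (R : realType) (n : nat)
    (A : set 'rV[R]_n) : Prop :=
  exists U C : set 'rV[R]_n, [/\ zariski_open U, zariski_closed C & A = U `&` C].

(* f is a regular function on the subset A of R^n (with the Zariski topology
   and the sheaf induced from R^n): Zariski locally on A it is a quotient of
   polynomials. The values of f outside A are irrelevant. *)
Definition regular_affine (R : realType) (n : nat) (A : set 'rV[R]_n)
    (f : 'rV[R]_n -> R) : Prop :=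
  forall a, A a -> exists P Q : mpoly.mpoly n R, peval Q a != 0 /\
    forall x, A x -> peval Q x != 0 -> f x = peval P x / peval Q x.

(* A space with a sheaf of real-valued functions: sections over an open set U
   are represented by total functions whose values outside U are irrelevant. *)
Record ringed_space (R : realType) := RingedSpace {
  rs_car :> topologicalType;
  rs_sect : set rs_car -> (rs_car -> R) -> Prop
}.

(* phi is an isomorphism of ringed spaces from X onto the subset phi(X) of R^n,
   the latter with its Zariski topology and its sheaf of regular functions. *)
Definition biregular_onto_image (R : realType) (X : ringed_space R) (n : nat)
    (phi : X -> 'rV[R]_n) : Prop :=
  [/\ injective phi,
      (forall U : set X, open U <->
         exists2 W, zariski_open W & U = phi @^-1` W) &
      (forall (U : set X) (f : X -> R), open U ->
         (rs_sect U f <->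
          exists2 g, regular_affine (phi @` U) g &
                     forall x, U x -> f x = g (phi x)))].

(* The canonical topology of a real algebraic variety (hence open, closed,
   closure) is the Zariski topology. *)
Record real_algebraic_variety (R : realType) := RealAlgebraicVariety {
  rav_space :> ringed_space R;
  rav_affine : exists (n : nat) (phi : rav_space -> 'rV[R]_n),
    biregular_onto_image phi /\ zariski_closed (range phi)
}.

Definition algebraic_embedding (R : realType) (V : real_algebraic_variety R)
    (n : nat) (e : V -> 'rV[R]_n) : Prop :=
  zariski_locally_closed (range e) /\ biregular_onto_image e.

(* V with its Euclidean topology: the coarsest topology for which all regular
   functions V -> R are continuous, which is the one induced from R^n by any
   algebraic embedding. *)
Definition global_regular (R : realType) (V : real_algebraic_variety R) : Type :=
  {f : V -> R | rs_sect [set: V] f}.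

Definition regular_values (R : realType) (V : real_algebraic_variety R)
    (x : V) : {ptws global_regular V -> R} := fun f => sval f x.

Definition euclidean (R : realType) (V : real_algebraic_variety R) :
    topologicalType :=
  initial_topology (@regular_values R V).

Definition euclidean_compact (R : realType) (V : real_algebraic_variety R)
    (L : set V) : Prop :=
  @compact (euclidean V) L.

Definition locally_closed (T : topologicalType) (A : set T) : Prop :=
  exists U C : set T, [/\ open U, closed C & A = U `&` C].

Definition stratification (R : realType) (V : real_algebraic_variety R)
    (S : set (set V)) : Prop :=
  [/\ finite_set S, (forall A, S A -> locally_closed A),
      trivIset S id & \bigcup_(A in S) A = [set: V]].

Definition fun_class (R : realType) (T : Type) := set T -> (T -> R) -> Prop.

Definition continuous_class (R : realType) (T : topologicalType) :
  fun_class R T := fun A f => {within A, continuous f}.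

(* Regular functions on a subset A of V: locally on A, restrictions of sections
   of the structure sheaf of V. *)
Definition regular_class (R : realType) (V : real_algebraic_variety R) :
    fun_class R V := fun A f =>
  forall a, A a -> exists (U : set V) (g : V -> R),
    [/\ open U, U a, rs_sect U g & forall x, A x -> U x -> f x = g x].

(* Regular functions on a subset A of the variety V x R^(m x d): locally they
   are quotients of polynomials in regular functions of V and in the
   coordinates of the second factor. *)
Definition regular_class_prod (R : realType) (V : real_algebraic_variety R)
    (m d : nat) : fun_class R (V * 'M[R]_(m, d))%type := fun A f =>
  forall a, A a ->
  exists (U : set V) (q : nat) (c : V -> 'rV[R]_q)
         (P Q : mpoly.mpoly (q + m * d) R),
    let ev (S : mpoly.mpoly (q + m * d) R) (z : V * 'M[R]_(m, d)) :=
      peval S (row_mx (c z.1) (mxvec z.2)) in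
    [/\ open U, U a.1, (forall i, rs_sect U (fun x => c x 0 i)),
        ev Q a != 0 &
        forall z, A z -> U z.1 -> ev Q z != 0 -> f z = ev P z / ev Q z].

(* Functions of class C^k on an open set U: all iterated directional
   derivatives of order at most k exist and are continuous on U. *)
Fixpoint Ck_open (R : realType) (E : normedModType R) (k : nat) (U : set E)
    (f : E -> R) : Prop :=
  (forall x, U x -> {for x, continuous f}) /\
  match k with
  | 0 => True
  | k'.+1 => forall v : E,
      (forall x, U x -> derivable f x v) /\ Ck_open k' U (fun x => 'D_v f x)
  end.

(* Functions of class C^k on an arbitrary subset A of R^N: locally on A,
   restrictions of functions of class C^k on open subsets of R^N. On an open
   subset, or on a submanifold of class C^k, this is the usual notion. *)
Definition Ck_class (R : realType) (E : normedModType R) (k : nat) :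
    fun_class R E := fun A f =>
  forall a, A a -> exists (U : set E) (g : E -> R),
    [/\ open U, U a, Ck_open k U g & forall x, A x -> U x -> f x = g x].

(* A family of subsets of F^m indexed by the points of T: its restriction to
   X is the candidate for a subbundle of the product bundle X x F^m. *)
Definition fibers (R : realType) (K : scalar_kind) (T : Type) (m : nat) :=
  T -> set 'rV[scalar R K]_m.

Definition is_basis (F : nzRingType) (m r : nat) (s : 'M[F]_(r, m))
    (W : set 'rV[F]_m) : Prop :=
  injective (fun a : 'rV[F]_r => a *m s) /\
  W = [set a *m s | a in [set: 'rV[F]_r]].

(* xi is an F-vector subbundle of the product bundle X x F^m whose local frames
   are of the given class; opn is the set of open subsets of the base. *)
Definition subbundle (R : realType) (K : scalar_kind) (T : Type)
    (opn : set (set T)) (cls : fun_class R T) (X : set T) (m : nat)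
    (xi : fibers R K T m) : Prop :=
  forall x, X x -> exists (U : set T) (r : nat) (s : T -> 'M[scalar R K]_(r, m)),
    [/\ opn U, U x,
        (forall i j c, cls (X `&` U) (fun y => real_of_scalar (s y i j) 0 c)) &
        forall y, X y -> U y -> is_basis (s y) (xi y)].

Definition total_space (R : realType) (K : scalar_kind) (T : Type) (X : set T)
    (m : nat) (xi : fibers R K T m) : set (T * 'M[R]_(m, rdim K)) :=
  [set z | X z.1 /\ xi z.1 (vec_of_real z.2)].

(* phi : xi -> eta is fiber-preserving and linear on fibers over X, and the map
   of total spaces that it induces is of the given class. *)
Definition morphism (R : realType) (K : scalar_kind) (T : Type) (m p : nat)
    (cls : fun_class R (T * 'M[R]_(m, rdim K))%type) (X : set T)
    (xi : fibers R K T m) (eta : fibers R K T p)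
    (phi : T -> 'rV[scalar R K]_m -> 'rV[scalar R K]_p) : Prop :=
  [/\ (forall x v, X x -> xi x v -> eta x (phi x v)),
      (forall x (a : scalar R K) u v, X x -> xi x u -> xi x v ->
         phi x (a *: u + v) = a *: phi x u + phi x v) &
      (forall j c, cls (total_space X xi)
         (fun z => real_of_scalar (phi z.1 (vec_of_real z.2) 0 j) 0 c))].

Definition inverse_on (R : realType) (K : scalar_kind) (T : Type) (m p : nat)
    (X : set T) (xi : fibers R K T m) (eta : fibers R K T p)
    (phi : T -> 'rV[scalar R K]_m -> 'rV[scalar R K]_p)
    (psi : T -> 'rV[scalar R K]_p -> 'rV[scalar R K]_m) : Prop :=
  (forall x v, X x -> xi x v -> psi x (phi x v) = v) /\
  (forall x w, X x -> eta x w -> phi x (psi x w) = w).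

Section Bundles.
Variables (R : realType) (K : scalar_kind) (V : real_algebraic_variety R).

Definition top_bundle (X : set V) (m : nat) (xi : fibers R K V m) : Prop :=
  @subbundle R K (euclidean V) open (@continuous_class R (euclidean V)) X m xi.

Definition top_morphism (X : set V) (m p : nat)
    (xi : fibers R K V m) (eta : fibers R K V p)
    (phi : V -> 'rV[scalar R K]_m -> 'rV[scalar R K]_p) : Prop :=
  @morphism R K (euclidean V) m p
    (@continuous_class R (euclidean V * 'M[R]_(m, rdim K))%type)
    X xi eta phi.

(* Z0 is a Zariski open neighborhood of X in the Zariski closure of X: open and
   closure refer to V, not to euclidean V. *)
Definition zariski_nbhd_in_closure (X Z0 : set V) : Prop :=
  X `<=` Z0 /\ exists2 W : set V, open W & Z0 = W `&` closure X.

Definition alg_extension (X Z0 : set V) (m : nat)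
    (xi xit : fibers R K V m) : Prop :=
  [/\ zariski_nbhd_in_closure X Z0,
      subbundle open (@regular_class R V) Z0 xit &
      forall x, X x -> xit x = xi x].

Definition alg_bundle (X : set V) (m : nat) (xi : fibers R K V m) : Prop :=
  top_bundle X xi /\ exists Z0 xit, alg_extension X Z0 xi xit.

Definition alg_morphism (X : set V) (m p : nat)
    (xi : fibers R K V m) (eta : fibers R K V p)
    (phi : V -> 'rV[scalar R K]_m -> 'rV[scalar R K]_p) : Prop :=
  top_morphism X xi eta phi /\
  exists Z0 xit etat phit,
    [/\ alg_extension X Z0 xi xit, alg_extension X Z0 eta etat,
        morphism (@regular_class_prod R V m (rdim K)) Z0 xit etat phit &
        forall x v, X x -> xi x v -> phit x v = phi x v].

Definition euclidean_component (A : set V) (x : V) : set V :=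
  @connected_component (euclidean V) A x.

Definition pa_bundle (S : set (set V)) (X : set V) (m : nat)
    (xi : fibers R K V m) : Prop :=
  top_bundle X xi /\
  forall A x, S A -> (X `&` A) x -> alg_bundle (euclidean_component (X `&` A) x) xi.

Definition pa_morphism (S : set (set V)) (X : set V) (m p : nat)
    (xi : fibers R K V m) (eta : fibers R K V p)
    (phi : V -> 'rV[scalar R K]_m -> 'rV[scalar R K]_p) : Prop :=
  top_morphism X xi eta phi /\
  forall A x, S A -> (X `&` A) x ->
    alg_morphism (euclidean_component (X `&` A) x) xi eta phi.

(* Bundles of class C^k on a compact subset L of V, by means of an algebraic
   embedding e of V. The pullback of xi by the inverse of e : L -> e(L) has the
   fiber xi x at e x, so its extensions to a neighborhood of e(L) in R^n are the
   bundles xih with xih (e x) = xi x for x in L; likewise for morphisms. *)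

Variables (n : nat) (e : V -> 'rV[R]_n).

Definition Ck_extension (k : nat) (L : set V) (U : set 'rV[R]_n) (m : nat)
    (xi : fibers R K V m) (xih : fibers R K 'rV[R]_n m) : Prop :=
  [/\ open U, e @` L `<=` U,
      subbundle open (@Ck_class R 'rV[R]_n k) U xih &
      forall x, L x -> xih (e x) = xi x].

Definition Ck_bundle (k : nat) (L : set V) (m : nat)
    (xi : fibers R K V m) : Prop :=
  top_bundle L xi /\ exists U xih, Ck_extension k L U xi xih.

Definition Ck_morphism (k : nat) (L : set V) (m p : nat)
    (xi : fibers R K V m) (eta : fibers R K V p)
    (phi : V -> 'rV[scalar R K]_m -> 'rV[scalar R K]_p) : Prop :=
  top_morphism L xi eta phi /\
  exists U xih etah phih,
    [/\ Ck_extension k L U xi xih, Ck_extension k L U eta etah,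
        morphism (@Ck_class R ('rV[R]_n * 'M[R]_(m, rdim K))%type k)
          U xih etah phih &
        forall x v, L x -> xi x v -> phih (e x) v = phi x v].

Definition Ck_isomorphic (k : nat) (L : set V) (m p : nat)
    (xi : fibers R K V m) (eta : fibers R K V p) : Prop :=
  exists phi psi,
    [/\ Ck_morphism k L xi eta phi, Ck_morphism k L eta xi psi &
        inverse_on L xi eta phi psi].

Definition Ckpa_bundle_for (S : set (set V)) (k : nat) (L : set V) (m : nat)
    (xi : fibers R K V m) : Prop :=
  pa_bundle S L xi /\ Ck_bundle k L xi.

Definition Ckpa_bundle (k : nat) (L : set V) (m : nat)
    (xi : fibers R K V m) : Prop :=
  exists2 S, stratification S & Ckpa_bundle_for S k L xi.

Definition Ckpa_morphism (k : nat) (L : set V) (m p : nat)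
    (xi : fibers R K V m) (eta : fibers R K V p)
    (phi : V -> 'rV[scalar R K]_m -> 'rV[scalar R K]_p) : Prop :=
  exists2 S, stratification S &
    [/\ Ckpa_bundle_for S k L xi, Ckpa_bundle_for S k L eta,
        Ck_morphism k L xi eta phi & pa_morphism S L xi eta phi].

Definition Ckpa_isomorphic (k : nat) (L : set V) (m p : nat)
    (xi : fibers R K V m) (eta : fibers R K V p) : Prop :=
  exists phi psi,
    [/\ Ckpa_morphism k L xi eta phi, Ckpa_morphism k L eta xi psi &
        inverse_on L xi eta phi psi].

End Bundles.

(* Main.v *)
From mathcomp Require Import all_boot all_order all_algebra.
From mathcomp Require Import all_classical all_reals all_analysis.
From mathcomp Require Import (canonicals) mpoly.
From mathcomp Require Import ring lra.
Require Import Defs.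

(** Bundles are handled through the orthogonal projections onto their fibers. In real
    coordinates these are real matrices commuting with the scalars, they are rational
    functions of any frame, and, being canonical, they glue; so they are of class [C^k], or
    regular, whenever the bundle is ([subbundle_oproj]). A matrix of functions sandwiched
    between two such projections is a morphism of the same class, and if it is bijective on
    the fibers its inverse is again given by a rational formula ([compress_class]). Hence, to
    obtain isomorphisms, it is enough to find matrices of functions of the right class whose
    compressions are bijective ([Ck_isomorphism], [alg_isomorphism]).

    The flexibility of piecewise-algebraic bundles comes from functions like the positive
    part of a polynomial raised to the power [k + 1]: it is of class [C^k], and it is a
    polynomial on each connected component of the locus where the given polynomial does not
    vanish. With [g = 4 r^2 - |y - c|^2] and [g = |y - c|^2 - r^2] one gets weights [a] and
    [b] such that [a] vanishes outside of the ball of radius [2 r] around [c] and [b]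
    vanishes on the ball of radius [r], while [a + b] is positive everywhere. A compact set
    is covered by finitely many balls of radius [r], with [r] as small as desired at each
    center ([bump_cover]). Stratify the variety according to which of the polynomials [g]
    vanish: on a connected component of the intersection of [L] with a stratum all signs are
    constant ([bump_sign]), hence all weights are polynomial.

    Existence. Let [P] be the projection onto the fibers of the given bundle, and [P_i] its
    value at the center [c_i]. The new fiber at [y] is the image of the product of the
    matrices [b_i + a_i P_i]. A factor with [a_i] nonzero involves a projection near to the
    one at [y], so each factor maps a cone around the old fiber into itself
    ([in_cone_step]); this bounds the rank of the product from below. At every [y] of interest
    some [b_i] vanishes, which bounds the rank from above, and shows that the image is
    spanned by a fixed basis of the image of [P_i] multiplied by the later factors
    ([chain_image], [chain_frame_basis]). These frames are of class [C^k], and on the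
    components of the strata they are polynomial. Since the new fiber lies in the cone around
    the old one and has the same dimension, orthogonal projection is an isomorphism
    ([approx_good]).

    Uniqueness. Two solutions are isomorphic by a morphism whose matrix [A] is continuous on
    [L]. Replace [A] by the sum of the constant matrices [A c_i] with weights [a_i]: it is of
    class [C^k] and piecewise polynomial, and near each point it is a positive multiple of a
    matrix close to [A], so its compression is still bijective ([average_good]). *)

Set Implicit Arguments.
Unset Strict Implicit.
Unset Printing Implicit Defensive.

Import Order.TTheory GRing.Theory Num.Theory.
Import numFieldNormedType.Exports.

Local Open Scope classical_set_scope.
Local Open Scope ring_scope.

(** * Real coordinates of vectors over the scalars *)

Section RealCoordinates.
Variables (R : realType) (K : scalar_kind).
Local Notation F := (scalar R K).
Local Notation D := (rdim K).

Lemma real_of_scalarD : {morph @real_of_scalar R K : a b / a + b}.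
Proof.
by case: K => a b; apply/rowP => i; rewrite !mxE //;
  case: i => [[|[|[|[|i]]]] //= Hi]; case: a; case: b.
Qed.

Lemma real_of_scalar0 : @real_of_scalar R K 0 = 0.
Proof. by apply: (addrI (real_of_scalar 0)); rewrite -real_of_scalarD !addr0. Qed.

Lemma real_of_scalar_sum (J : Type) (s : seq J) (f : J -> F) :
  real_of_scalar (\sum_(i <- s) f i) = \sum_(i <- s) real_of_scalar (f i).
Proof. exact: (big_morph _ real_of_scalarD real_of_scalar0). Qed.

Definition real_unit (i : 'I_D) : F := scalar_of_real (delta_mx 0 i).

Definition lscal_mx (a : F) : 'M[R]_D := \matrix_i real_of_scalar (a * real_unit i).

Definition rscal_mx (b : F) : 'M[R]_D := \matrix_i real_of_scalar (real_unit i * b).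

Lemma real_of_scalarMl (a b : F) :
  real_of_scalar (a * b) = real_of_scalar b *m lscal_mx a.
Proof.
rewrite /lscal_mx /real_unit.
case: K a b => [a b|[a1 a2] [b1 b2]|[a1 a2 a3 a4] [b1 b2 b3 b4]]; apply/rowP => i;
  rewrite !mxE !big_ord_recl big_ord0 !mxE /=;
  case: i => [[|[|[|[|i]]]] //= Hi]; rewrite ?mxE -?val_eqE /= ?inordK //= ?eqxx /=.
all: rewrite ?(mul0r, mul1r, mulr0, mulr1, addr0, add0r) //.
1: exact: (@mulrC R).
all: by ring.
Qed.

Lemma real_of_scalarMr (a b : F) :
  real_of_scalar (a * b) = real_of_scalar a *m rscal_mx b.
Proof.
rewrite /rscal_mx /real_unit.
case: K a b => [a b|[a1 a2] [b1 b2]|[a1 a2 a3 a4] [b1 b2 b3 b4]]; apply/rowP => i;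
  rewrite !mxE !big_ord_recl big_ord0 !mxE /=;
  case: i => [[|[|[|[|i]]]] //= Hi]; rewrite ?mxE -?val_eqE /= ?inordK //= ?eqxx /=.
all: rewrite ?(mul0r, mul1r, mulr0, mulr1, addr0, add0r) //.
all: by ring.
Qed.

Lemma rscal_mxE (b : F) d c :
  rscal_mx b d c = (real_of_scalar b *m lscal_mx (real_unit d)) 0 c.
Proof. by rewrite mxE real_of_scalarMl. Qed.

(** Left multiplications by scalars form a family stable under transposition
    because multiplication by the conjugate of [a] is adjoint to
    multiplication by [a]. *)
Lemma tr_lscal_mx (a : F) : exists b : F, (lscal_mx a)^T = lscal_mx b.
Proof.
rewrite /lscal_mx /real_unit.
case: K a => [a|[a1 a2]|[a1 a2 a3 a4]].
- exists a; apply/matrixP => i j; rewrite !mxE !ord1.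
  by rewrite -?val_eqE /= ?inordK.
- exists (complex.Complex a1 (- a2)); apply/matrixP => i j; rewrite !mxE.
  case: i => [[|[|i]] //= Hi]; case: j => [[|[|j]] //= Hj];
    rewrite -?val_eqE /= ?inordK //= ?eqxx /= ?mxE -?val_eqE /= ?inordK //=; ring.
exists (Quaternion a1 (- a2) (- a3) (- a4)); apply/matrixP => i j; rewrite !mxE.
case: i => [[|[|[|[|i]]]] //= Hi]; case: j => [[|[|[|[|j]]]] //= Hj];
  rewrite -?val_eqE /= ?inordK //= ?eqxx /= ?mxE -?val_eqE /= ?inordK //=; ring.
Qed.

Definition unpair m (k : 'I_(m * D)) : 'I_m * 'I_D :=
  enum_val (cast_ord (esym (mxvec_cast m D)) k).

Lemma unpairK m (i : 'I_m) (d : 'I_D) : unpair (mxvec_index i d) = (i, d).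
Proof. by rewrite /unpair cast_ordK enum_rankK. Qed.

Definition block_of r m (G : 'I_r -> 'I_m -> 'M[R]_D) : 'M[R]_(r * D, m * D) :=
  \matrix_(k, l) G (unpair k).1 (unpair l).1 (unpair k).2 (unpair l).2.

Lemma sum_mxvec_index m (f : 'I_(m * D) -> R) :
  \sum_k f k = \sum_i \sum_d f (mxvec_index i d).
Proof.
rewrite (reindex _ (curry_mxvec_bij m D)) pair_bigA /=.
by apply: eq_bigr => -[].
Qed.

Definition rvec m (v : 'rV[F]_m) : 'rV[R]_(m * D) :=
  mxvec (\matrix_(j, c) real_of_scalar (v 0 j) 0 c).

Definition cvec m (t : 'rV[R]_(m * D)) : 'rV[F]_m := vec_of_real (vec_mx t).

Lemma rvecE m (v : 'rV[F]_m) j c : rvec v 0 (mxvec_index j c) = real_of_scalar (v 0 j) 0 c.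
Proof. by rewrite mxvecE mxE. Qed.

Lemma cvecE m (t : 'rV[R]_(m * D)) j c :
  real_of_scalar (cvec t 0 j) 0 c = t 0 (mxvec_index j c).
Proof. by rewrite mxE scalar_of_realK !mxE. Qed.

Lemma rvec_eq m (u v : 'rV[R]_(m * D)) :
  (forall j c, u 0 (mxvec_index j c) = v 0 (mxvec_index j c)) -> u = v.
Proof. by move=> uv; apply/rowP => k; case/mxvec_indexP: k. Qed.

Lemma rvecK m : cancel (@rvec m) (@cvec m).
Proof.
move=> v; apply/rowP => j; apply: (can_inj (@real_of_scalarK R K)).
by apply/rowP => c; rewrite cvecE rvecE.
Qed.

Lemma cvecK m : cancel (@cvec m) (@rvec m).
Proof. by move=> t; apply: rvec_eq => j c; rewrite rvecE cvecE. Qed.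

Lemma rvecD m : {morph @rvec m : u v / u + v}.
Proof.
by move=> u v; apply: rvec_eq => j c; rewrite [RHS]mxE !rvecE mxE real_of_scalarD mxE.
Qed.

Lemma rvec0 m : rvec (0 : 'rV[F]_m) = 0.
Proof. by apply: (addrI (rvec 0)); rewrite -rvecD !addr0. Qed.

Lemma vec_of_realE m (t : 'M[R]_(m, D)) : vec_of_real t = cvec (mxvec t) :> 'rV[F]_m.
Proof. by rewrite /cvec mxvecK. Qed.

Definition scale_mx m (a : F) : 'M[R]_(m * D) :=
  block_of (fun i j : 'I_m => if i == j then lscal_mx a else 0).

Definition real_mx r m (s : 'M[F]_(r, m)) : 'M[R]_(r * D, m * D) :=
  block_of (fun i j => rscal_mx (s i j)).

Lemma mul_block_of r m (G : 'I_r -> 'I_m -> 'M[R]_D) (v : 'rV[F]_r) j c :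
  (rvec v *m block_of G) 0 (mxvec_index j c) =
  (\sum_i real_of_scalar (v 0 i) *m G i j) 0 c.
Proof.
rewrite mxE sum_mxvec_index summxE; apply: eq_bigr => i _.
by rewrite mxE; apply: eq_bigr => d _; rewrite rvecE mxE !unpairK.
Qed.

Lemma rvecZ m (a : F) (v : 'rV[F]_m) : rvec (a *: v) = rvec v *m scale_mx m a.
Proof.
apply: rvec_eq => j c; rewrite mul_block_of (bigD1 j) //= eqxx big1 ?addr0; last first.
  by move=> i /negPf ->; rewrite mulmx0.
by rewrite rvecE mxE real_of_scalarMl.
Qed.

Lemma rvecM r m (v : 'rV[F]_r) (s : 'M[F]_(r, m)) : rvec (v *m s) = rvec v *m real_mx s.
Proof.
apply: rvec_eq => j c; rewrite mul_block_of rvecE mxE real_of_scalar_sum.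
by congr (fun_of_matrix _ _ _); apply: eq_bigr => i _; rewrite real_of_scalarMr.
Qed.

Lemma tr_scale_mx (a : F) : exists b : F, forall m, (scale_mx m a)^T = scale_mx m b.
Proof.
have [b ab] := tr_lscal_mx a; exists b => m.
apply/matrixP => k l; rewrite mxE [LHS]mxE [RHS]mxE eq_sym.
by case: eqP => _; [rewrite -ab [RHS]mxE | rewrite !mxE].
Qed.

(** A real matrix comes from a linear map over the scalars when it commutes with left
    multiplications. This form of linearity is visibly stable under transposition and
    inversion, which spares conjugates and inverses of matrices over a skew field. *)
Definition scalar_linear m p (B : 'M[R]_(m * D, p * D)) :=
  forall a : F, scale_mx m a *m B = B *m scale_mx p a.

Lemma scalar_linearM m p q (A : 'M[R]_(m * D, p * D)) (B : 'M[R]_(p * D, q * D)) :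
  scalar_linear A -> scalar_linear B -> scalar_linear (A *m B).
Proof. by move=> hA hB a; rewrite mulmxA hA -mulmxA hB mulmxA. Qed.

Lemma scalar_linear1 m : scalar_linear (1%:M : 'M[R]_(m * D)).
Proof. by move=> a; rewrite mulmx1 mul1mx. Qed.

Lemma scalar_linearD m p (A B : 'M[R]_(m * D, p * D)) :
  scalar_linear A -> scalar_linear B -> scalar_linear (A + B).
Proof. by move=> hA hB a; rewrite mulmxDr mulmxDl hA hB. Qed.

Lemma scalar_linearZ m p (c : R) (A : 'M[R]_(m * D, p * D)) :
  scalar_linear A -> scalar_linear (c *: A).
Proof. by move=> hA a; rewrite -scalemxAr -scalemxAl hA. Qed.

Lemma scalar_linear0 m p : scalar_linear (0 : 'M[R]_(m * D, p * D)).
Proof. by move=> a; rewrite mulmx0 mul0mx. Qed.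

Lemma scalar_linearB m p (A B : 'M[R]_(m * D, p * D)) :
  scalar_linear A -> scalar_linear B -> scalar_linear (A - B).
Proof. by move=> hA hB; rewrite -scaleN1r; apply/scalar_linearD/scalar_linearZ. Qed.

Lemma scalar_linear_tr m p (A : 'M[R]_(m * D, p * D)) :
  scalar_linear A -> scalar_linear A^T.
Proof.
move=> hA a; apply: trmx_inj; rewrite !trmx_mul trmxK.
by have [b hb] := tr_scale_mx a; rewrite !hb hA.
Qed.

Lemma scalar_linear_inv m (A : 'M[R]_(m * D)) :
  A \in unitmx -> scalar_linear A -> scalar_linear (invmx A).
Proof.
move=> uA hA a; rewrite -[LHS]mul1mx -{1}(mulVmx uA) -!mulmxA.
by rewrite [A *m _]mulmxA -hA -[_ *m _ *m invmx A]mulmxA mulmxV // mulmx1.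
Qed.

Definition linmap m p (B : 'M[R]_(m * D, p * D)) (v : 'rV[F]_m) : 'rV[F]_p :=
  cvec (rvec v *m B).

Lemma rvec_linmap m p (B : 'M[R]_(m * D, p * D)) v : rvec (linmap B v) = rvec v *m B.
Proof. exact: cvecK. Qed.

Lemma linmapP m p (B : 'M[R]_(m * D, p * D)) (a : F) u v :
  scalar_linear B -> linmap B (a *: u + v) = a *: linmap B u + linmap B v.
Proof.
move=> hB; apply: (can_inj (@rvecK p)).
by rewrite rvec_linmap !rvecD !rvecZ !rvec_linmap mulmxDl -!mulmxA hB.
Qed.

Lemma scalar_linear_mx m p (B : 'M[R]_(m * D, p * D)) r (a : 'rV[F]_r) (s : 'M[F]_(r, m)) :
  scalar_linear B ->
  rvec (a *m s) *m B = rvec (a *m \matrix_i linmap B (row i s)).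
Proof.
move=> hB; rewrite [a *m s]mulmx_sum_row [a *m _]mulmx_sum_row.
have rvec_sum q (f : 'I_r -> 'rV[F]_q) : rvec (\sum_i f i) = \sum_i rvec (f i).
  exact: (big_morph _ (@rvecD q) (@rvec0 q)).
rewrite !rvec_sum mulmx_suml; apply: eq_bigr => i _.
by rewrite rowK !rvecZ rvec_linmap -!mulmxA hB.
Qed.

(** * Orthogonal projections *)

Section OrthogonalProjection.
Variable m : nat.
Implicit Types (W : set 'rV[F]_m) (P : 'M[R]_(m * D)).

Definition is_oproj W P :=
  [/\ P^T = P, P *m P = P & forall v, W v <-> rvec v *m P = rvec v].

Definition oproj W : 'M[R]_(m * D) := xget 0 (is_oproj W).

Lemma is_oproj_unique W P Q : is_oproj W P -> is_oproj W Q -> P = Q.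
Proof.
have abs (A B : 'M[R]_(m * D)) : is_oproj W A -> is_oproj W B -> A *m B = A.
  move=> [_ AA WA] [_ _ WB]; apply/row_matrixP => i; rewrite row_mul.
  have /WB : W (cvec (row i A)) by rewrite WA cvecK -row_mul AA.
  by rewrite cvecK.
move=> hP hQ; have [PT _ _] := hP; have [QT _ _] := hQ.
by rewrite -(abs _ _ hP hQ) -{1}PT -{1}QT -trmx_mul (abs _ _ hQ hP).
Qed.

Lemma oproj_eq W P : is_oproj W P -> oproj W = P.
Proof.
by move=> WP; apply: (is_oproj_unique _ WP); apply: (xgetPex 0); exists P.
Qed.

Lemma dot_eq0 q (v : 'rV[R]_q) : v *m v^T = 0 -> v = 0.
Proof.
move=> /(congr1 (fun M : 'M[R]_1 => M 0 0)); rewrite !mxE => /eqP.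
rewrite psumr_eq0 => [/allP v0|j _]; last by rewrite mxE -expr2 sqr_ge0.
apply/rowP => j; have := v0 j (mem_index_enum _).
by rewrite !mxE mulf_eq0 orbb => /eqP.
Qed.

Lemma gram_unit p q (A : 'M[R]_(p, q)) :
  A *m A^T \in unitmx <-> forall v : 'rV_p, v *m A = 0 -> v = 0.
Proof.
split=> [uA v vA|inj].
  by rewrite -(mulmxK uA v) mulmxA vA !mul0mx.
rewrite -row_free_unit; apply/inj_row_free => v vA; apply: inj.
by apply: dot_eq0; rewrite trmx_mul mulmxA -[v *m A *m _]mulmxA vA mul0mx.
Qed.

Lemma basis_injP r (s : 'M[F]_(r, m)) :
  injective (fun a : 'rV[F]_r => a *m s) <->
  forall v : 'rV[R]_(r * D), v *m real_mx s = 0 -> v = 0.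
Proof.
split=> [inj v|inj a b ab].
  rewrite -{1}[v]cvecK -rvecM => v0; rewrite -[v]cvecK -(rvec0 r); congr rvec.
  by apply: inj; rewrite mul0mx; apply: (can_inj (@rvecK m)); rewrite rvec0.
apply: (can_inj (@rvecK r)); apply/eqP; rewrite -subr_eq0; apply/eqP/inj.
by rewrite mulmxBl -!rvecM ab subrr.
Qed.

(** Inverse and transposition are taken over the reals, so the projection is a rational
    function of the real coordinates of the frame, whatever the scalars. *)
Lemma oproj_basis r (s : 'M[F]_(r, m)) W : is_basis s W ->
  let S := real_mx s in
  S *m S^T \in unitmx /\ is_oproj W (S^T *m invmx (S *m S^T) *m S).
Proof.
move=> [/basis_injP inj ->] S; have uS : S *m S^T \in unitmx by apply/gram_unit.
split=> //; split.
- by rewrite !trmx_mul trmxK trmx_inv trmx_mul trmxK mulmxA.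
- by rewrite !mulmxA -[_ *m S *m S^T]mulmxA mulmxKV.
move=> v; split=> [[a _ <-]|vP].
  by rewrite rvecM !mulmxA -[_ *m S *m S^T]mulmxA mulmxK.
exists (cvec (rvec v *m (S^T *m invmx (S *m S^T)))) => //.
by apply: (can_inj (@rvecK m)); rewrite rvecM cvecK -[RHS]vP !mulmxA.
Qed.

Lemma oprojP W P : is_oproj W P -> is_oproj W (oproj W).
Proof. by move=> WP; rewrite (oproj_eq WP). Qed.

(** An orthogonal projection onto a subspace commutes with the scalars since both the
    subspace and its orthogonal complement are stable under them. *)
Lemma oproj_linear W P : (forall (a : F) v, W v -> W (a *: v)) ->
  is_oproj W P -> scalar_linear P.
Proof.
move=> Wa [PT PP WP].
have stab (a : F) : P *m scale_mx m a *m P = P *m scale_mx m a.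
  apply/row_matrixP => i; rewrite !row_mul -[row i P]cvecK -rvecZ.
  by apply/WP/Wa/WP; rewrite cvecK -row_mul PP.
move=> a; have [b hb] := tr_scale_mx a.
have := congr1 trmx (stab b); rewrite !trmx_mul PT -{1 2}hb trmxK mulmxA => <-.
exact: stab.
Qed.

Lemma basis_stable r (s : 'M[F]_(r, m)) W (a : F) v : is_basis s W -> W v -> W (a *: v).
Proof. by move=> [_ ->] [b _ <-]; exists (a *: b); rewrite // scalemxAl. Qed.

End OrthogonalProjection.
End RealCoordinates.

(** * Algebras of functions *)

(** Functions of class [C^k] and regular functions, on arbitrary subsets of the ambient
    space, enter the proofs only through these properties. The last one makes the locus
    where a matrix of functions is invertible an open one, for the Euclidean or for the
    Zariski topology. *)
Record function_algebra (R : realType) (T : Type) (opn : set (set T))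
    (cls : fun_class R T) : Prop := FunctionAlgebra {
  cls_sub : forall A B f, A `<=` B -> cls B f -> cls A f;
  cls_ext : forall A f g, (forall x, A x -> f x = g x) -> cls A f -> cls A g;
  cls_cst : forall A a, cls A (fun=> a);
  cls_add : forall A f g, cls A f -> cls A g -> cls A (fun x => f x + g x);
  cls_mul : forall A f g, cls A f -> cls A g -> cls A (fun x => f x * g x);
  cls_inv : forall A f, cls A f -> (forall x, A x -> f x != 0) ->
    cls A (fun x => (f x)^-1);
  cls_local : forall A f,
    (forall a, A a -> exists U, [/\ opn U, U a & cls (A `&` U) f]) -> cls A f;
  cls_neq0 : forall A f, cls A f ->
    exists2 W, opn W & forall x, A x -> W x <-> f x != 0
}.

Section MatricesOfFunctions.
Variables (R : realType) (T : Type) (opn : set (set T)) (cls : fun_class R T).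
Hypothesis alg : function_algebra opn cls.

Definition mx_class (A : set T) p q (M : T -> 'M[R]_(p, q)) :=
  forall i j, cls A (fun x => M x i j).

Lemma cls_sum A (I : Type) (s : seq I) (f : I -> T -> R) :
  (forall i, cls A (f i)) -> cls A (fun x => \sum_(i <- s) f i x).
Proof.
move=> hf; elim: s => [|i s IH].
  by apply: (cls_ext alg _ (cls_cst alg A 0)) => x _; rewrite big_nil.
by apply: (cls_ext alg _ (cls_add alg (hf i) IH)) => x _; rewrite big_cons.
Qed.

Lemma cls_prod A (I : Type) (s : seq I) (f : I -> T -> R) :
  (forall i, cls A (f i)) -> cls A (fun x => \prod_(i <- s) f i x).
Proof.
move=> hf; elim: s => [|i s IH].
  by apply: (cls_ext alg _ (cls_cst alg A 1)) => x _; rewrite big_nil.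
by apply: (cls_ext alg _ (cls_mul alg (hf i) IH)) => x _; rewrite big_cons.
Qed.

Section On.
Variable A : set T.

Lemma mx_class_ext p q (M N : T -> 'M[R]_(p, q)) :
  (forall x, A x -> M x = N x) -> mx_class A M -> mx_class A N.
Proof. by move=> MN hM i j; apply: (cls_ext alg _ (hM i j)) => x /MN ->. Qed.

Lemma mx_class_cst p q (M : 'M[R]_(p, q)) : mx_class A (fun=> M).
Proof. by move=> i j; apply: (cls_cst alg). Qed.

Lemma mx_classD p q (M N : T -> 'M[R]_(p, q)) :
  mx_class A M -> mx_class A N -> mx_class A (fun x => M x + N x).
Proof.
by move=> hM hN i j; apply: (cls_ext alg _ (cls_add alg (hM i j) (hN i j))) => x _; rewrite mxE.
Qed.

Lemma mx_classZ p q f (M : T -> 'M[R]_(p, q)) :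
  cls A f -> mx_class A M -> mx_class A (fun x => f x *: M x).
Proof.
by move=> hf hM i j; apply: (cls_ext alg _ (cls_mul alg hf (hM i j))) => x _; rewrite mxE.
Qed.

Lemma mx_classB p q (M N : T -> 'M[R]_(p, q)) :
  mx_class A M -> mx_class A N -> mx_class A (fun x => M x - N x).
Proof.
move=> hM hN; apply: (mx_class_ext _ (mx_classD hM (mx_classZ (cls_cst alg A (-1)) hN))) => x _.
by rewrite scaleN1r.
Qed.

Lemma mx_classM p q r (M : T -> 'M[R]_(p, q)) (N : T -> 'M[R]_(q, r)) :
  mx_class A M -> mx_class A N -> mx_class A (fun x => M x *m N x).
Proof.
move=> hM hN i j; have h k := cls_mul alg (hM i k) (hN k j).
by apply: (cls_ext alg _ (cls_sum _ h)) => x _; rewrite mxE.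
Qed.

Lemma mx_class_tr p q (M : T -> 'M[R]_(p, q)) :
  mx_class A M -> mx_class A (fun x => (M x)^T).
Proof. by move=> hM i j; apply: (cls_ext alg _ (hM j i)) => x _; rewrite mxE. Qed.

Lemma cls_det p (M : T -> 'M[R]_p) : mx_class A M -> cls A (fun x => \det (M x)).
Proof.
move=> hM; apply: cls_sum => s. apply: (cls_mul alg); first exact: (cls_cst alg).
by apply: cls_prod => i; apply: hM.
Qed.

Lemma mx_class_inv p (M : T -> 'M[R]_p) : mx_class A M ->
  (forall x, A x -> M x \in unitmx) -> mx_class A (fun x => invmx (M x)).
Proof.
move=> hM uM; apply: (@mx_class_ext _ _ (fun x => (\det (M x))^-1 *: \adj (M x))).
  by move=> x /uM uMx; rewrite /invmx uMx.
apply: mx_classZ => [|i j].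
  by apply: (cls_inv alg) => [|x /uM]; [exact: cls_det|rewrite unitmxE unitfE].
apply: (@cls_ext _ _ _ _ alg _ (fun x => cofactor (M x) j i)); first by move=> x _; rewrite mxE.
apply: (cls_mul alg); first exact: (cls_cst alg).
by apply: cls_det => k l; apply: (cls_ext alg _ (hM (lift j k) (lift i l))) => x _; rewrite !mxE.
Qed.

End On.

Lemma mx_class_sub A B p q (M : T -> 'M[R]_(p, q)) : A `<=` B -> mx_class B M -> mx_class A M.
Proof. by move=> AB hM i j; apply: (cls_sub alg _ (hM i j)). Qed.

End MatricesOfFunctions.

(** * Subbundles, morphisms and matrices of functions *)

Section BundlesAndProjections.
Variables (R : realType) (K : scalar_kind) (T : Type) (opn : set (set T)) (cls : fun_class R T).
Local Notation F := (scalar R K).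
Local Notation D := (rdim K).
Hypothesis alg : function_algebra opn cls.

Lemma mx_class_real A r m (s : T -> 'M[F]_(r, m)) :
  (forall i j c, cls A (fun x => real_of_scalar (s x i j) 0 c)) ->
  mx_class cls A (fun x => real_mx (s x)).
Proof.
move=> hs k l; set i := (unpair k).1; set j := (unpair l).1.
have : mx_class cls A (fun x => real_of_scalar (s x i j) *m
    lscal_mx (real_unit R (unpair k).2)).
  by apply: (mx_classM alg); [move=> a b; rewrite ord1|apply: (mx_class_cst alg)].
move=> /(_ 0 (unpair l).2); apply: (cls_ext alg) => x _.
by rewrite /real_mx /block_of mxE rscal_mxE.
Qed.

(** A subbundle is recovered from the orthogonal projections onto its fibers; unlike
    frames they are canonical, hence defined globally and compatible between different
    classes of functions. *)
Lemma subbundle_oproj X m (xi : fibers R K T m) : subbundle opn cls X xi ->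
  [/\ mx_class cls X (fun x => oproj (xi x)),
      forall x, X x -> is_oproj (xi x) (oproj (xi x)) &
      forall x, X x -> scalar_linear (oproj (xi x))].
Proof.
move=> hxi.
have pw x : X x -> is_oproj (xi x) (oproj (xi x)) /\ scalar_linear (oproj (xi x)).
  move=> Xx; have [U [r [s [_ Ux _ /(_ x Xx Ux) sb]]]] := hxi x Xx.
  have [_ /oprojP Po] := oproj_basis sb; split=> //.
  by apply: oproj_linear Po => a v; apply: basis_stable sb.
split; try by move=> x /pw [].
move=> i j; apply: (cls_local alg) => x Xx.
have [U [r [s [Uo Ux cs sb]]]] := hxi x Xx; exists U; split=> //.
pose S y := real_mx (s y); have hS : mx_class cls (X `&` U) S by exact: mx_class_real.
have hST := mx_class_tr alg hS.
have uS y : (X `&` U) y -> S y *m (S y)^T \in unitmx.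
  by move=> [Xy Uy]; have [] := oproj_basis (sb y Xy Uy).
have := mx_classM alg (mx_classM alg hST (mx_class_inv alg (mx_classM alg hS hST) uS)) hS.
move=> /(_ i j); apply: (cls_ext alg) => y [Xy Uy].
by have [_ /oproj_eq ->] := oproj_basis (sb y Xy Uy).
Qed.

(** The link between a class of functions on the base and one on total spaces on which
    morphisms given by matrices of functions rest. *)
Definition linear_in_class m (pcls : fun_class R (T * 'M[R]_(m, D))%type) :=
  forall (X : set T) (A : set (T * 'M[R]_(m, D))%type) (w : T -> 'cV[R]_(m * D)),
    (forall z, A z -> X z.1) -> mx_class cls X w ->
    pcls A (fun z => (mxvec z.2 *m w z.1) 0 0).

Lemma linmap_coord m p (B : 'M[R]_(m * D, p * D)) (t : 'M[R]_(m, D)) j c :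
  real_of_scalar (linmap B (vec_of_real t) 0 j) 0 c = (mxvec t *m B) 0 (mxvec_index j c).
Proof. by rewrite cvecE vec_of_realE cvecK. Qed.

Lemma matrix_morphism m p (pcls : fun_class R (T * 'M[R]_(m, D))%type) X
    (xi : fibers R K T m) (eta : fibers R K T p) (B : T -> 'M[R]_(m * D, p * D)) :
  linear_in_class pcls -> mx_class cls X B ->
  (forall x, X x -> scalar_linear (B x)) ->
  (forall x v, X x -> xi x v -> eta x (linmap (B x) v)) ->
  morphism pcls X xi eta (fun x => linmap (B x)).
Proof.
move=> lin hB lB Bxi; split=> // [x a u v Xx _ _|j c]; first exact/linmapP/lB.
rewrite (_ : (fun z => _) = fun z => (mxvec z.2 *m col (mxvec_index j c) (B z.1)) 0 0).
  apply: (lin X _ (fun x => col (mxvec_index j c) (B x))) => [z []//|i k].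
  by apply: (cls_ext alg _ (hB i (mxvec_index j c))) => x _; rewrite mxE.
apply/funext => z; rewrite linmap_coord !mxE.
by apply: eq_bigr => k _; rewrite [in RHS]mxE.
Qed.

End BundlesAndProjections.

Section IsomorphismFromProjections.
Variables (R : realType) (p q : nat).
Variables (P : 'M[R]_p) (Q : 'M[R]_q) (B : 'M[R]_(p, q)).

(** If [B] maps the image of [P] bijectively onto the image of [Q], then [gram_mx] is
    invertible and [coinverse_mx] is the inverse bijection, extended by zero to the
    orthogonal complement. The formula is rational in the entries of [P] and [B], so it
    preserves algebras of functions and makes sense near the points of interest even if
    bijectivity is known at these points only. *)
Definition gram_mx := B *m B^T + (1%:M - P).
Definition coinverse_mx := B^T *m invmx gram_mx.

Hypotheses (PT : P^T = P) (PP : P *m P = P) (QT : Q^T = Q) (QQ : Q *m Q = Q).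
Hypotheses (PB : P *m B = B) (BQ : B *m Q = B).

Lemma BTP : B^T *m P = B^T. Proof. by rewrite -{1}PT -trmx_mul PB. Qed.

Lemma gram_unitmx : \rank B = \rank P -> gram_mx \in unitmx.
Proof.
move=> rB; rewrite -row_free_unit; apply/inj_row_free => v vN.
(* P commutes with the Gram matrix, so both parts of v N vanish *)
have vP : v *m (B *m B^T) = 0.
  have := congr1 (mulmx^~ P) vN.
  by rewrite mul0mx -mulmxA /gram_mx !mulmxDl mul1mx mulNmx PP subrr addr0 -mulmxA BTP.
have vPv : v *m P = v.
  by move: vN; rewrite /gram_mx mulmxDr vP add0r mulmxBr mulmx1 => /eqP; rewrite subr_eq0 => /eqP.
have vB : v *m B = 0.
  by apply: dot_eq0; rewrite trmx_mul mulmxA -[v *m B *m _]mulmxA vP mul0mx.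
have PleB : (P <= B^T)%MS.
  have BleP : (B^T <= P)%MS by rewrite -{1}BTP submxMl.
  by rewrite -(geq_leqif (mxrank_leqif_sup BleP)) mxrank_tr rB.
have : (v <= B^T)%MS by apply: submx_trans PleB; rewrite -vPv submxMl.
case/submxP=> u vu; apply: dot_eq0; rewrite {2}vu trmx_mul trmxK mulmxA vB mul0mx //.
Qed.

Lemma mul_coinverse : gram_mx \in unitmx -> B *m coinverse_mx = P.
Proof.
move=> uN; rewrite /coinverse_mx mulmxA -(mulmxK uN P); congr (_ *m _).
by rewrite /gram_mx mulmxDr mulmxBr mulmx1 PP subrr addr0 mulmxA PB.
Qed.

Lemma coinverse_P : gram_mx \in unitmx -> coinverse_mx *m P = coinverse_mx.
Proof.
move=> uN; apply: (can_inj (mulmxK uN)).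
have PN : P *m gram_mx = gram_mx *m P.
  by rewrite /gram_mx mulmxDr mulmxDl mulmxBr mulmxBl mulmx1 mul1mx !mulmxA PB -mulmxA BTP.
by rewrite -mulmxA PN /coinverse_mx mulmxA !mulmxKV // BTP.
Qed.

Lemma coinverse_mul : gram_mx \in unitmx -> \rank B = \rank Q -> coinverse_mx *m B = Q.
Proof.
move=> uN rB; have /submxP[X QX] : (Q <= B)%MS.
  have BleQ : (B <= Q)%MS by rewrite -{1}BQ submxMl.
  by rewrite -(geq_leqif (mxrank_leqif_sup BleQ)) rB.
apply/eqP; rewrite -subr_eq0; apply/eqP.
have QBT : Q *m B^T = B^T by rewrite -{1}QT -trmx_mul BQ.
rewrite -[LHS]mul1mx -[X in X *m _](subrK Q) mulmxDl.
have -> : (1%:M - Q) *m (coinverse_mx *m B - Q) = 0.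
  by rewrite mulmxBl mul1mx mulmxBr /coinverse_mx !mulmxA QBT QQ subrr.
by rewrite add0r {1}QX -mulmxA mulmxBr mulmxA mul_coinverse // PB BQ subrr mulmx0.
Qed.
End IsomorphismFromProjections.

(** * Functions of class C^k *)

Section IteratedDerivatives.
Variables (R : realType) (E : normedModType R).
Implicit Types (U W : set E) (f g : E -> R) (k : nat).

Lemma Ck_open_continuous k U f : Ck_open k U f -> forall x, U x -> {for x, continuous f}.
Proof. by case: k => [|k] []. Qed.

Lemma Ck_open_sub k U W f : W `<=` U -> Ck_open k U f -> Ck_open k W f.
Proof.
move=> WU; elim: k f => [|k IH] f [cf hf]; split=> //; try by move=> x /WU /cf.
by move=> v; have [df hdf] := hf v; split=> [x /WU /df//|]; apply: IH.
Qed.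

Lemma Ck_open_pred k U f : Ck_open k.+1 U f -> Ck_open k U f.
Proof.
elim: k f => [|k IH] f [cf hf]; split=> // v.
by have [df hdf] := hf v; split=> //; apply: IH.
Qed.

Lemma Ck_open_le j k U f : (j <= k)%N -> Ck_open k U f -> Ck_open j U f.
Proof.
by elim: k => [|k IH]; rewrite leq_eqVlt => /predU1P[->//|//] jk /Ck_open_pred; apply: IH.
Qed.

Lemma Ck_open_ext k U f g : open U -> (forall x, U x -> f x = g x) ->
  Ck_open k U f -> Ck_open k U g.
Proof.
move=> oU; elim: k f g => [|k IH] f g fg [cf hf].
  split=> // x Ux; have nfg : \near x, f x = g x.
    by apply: filterS (open_nbhs_nbhs (conj oU Ux)) => y /fg.
  rewrite /prop_for /continuous_at -(fg x Ux); apply: cvg_trans (cf x Ux).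
  exact: near_eq_cvg.
have nfg x : U x -> \near x, f x = g x.
  by move=> Ux; apply: filterS (open_nbhs_nbhs (conj oU Ux)) => y /fg.
split=> [x Ux|v].
  rewrite /prop_for /continuous_at -(fg x Ux); apply: cvg_trans (cf x Ux).
  by apply: near_eq_cvg; exact: nfg.
have [df hdf] := hf v; split=> [x Ux|].
  exact: near_eq_derivable (nfg x Ux) (df x Ux).
by apply: IH hdf => x Ux; apply: near_eq_derive; exact: nfg.
Qed.

Lemma Ck_open_cst k U (a : R) : Ck_open k U (fun=> a).
Proof.
elim: k a => [|k IH] a; first by split=> // x _; exact: cst_continuous.
split=> [x _|v]; first exact: cst_continuous.
split=> [x _|]; first exact: derivable_cst.
have -> : (fun x => 'D_v (fun=> a) x) = (fun=> 0 : R); last exact: IH.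
by apply/funext => x; exact: derive_cst.
Qed.

Lemma Ck_open_add k U f g : open U -> Ck_open k U f -> Ck_open k U g ->
  Ck_open k U (fun x => f x + g x).
Proof.
move=> oU; elim: k f g => [|k IH] f g [cf hf] [cg hg].
  by split=> // x Ux; apply: continuousD; [exact: cf|exact: cg].
split=> [x Ux|v]; first by apply: continuousD; [exact: cf|exact: cg].
have [df hdf] := hf v; have [dg hdg] := hg v.
split=> [x Ux|]; first exact: derivableD (df x Ux) (dg x Ux).
apply: (Ck_open_ext oU _ (IH _ _ hdf hdg)) => x Ux.
by rewrite (deriveD (df x Ux) (dg x Ux)).
Qed.

Lemma Ck_open_mul k U f g : open U -> Ck_open k U f -> Ck_open k U g ->
  Ck_open k U (fun x => f x * g x).
Proof.
move=> oU; elim: k f g => [|k IH] f g hf hg.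
  split=> // x Ux; apply: continuousM; first exact: (Ck_open_continuous hf Ux).
  exact: (Ck_open_continuous hg Ux).
split=> [x Ux|v].
  apply: continuousM; first exact: (Ck_open_continuous hf Ux).
  exact: (Ck_open_continuous hg Ux).
have [_ /(_ v)[df hdf]] := hf; have [_ /(_ v)[dg hdg]] := hg.
split=> [x Ux|]; first exact: derivableM (df x Ux) (dg x Ux).
apply: (Ck_open_ext oU _ (Ck_open_add oU (IH _ _ (Ck_open_pred hf) hdg)
  (IH _ _ (Ck_open_pred hg) hdf))) => x Ux.
by rewrite (deriveM (df x Ux) (dg x Ux)).
Qed.

Lemma Ck_open_inv k U f : open U -> Ck_open k U f -> (forall x, U x -> f x != 0) ->
  Ck_open k U (fun x => (f x)^-1).
Proof.
move=> oU hf f0; elim: k hf => [|k IH] hf.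
  by split=> // x Ux; apply: continuousV; [exact: f0|exact: (Ck_open_continuous hf Ux)].
split=> [x Ux|v].
  by apply: continuousV; [exact: f0|exact: (Ck_open_continuous hf Ux)].
have [_ /(_ v)[df hdf]] := hf.
split=> [x Ux|]; first exact: derivableV (f0 x Ux) (df x Ux).
have hi := IH (Ck_open_pred hf).
apply: (Ck_open_ext oU _ (Ck_open_mul oU (Ck_open_mul oU (Ck_open_mul oU
  (Ck_open_cst k U (-1)) hi) hi) hdf)) => x Ux.
by rewrite (deriveV (f0 x Ux) (df x Ux)) -[RHS]/(- f x ^- 2 * 'D_v f x) mulN1r !mulNr expr2 invfM.
Qed.

Lemma Ck_function_algebra k : function_algebra open (@Ck_class R E k).
Proof.
split.
- move=> A B f AB hf a /AB /hf[U [g [oU Ua hg fg]]].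
  by exists U, g; split=> // x /AB; apply: fg.
- move=> A f g fg hf a /hf[U [h [oU Ua hh fh]]].
  by exists U, h; split=> // x Ax Ux; rewrite -fg ?fh.
- move=> A a x _; exists setT, (fun=> a); split=> //; first exact: openT.
  exact: Ck_open_cst.
- move=> A f g hf hg a Aa.
  have [U [f' [oU Ua hf' ff']]] := hf a Aa; have [W [g' [oW Wa hg' gg']]] := hg a Aa.
  have oUW := openI oU oW.
  exists (U `&` W), (fun x => f' x + g' x); split=> // [|x Ax [Ux Wx]]; last by rewrite ff' ?gg'.
  by apply: Ck_open_add => //; [apply: Ck_open_sub hf'|apply: Ck_open_sub hg'] => x [].
- move=> A f g hf hg a Aa.
  have [U [f' [oU Ua hf' ff']]] := hf a Aa; have [W [g' [oW Wa hg' gg']]] := hg a Aa.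
  have oUW := openI oU oW.
  exists (U `&` W), (fun x => f' x * g' x); split=> // [|x Ax [Ux Wx]]; last by rewrite ff' ?gg'.
  by apply: Ck_open_mul => //; [apply: Ck_open_sub hf'|apply: Ck_open_sub hg'] => x [].
- move=> A f hf f0 a Aa; have [U [f' [oU Ua hf' ff']]] := hf a Aa.
  have oUW : open (U `&` [set x | f' x != 0]).
    rewrite openE => x [Ux f'x]; apply: filterI; first exact: open_nbhs_nbhs.
    exact: (cvgr_neq0 (f' x) (Ck_open_continuous hf' Ux)).
  exists (U `&` [set x | f' x != 0]), (fun x => (f' x)^-1); split=> //.
  + by split=> //=; rewrite -ff' // f0.
  + by apply: Ck_open_inv => // [|x []//]; apply: Ck_open_sub hf' => x [].
  + by move=> x Ax [Ux _]; rewrite ff'.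
- move=> A f hf a Aa; have [U [oU Ua hU]] := hf a Aa.
  have [W [g [oW Wa hg fg]]] := hU a (conj Aa Ua).
  exists (U `&` W), g; split=> // [||x Ax [Ux Wx]]; [exact: openI| |exact: fg].
  by apply: Ck_open_sub hg => x [].
move=> A f hf.
have /choice[W hW] : forall a, exists W : set E,
    A a -> f a != 0 -> [/\ open W, W a & forall x, A x -> W x -> f x != 0].
  move=> a; case: (pselect (A a)) => [Aa|]; last by exists setT.
  case: (eqVneq (f a) 0) => [_|fa]; first by exists setT.
  have [U [f' [oU Ua hf' ff']]] := hf a Aa.
  exists (U `&` [set x | f' x != 0]) => _ _; split.
  + rewrite openE => x [Ux f'x]; apply: filterI; first exact: open_nbhs_nbhs.
    exact: (cvgr_neq0 (f' x) (Ck_open_continuous hf' Ux)).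
  + by split=> //=; rewrite -ff'.
  + by move=> x Ax [Ux /=]; rewrite ff'.
exists (\bigcup_(a in [set a | A a /\ f a != 0]) W a).
  by apply: bigcup_open => a [Aa fa]; have [] := hW a Aa fa.
move=> x Ax; split=> [[a [Aa fa] Wx]|fx].
  by have [_ _ /(_ x Ax Wx)] := hW a Aa fa.
by exists x => //; have [] := hW x Ax fx.
Qed.

End IteratedDerivatives.

Section ExamplesOfCkFunctions.
Variables (R : realType) (E : normedModType R).
Implicit Types (U : set E) (f g : E -> R) (k : nat).

Lemma Ck_open_linear k U f : continuous f ->
  (forall x v (h : R), f (h *: v + x) = h * f v + f x) -> Ck_open k U f.
Proof.
move=> cf lf.
have df x v : (fun h : R => h^-1 *: ((f \o shift x) (h *: v) - f x)) @ 0^' --> f v.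
  apply: cvg_trans (@cvg_cst _ (f v) _ (0^' : set_system R) _); apply: near_eq_cvg.
  near=> h; rewrite /= lf addrK -[RHS]/(h^-1 * (h * f v)) mulKf //.
  by near: h; exact: nbhs_dnbhs_neq.
case: k => [|k]; first by split=> // x _; exact: cf.
split=> [x _|v]; first exact: cf.
split=> [x _|]; first by apply/cvg_ex; exists (f v); exact: df.
have -> : (fun x => 'D_v f x) = (fun=> f v); last exact: Ck_open_cst.
by apply/funext => x; apply/cvg_lim => //; exact: df.
Unshelve. all: by end_near.
Qed.

(** [pospow k.+1] is of class [C^k], and polynomial on either side of zero. *)
Definition pospow k (t : R) : R := Num.max 0 t ^+ k.

Lemma pospow_continuous k : continuous (pospow k).
Proof.
move=> t; rewrite -[continuous_at _ _]/{for t,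
  continuous ((fun u : R => u ^+ k) \o (fun t => Num.max 0 t))}.
apply: continuous_comp; last exact: exprn_continuous.
by apply: (@continuous_max R R (fun=> 0) id); [exact: cst_continuous|exact: cvg_id].
Qed.

Lemma pospow_derive k (t : R) : is_derive t 1 (pospow k.+2) (k.+2%:R * pospow k.+1 t).
Proof.
have [t0|t0|->] := ltgtP t 0.
- have nf : {near t, (fun=> 0) =1 pospow k.+2}.
    near=> u; rewrite /pospow max_l ?expr0n //.
    by apply: ltW; near: u; exact: lt_nbhsl.
  rewrite /pospow max_l ?ltW // expr0n mulr0.
  apply: DeriveDef; first exact: near_eq_derivable nf (derivable_cst _ _ _).
  by rewrite -(near_eq_derive _ nf) derive_cst.
- have nf : {near t, (id : R -> R) ^+ k.+2 =1 pospow k.+2}.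
    near=> u; rewrite /pospow max_r ?exprfctE //.
    by apply: ltW; near: u; exact: lt_nbhsr.
  rewrite /pospow max_r ?ltW //.
  apply: DeriveDef; first by apply: near_eq_derivable nf _; exact: derivableX.
  rewrite -(near_eq_derive _ nf) deriveX; last exact: derivable_id.
  by rewrite derive_id -[LHS]/(_ * 1) mulr1.
(* at the origin the difference quotient is [pospow k.+1] *)
have lim0 : (fun h : R => h^-1 *: ((pospow k.+2 \o shift 0) (h *: 1) - pospow k.+2 0)) @ 0^'
    --> (0 : R).
  have : pospow k.+1 x @[x --> 0^'] --> (0 : R).
    have := @pospow_continuous k.+1 0; rewrite /continuous_at {2}/pospow maxxx expr0n.
    by apply: cvg_trans; apply: cvg_app; exact: nbhs_dnbhs.
  apply: cvg_trans; apply: near_eq_cvg; near=> h.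
  have h0 : h != 0 by near: h; exact: nbhs_dnbhs_neq.
  rewrite /= addr0 /pospow maxxx expr0n subr0 -[h *: 1]/(h * 1) mulr1 -[RHS]/(h^-1 * _).
  have [hpos|hneg] := leP 0 h; first by rewrite [in RHS]exprS mulKf.
  by rewrite !expr0n mulr0.
rewrite /pospow maxxx expr0n mulr0.
apply: DeriveDef; first by apply/cvg_ex; exists 0.
exact/cvg_lim.
Unshelve. all: by end_near.
Qed.

Lemma derive_line g x v :
  derivable g x v -> is_derive (0 : R) 1 (fun h : R => g (h *: v + x)) ('D_v g x).
Proof.
have e : (fun h : R => h^-1 *:
    (((fun h : R => g (h *: v + x)) \o shift 0) (h *: 1) - g (0 *: v + x))) =
  (fun h : R => h^-1 *: ((g \o shift x) (h *: v) - g x)).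
  by apply/funext => h; rewrite /= addr0 -[h *: 1]/(h * 1) mulr1 scale0r add0r.
by move=> dg; apply: DeriveDef; rewrite /derivable /derive e.
Qed.

Lemma is_derive_comp_line (h : R -> R) g x v (a : R) : derivable g x v ->
  is_derive (g x) 1 h a -> is_derive x v (fun y => h (g y)) (a * 'D_v g x).
Proof.
move=> dg dh; have dl := derive_line dg.
have gx : g x = g (0 *: v + x) by rewrite scale0r add0r.
rewrite gx in dh; have [dc ec] := is_derive1_comp dh dl.
have e : (fun s : R => s^-1 *: (((fun y => h (g y)) \o shift x) (s *: v) - h (g x)))
  = (fun s : R => s^-1 *:
      (((h \o (fun s : R => g (s *: v + x))) \o shift 0) (s *: 1) - h (g (0 *: v + x)))).
  by apply/funext => s; rewrite /= addr0 -[s *: 1]/(s * 1) mulr1 scale0r add0r.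
by apply: DeriveDef; rewrite /derivable /derive e.
Qed.

Lemma Ck_open_pospow k U g : open U -> (forall j, Ck_open j U g) ->
  Ck_open k U (fun x => pospow k.+1 (g x)).
Proof.
move=> oU hg; have cg := Ck_open_continuous (hg 0%N).
have cp j x : U x -> {for x, continuous (fun y => pospow j.+1 (g y))}.
  by move=> Ux; apply: continuous_comp; [exact: cg|exact: pospow_continuous].
elim: k => [|k IH]; first by split=> // x; exact: cp.
split=> [x|v]; first exact: cp.
have dp x : U x -> is_derive x v (fun y => pospow k.+2 (g y))
    (k.+2%:R * pospow k.+1 (g x) * 'D_v g x).
  move=> Ux; apply: is_derive_comp_line; last exact: pospow_derive.
  by have [_ /(_ v)[+ _]] := hg 1%N; apply.
split=> [x /dp[]//|].
have [_ /(_ v)[_ hdg]] := hg k.+1.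
apply: (Ck_open_ext oU _ (Ck_open_mul oU (Ck_open_mul oU (Ck_open_cst k U k.+2%:R) IH) hdg)).
by move=> x /dp[_ <-].
Qed.

End ExamplesOfCkFunctions.

Section CkOnProducts.
Variables (R : realType) (E G : normedModType R).

Lemma Ck_open_fst k (U : set E) (f : E -> R) : Ck_open k U f ->
  Ck_open k [set z : E * G | U z.1] (fun z => f z.1).
Proof.
elim: k f => [|k IH] f [cf hf].
  split=> // z Uz; apply: (@continuous_comp _ _ _ fst f); [exact: cvg_fst|exact: cf].
split=> [z Uz|v].
  by apply: (@continuous_comp _ _ _ fst f); [exact: cvg_fst|exact: cf].
have [df hdf] := hf v.1; split=> [z Uz|]; first exact: (df z.1 Uz).
exact: (IH _ hdf).
Qed.

End CkOnProducts.

Lemma Ck_linear_in_class (R : realType) (K : scalar_kind) n m k :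
  @linear_in_class R K 'rV[R]_n (@Ck_class R 'rV[R]_n k) m
    (@Ck_class R ('rV[R]_n * 'M[R]_(m, rdim K))%type k).
Proof.
move=> X A w AX hw; set E := 'rV[R]_n; set G := 'M[R]_(m, rdim K).
have alg := Ck_function_algebra (E * G)%type k.
have -> : (fun z : E * G => (mxvec z.2 *m w z.1) 0 0) =
    (fun z => \sum_i mxvec z.2 0 i * w z.1 i 0).
  by apply/funext => z; rewrite mxE.
apply: (cls_sum alg) => i; apply: (cls_mul alg).
  have : Ck_class k setT (fun z : E * G => mxvec z.2 0 i).
    move=> z _; exists setT, (fun z : E * G => mxvec z.2 0 i); split=> //; first exact: openT.
    case/mxvec_indexP: i => a b; apply: Ck_open_linear => [{}z|x v h].
      rewrite (_ : (fun _ => _) = (fun M : G => M a b) \o snd); last first.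
        by apply/funext => y; rewrite mxvecE.
      by apply: continuous_comp; [exact: cvg_snd|exact: coord_continuous].
    by rewrite !mxvecE !mxE.
  exact: (cls_sub alg).
move=> z Az; have [U [g [oU Uz hg wg]]] := hw i 0 z.1 (AX z Az).
exists [set z | U z.1], (fun z => g z.1); split=> //.
- have := @open_comp _ _ (@fst E G) U; apply=> //.
  by move=> y _; exact: cvg_fst.
- exact: Ck_open_fst.
- by move=> y /AX; exact: wg.
Qed.

(** * Euclidean topology and regular functions *)

Section EuclideanTopology.
Variables (R : realType).

Lemma ptws_eval_continuous (I : Type) (i : I) :
  continuous (fun g : {ptws I -> R} => g i).
Proof.
move=> g; have /cvg_sup/(_ i) gi : nbhs (g : {ptws I -> R}) --> g by exact: cvg_id.
apply: cvg_trans (cvg_app (fun g : {ptws I -> R} => g i) gi) _.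
exact: (@initial_continuous _ _ (fun g : I -> R => g i)).
Qed.

Lemma regular_continuous (V : real_algebraic_variety R) (f : V -> R) :
  rs_sect [set: V] f -> continuous (f : euclidean V -> R).
Proof.
move=> hf x.
pose i : global_regular V := exist _ f hf.
apply: (@continuous_comp _ _ _ (@regular_values R V : euclidean V -> _) (fun g => g i)).
  exact: initial_continuous.
exact: ptws_eval_continuous.
Qed.

Lemma mx_norm_leP p q (A : 'M[R]_(p, q)) (c : R) : 0 <= c ->
  `|A| <= c <-> forall i j, `|A i j| <= c.
Proof.
move=> c0; rewrite -[`|A|]/(mx_norm A) mx_normrE; split=> [Ac i j|Ac].
  by apply: le_trans Ac; exact: (@le_bigmax _ _ _ _ (fun ij => `|A ij.1 ij.2|) (i, j)).
by apply: bigmax_le => // ij _; apply: Ac.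
Qed.

Lemma mx_continuous (T : topologicalType) p q (f : T -> 'M[R]_(p, q)) x :
  (forall i j, {for x, continuous (fun y => f y i j)}) -> {for x, continuous f}.
Proof.
move=> cf; apply/cvgrPdist_le => eps eps0.
have : \forall y \near x, forall ij : 'I_p * 'I_q, `|f x ij.1 ij.2 - f y ij.1 ij.2| <= eps.
  by apply: filter_forall => -[i j] /=; have /cvgrPdist_le := cf i j; apply.
apply: filterS => y fy; apply/mx_norm_leP; first exact: ltW.
by move=> i j; rewrite !mxE; exact: (fy (i, j)).
Qed.

Lemma Ck_class_comp_continuous (T : topologicalType) (E : normedModType R) k
    (B : set E) (f : E -> R) (A : set T) (g : T -> E) :
  Ck_class k B f -> (forall x, A x -> B (g x)) ->
  (forall x, A x -> {for x, continuous g}) -> {within A, continuous (fun x => f (g x))}.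
Proof.
move=> hf AB cg; apply/subspace_continuousP => x Ax.
have [U [h [oU Ux hh fh]]] := hf _ (AB x Ax).
have : h (g y) @[y --> within A (nbhs x)] --> f (g x).
  rewrite (fh _ (AB x Ax) Ux).
  apply: cvg_trans (@continuous_comp _ _ _ g h x (cg x Ax) (Ck_open_continuous hh Ux)).
  by apply: cvg_app; exact: cvg_within.
apply: cvg_trans; apply: near_eq_cvg.
have : \forall y \near x, U (g y) by apply: cg => //; exact: open_nbhs_nbhs.
rewrite near_withinE; apply: filterS => y Uy Ay.
by apply: esym; apply: fh => //; exact: AB.
Qed.

End EuclideanTopology.

Section RegularFunctions.
Variables (R : realType) (V : real_algebraic_variety R) (n : nat) (e : V -> 'rV[R]_n).
Hypothesis he : biregular_onto_image e.
Implicit Types (A U : set V) (f g : V -> R).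

Lemma pevalM q (P Q : mpoly.mpoly q R) x : peval (P * Q) x = peval P x * peval Q x.
Proof. exact: mpoly.mevalM. Qed.

Lemma pevalD q (P Q : mpoly.mpoly q R) x : peval (P + Q) x = peval P x + peval Q x.
Proof. exact: mpoly.mevalD. Qed.

Lemma peval_sum q (I : Type) (s : seq I) (P : I -> mpoly.mpoly q R) x :
  peval (\sum_(i <- s) P i) x = \sum_(i <- s) peval (P i) x.
Proof. by apply: (big_morph _ (fun P Q => pevalD P Q x)); exact: mpoly.meval0. Qed.

Lemma sect_sub U W f : open U -> open W -> U `<=` W -> rs_sect W f -> rs_sect U f.
Proof.
have [_ _ hs] := he => oU oW UW /(hs _ _ oW)[g hg fg]; apply/(hs _ _ oU).
exists g => [_ [a Ua <-]|x /UW/fg//].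
have [|P [Q [Qa PQ]]] := hg (e a); first by exists a => //; exact: UW.
by exists P, Q; split=> // _ [x /UW Wx <-]; apply: PQ; exists x.
Qed.

Lemma peval_open (Q : mpoly.mpoly n R) : open [set x : V | peval Q (e x) != 0].
Proof.
have [_ ho _] := he; apply/ho; exists [set y | peval Q y != 0] => //.
exists [set Q]; apply/seteqP; split=> y /=; first by move=> /negP; rewrite negbK => /eqP yQ P ->.
by move=> /(_ Q erefl) ->; rewrite eqxx.
Qed.

Lemma open_peval U a : open U -> U a ->
  exists2 Q, peval Q (e a) != 0 & forall x, peval Q (e x) != 0 -> U x.
Proof.
have [_ ho _] := he => /ho[W [I WI] ->] Wa.
have /existsNP[Q /not_implyP[IQ Qa]] : ~ (forall Q, I Q -> peval Q (e a) = 0).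
  by move=> aI; have : (~` W) (e a) by rewrite WI.
exists Q => [|x Qx]; first exact/eqP.
apply: contrapT => nWx; have : (~` W) (e x) by [].
by rewrite WI => /(_ Q IQ) Qx0; rewrite Qx0 eqxx in Qx.
Qed.

(** A section given near a point as a quotient of polynomials, and an open set given as a
    nonvanishing locus, are merged by multiplying numerator and denominator by a polynomial
    that vanishes outside of the open set. *)
Lemma regular_classP A f : @regular_class R V A f <->
  forall a, A a -> exists P Q, peval Q (e a) != 0 /\
    forall x, A x -> peval Q (e x) != 0 -> f x = peval P (e x) / peval Q (e x).
Proof.
have [_ _ hs] := he; split=> hf a Aa.
  have [U [g [oU Ua /(hs _ _ oU)[h hh gh] fg]]] := hf a Aa.
  have [|P [Q [Qa PQ]]] := hh (e a); first by exists a.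
  have [H Ha HU] := open_peval oU Ua.
  exists (P * H), (Q * H); split=> [|x Ax]; rewrite pevalM; first by rewrite mulf_neq0.
  rewrite mulf_eq0 negb_or => /andP[Qx Hx].
  have Ux := HU x Hx; rewrite fg // gh // PQ //.
  by rewrite pevalM -mulf_div divff // mulr1.
have [P [Q [Qa PQ]]] := hf a Aa; have oQ := peval_open Q.
exists [set x | peval Q (e x) != 0], (fun x => peval P (e x) / peval Q (e x)).
split=> //.
apply/(hs _ _ oQ); exists (fun y => peval P y / peval Q y) => //.
by move=> _ [x Qx <-]; exists P, Q; split.
Qed.

Lemma regular_function_algebra : function_algebra open (@regular_class R V).
Proof.
split.
- move=> A B f AB /regular_classP hf; apply/regular_classP => a /AB/hf[P [Q [Qa PQ]]].
  by exists P, Q; split=> // x /AB; apply: PQ.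
- move=> A f g fg /regular_classP hf; apply/regular_classP => a /hf[P [Q [Qa PQ]]].
  by exists P, Q; split=> // x Ax Qx; rewrite -fg ?PQ.
- move=> A c; apply/regular_classP => a _; exists (mpoly.mpolyC n c), 1.
  by rewrite /peval; split=> [|x _ _]; rewrite mpoly.meval1 ?oner_eq0 // mpoly.mevalC divr1.
- move=> A f g /regular_classP hf /regular_classP hg; apply/regular_classP => a Aa.
  have [P [Q [Qa PQ]]] := hf a Aa; have [P' [Q' [Qa' PQ']]] := hg a Aa.
  exists (P * Q' + P' * Q), (Q * Q'); split=> [|x Ax]; rewrite pevalM; first by rewrite mulf_neq0.
  rewrite mulf_eq0 negb_or => /andP[Qx Qx'].
  by rewrite PQ // PQ' // pevalD !pevalM addf_div.
- move=> A f g /regular_classP hf /regular_classP hg; apply/regular_classP => a Aa.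
  have [P [Q [Qa PQ]]] := hf a Aa; have [P' [Q' [Qa' PQ']]] := hg a Aa.
  exists (P * P'), (Q * Q'); split=> [|x Ax]; rewrite pevalM; first by rewrite mulf_neq0.
  rewrite mulf_eq0 negb_or => /andP[Qx Qx'].
  by rewrite PQ // PQ' // pevalM mulf_div.
- move=> A f /regular_classP hf f0; apply/regular_classP => a Aa.
  have [P [Q [Qa PQ]]] := hf a Aa; exists (Q * Q), (P * Q).
  have := f0 a Aa; rewrite PQ // mulf_eq0 negb_or => /andP[Pa _].
  split=> [|x Ax]; rewrite pevalM; first by rewrite mulf_neq0.
  rewrite mulf_eq0 negb_or => /andP[Px Qx].
  by rewrite PQ // invf_div pevalM -mulf_div divff // mulr1.
- move=> A f hf; apply/regular_classP => a Aa; have [U [oU Ua /regular_classP hU]] := hf a Aa.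
  have [H Ha HU] := open_peval oU Ua; have [P [Q [Qa PQ]]] := hU a (conj Aa Ua).
  exists (P * H), (Q * H); split=> [|x Ax]; rewrite pevalM; first by rewrite mulf_neq0.
  rewrite mulf_eq0 negb_or => /andP[Qx Hx].
  by rewrite (PQ x (conj Ax (HU x Hx))) // pevalM -mulf_div divff // mulr1.
move=> A f /regular_classP hf.
pose B : set (mpoly.mpoly n R * mpoly.mpoly n R) := [set PQ |
  forall x, A x -> peval PQ.2 (e x) != 0 -> f x = peval PQ.1 (e x) / peval PQ.2 (e x)].
exists (\bigcup_(PQ in B) [set x | peval (PQ.1 * PQ.2) (e x) != 0]).
  by apply: bigcup_open => PQ _; exact: peval_open.
move=> x Ax; split=> [[[P Q] BPQ] /=|fx].
  by rewrite pevalM mulf_eq0 negb_or => /andP[Px Qx]; rewrite (BPQ x) //= mulf_neq0 ?invr_eq0.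
have [P [Q [Qa PQ]]] := hf x Ax; exists (P, Q) => //=; rewrite pevalM mulf_neq0 //.
by move: fx; rewrite PQ // mulf_eq0 negb_or => /andP[].
Qed.

Lemma sect_coord i : rs_sect [set: V] (fun x => e x 0 i).
Proof.
have [_ _ hs] := he; apply/(hs _ _ openT); exists (fun y => y 0 i) => //.
move=> y _; exists (mpoly.mpolyX R (mpoly.mnm1 i)), 1.
by rewrite /peval; split=> [|x _ _]; rewrite mpoly.meval1 ?oner_eq0 // mpoly.mevalXU divr1.
Qed.

Lemma regular_coord A i : @regular_class R V A (fun x => e x 0 i).
Proof.
move=> a _; exists setT, (fun x => e x 0 i).
by split=> //; [exact: openT|exact: sect_coord].
Qed.

Lemma embedding_continuous : continuous (e : euclidean V -> 'rV[R]_n).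
Proof.
move=> x; apply: mx_continuous => i j; rewrite ord1.
exact: (regular_continuous (sect_coord j)).
Qed.

Lemma regular_linear_in_class (K : scalar_kind) m :
  @linear_in_class R K V (@regular_class R V) m (@regular_class_prod R V m (rdim K)).
Proof.
move=> X A w AX hw a Aa; set q := (m * rdim K)%N.
have /choice[Ug hUg] (i : 'I_q) : exists Ug : set V * (V -> R),
    [/\ open Ug.1, Ug.1 a.1, rs_sect Ug.1 Ug.2 & forall x, X x -> Ug.1 x -> w x i 0 = Ug.2 x].
  by have [U [g hU]] := hw i 0 a.1 (AX a Aa); exists (U, g).
pose U := \bigcap_(i in [set: 'I_q]) (Ug i).1.
have oU : open U.
  rewrite openE => x Ux; have nx : \forall y \near x, forall i, (Ug i).1 y.
    apply: filter_forall => i; apply: open_nbhs_nbhs; split; last exact: Ux.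
    by have [] := hUg i.
  by apply: filterS nx => y Uy i _; exact: Uy.
have Usub i : U `<=` (Ug i).1 by move=> x; apply.
exists U, q, (fun x => \row_i (Ug i).2 x).
exists (\sum_(i < q) mpoly.mpolyX R (mpoly.mnm1 (lshift q i)) *
  mpoly.mpolyX R (mpoly.mnm1 (rshift q i))), 1.
split=> //.
- by move=> i _; have [] := hUg i.
- move=> i; have [oi _ si _] := hUg i.
  rewrite (_ : (fun x => _) = (Ug i).2); last by apply/funext => x; rewrite mxE.
  exact: sect_sub (Usub i) si.
- by rewrite /peval mpoly.meval1 oner_eq0.
move=> z Az Uz _; rewrite {2}/peval mpoly.meval1 divr1 peval_sum mxE.
apply: eq_bigr => i _; rewrite pevalM /peval !mpoly.mevalXU row_mxEl row_mxEr mxE mulrC.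
by have [_ _ _ ->] := hUg i => //; [exact: AX|exact: Usub].
Qed.

End RegularFunctions.

(** * Isomorphisms from matrices of functions *)

Section IsomorphismMatrices.
Variables (R : realType) (K : scalar_kind) (T : Type) (opn : set (set T)) (cls : fun_class R T).
Local Notation D := (rdim K).
Hypothesis alg : function_algebra opn cls.
Variables (m p : nat) (xi : fibers R K T m) (eta : fibers R K T p).
Variable G : T -> 'M[R]_(m * D, p * D).

(** The two projections turn any matrix of functions into a morphism, so that morphisms
    can be approximated and averaged as if they were functions. *)
Definition compress x := oproj (xi x) *m G x *m oproj (eta x).

Definition uncompress x := coinverse_mx (oproj (xi x)) (compress x).

Definition compress_good x :=
  \rank (compress x) = \rank (oproj (xi x)) /\ \rank (compress x) = \rank (oproj (eta x)).

Section Pointwise.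
Variable x : T.
Hypotheses (hP : is_oproj (xi x) (oproj (xi x))) (hQ : is_oproj (eta x) (oproj (eta x))).

Lemma linmap_in q (W : set 'rV[scalar R K]_q) (P : 'M[R]_(q * D)) r (B : 'M[R]_(r * D, q * D)) v :
  is_oproj W P -> B *m P = B -> W (linmap B v).
Proof. by move=> [_ _ WP] BP; apply/WP; rewrite rvec_linmap -mulmxA BP. Qed.

Lemma oproj_compress : oproj (xi x) *m compress x = compress x.
Proof. by have [_ PP _] := hP; rewrite /compress !mulmxA PP. Qed.

Lemma compress_oproj : compress x *m oproj (eta x) = compress x.
Proof. by have [_ QQ _] := hQ; rewrite /compress -!mulmxA QQ. Qed.

Lemma compress_gram : compress_good x -> gram_mx (oproj (xi x)) (compress x) \in unitmx.
Proof.
by move=> [r1 _]; have [PT PP _] := hP; apply: gram_unitmx => //; exact: oproj_compress.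
Qed.

Lemma uncompressK v : compress_good x -> xi x v ->
  linmap (uncompress x) (linmap (compress x) v) = v.
Proof.
move=> gd; have [PT PP WP] := hP => /WP vP; apply: (can_inj (@rvecK _ _ m)).
by rewrite !rvec_linmap -mulmxA mul_coinverse ?vP ?compress_gram ?oproj_compress.
Qed.

Lemma compressK w : compress_good x -> eta x w ->
  linmap (compress x) (linmap (uncompress x) w) = w.
Proof.
move=> gd; have [QT QQ WQ] := hQ; have [PT PP _] := hP; have [_ rQ] := gd.
move=> /WQ wQ; apply: (can_inj (@rvecK _ _ p)).
rewrite !rvec_linmap -mulmxA (coinverse_mul PP QT QQ) ?wQ ?compress_gram ?oproj_compress //.
exact: compress_oproj.
Qed.

End Pointwise.

(** Both matrices are rational functions of [G] and of the projections; the determinant of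
    the Gram matrix is the only denominator that has to be kept away from zero. *)
Lemma compress_class X : subbundle opn cls X xi -> subbundle opn cls X eta ->
  mx_class cls X G -> (forall x, X x -> scalar_linear (G x)) ->
  [/\ mx_class cls X compress, forall x, X x -> scalar_linear (compress x) &
      forall x v, X x -> xi x v -> eta x (linmap (compress x) v)] /\
  exists W, [/\ opn W, (forall x, X x -> compress_good x -> W x) &
  [/\ mx_class cls (X `&` W) uncompress, forall x, (X `&` W) x -> scalar_linear (uncompress x) &
      forall x v, (X `&` W) x -> eta x v -> xi x (linmap (uncompress x) v)]].
Proof.
move=> hxi heta hG lG.
have [cP oP lP] := subbundle_oproj alg hxi; have [cQ oQ lQ] := subbundle_oproj alg heta.
have cC : mx_class cls X compress by apply: (mx_classM alg) => //; exact: (mx_classM alg).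
have lC x : X x -> scalar_linear (compress x).
  by move=> Xx; apply: scalar_linearM (lQ x Xx); apply: scalar_linearM (lP x Xx) (lG x Xx).
split.
  split=> // x v Xx _; apply: linmap_in (oQ x Xx) _.
  by apply: compress_oproj; exact: oQ.
pose N x := gram_mx (oproj (xi x)) (compress x).
have cN : mx_class cls X N.
  apply: (mx_classD alg); first by apply: (mx_classM alg) => //; exact: (mx_class_tr alg).
  by apply: (mx_classB alg) => //; exact: (mx_class_cst alg).
have [W oW XW] := cls_neq0 alg (cls_det alg cN).
have uN x : (X `&` W) x -> N x \in unitmx.
  by move=> [Xx]; rewrite unitmxE unitfE => /(XW x Xx).
have sub := @subIsetl _ X W.
exists W; split=> //.
  move=> x Xx gd; apply/(XW x Xx); rewrite -unitfE -unitmxE.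
  by apply: compress_gram => //; exact: oP.
split.
- apply: (mx_classM alg); first by apply: (mx_class_tr alg); exact: (mx_class_sub alg sub).
  by apply: (mx_class_inv alg) => //; exact: (mx_class_sub alg sub).
- move=> x XWx; have [Xx Wx] := XWx; apply: scalar_linearM; first exact/scalar_linear_tr/lC.
  apply: scalar_linear_inv; first exact: uN.
  apply: scalar_linearD; first exact: scalar_linearM (lC x Xx) (scalar_linear_tr (lC x Xx)).
  by apply: scalar_linearB (lP x Xx); exact: scalar_linear1.
move=> x v XWx _; have [Xx Wx] := XWx; have [PT PP _] := oP x Xx.
apply: linmap_in (oP x Xx) _; apply: coinverse_P => //; last exact: uN.
exact: (oproj_compress (oP x Xx)).
Qed.

End IsomorphismMatrices.

Section Extensions.
Variables (R : realType) (K : scalar_kind) (V : real_algebraic_variety R).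
Variables (n : nat) (e : V -> 'rV[R]_n).
Local Notation D := (rdim K).
Hypothesis he : biregular_onto_image e.
Let cte := embedding_continuous he.

Lemma subbundle_sub (T : Type) (opn : set (set T)) (cls : fun_class R T) X Y m
    (xi : fibers R K T m) :
  (forall A B f, A `<=` B -> cls B f -> cls A f) ->
  Y `<=` X -> subbundle opn cls X xi -> subbundle opn cls Y xi.
Proof.
move=> csub YX hxi x /YX /hxi[U [r [s [oU Ux cs sb]]]]; exists U, r, s; split=> //.
  by move=> i j c; apply: csub (cs i j c) => y [/YX].
by move=> y /YX; exact: sb.
Qed.

Lemma continuous_class_sub (T : topologicalType) (A B : set T) (f : T -> R) :
  A `<=` B -> continuous_class B f -> continuous_class A f.
Proof. exact: continuous_subspaceW. Qed.

Lemma top_bundle_sub (X Y : set V) m (xi : fibers R K V m) :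
  Y `<=` X -> top_bundle X xi -> top_bundle Y xi.
Proof.
exact: (@subbundle_sub (euclidean V) _ _ _ _ _ _ (@continuous_class_sub (euclidean V))).
Qed.

Lemma top_morphism_sub (X Y : set V) m p (xi : fibers R K V m) (eta : fibers R K V p) phi :
  Y `<=` X -> top_morphism X xi eta phi -> top_morphism Y xi eta phi.
Proof.
move=> YX [h1 h2 h3]; split.
- by move=> x v /YX; exact: h1.
- by move=> x a u v /YX; exact: h2.
by move=> j c; apply: continuous_class_sub (h3 j c) => z [/YX].
Qed.

Lemma Ck_top_bundle k (L : set V) U m (xi : fibers R K V m) xih :
  Ck_extension e k L U xi xih -> top_bundle L xi.
Proof.
move=> [oU LU hxih xiE] x Lx.
have [W [r [s [oW Wx cs sb]]]] := hxih (e x) (LU _ (imageP _ Lx)).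
exists (e @^-1` W), r, (fun x => s (e x)); split=> //.
- by apply: open_comp oW => y _; exact: cte.
- move=> i j c.
  apply: Ck_class_comp_continuous (cs i j c) _ _ => [y [Ly Wy]|y _]; last exact: cte.
  by split=> //; apply: LU; exact: imageP.
by move=> y Ly Wy; rewrite -xiE //; apply: sb => //; apply: LU; exact: imageP.
Qed.

Lemma Ck_extension_sub k (L : set V) U W m (xi : fibers R K V m) xih :
  Ck_extension e k L U xi xih -> open W -> e @` L `<=` W -> W `<=` U ->
  Ck_extension e k L W xi xih.
Proof.
move=> [oU LU hxih xiE] oW LW WU; split=> //.
by apply: subbundle_sub hxih; [exact: (cls_sub (Ck_function_algebra _ k))|].
Qed.

Lemma continuous_class_ext (T : topologicalType) (A : set T) (f g : T -> R) :
  (forall x, A x -> f x = g x) -> continuous_class A f -> continuous_class A g.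
Proof.
move=> fg /subspace_continuousP cf; apply/subspace_continuousP => x Ax.
rewrite -[from_subspace _ _ _]/(g x) -fg //; apply: cvg_trans (cf x Ax).
apply: near_eq_cvg; rewrite near_withinE; apply: nearW => y Ay.
exact: fg.
Qed.

(** The topological part of being a [C^k] morphism comes for free, since [e] is continuous
    for the Euclidean topology. *)
Lemma Ck_matrix_morphism k (L : set V) U m p (xi : fibers R K V m) xih
    (eta : fibers R K V p) etah (B : 'rV[R]_n -> 'M[R]_(m * D, p * D)) phi :
  Ck_extension e k L U xi xih -> Ck_extension e k L U eta etah ->
  mx_class (@Ck_class R 'rV[R]_n k) U B -> (forall y, U y -> scalar_linear (B y)) ->
  (forall y v, U y -> xih y v -> etah y (linmap (B y) v)) ->
  (forall x, L x -> phi x = linmap (B (e x))) ->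
  Ck_morphism e k L xi eta phi.
Proof.
move=> exi eeta cB lB Bxi phiB.
have hB : morphism (@Ck_class R ('rV[R]_n * 'M[R]_(m, D))%type k) U xih etah
    (fun y => linmap (B y)).
  by apply: (matrix_morphism (Ck_function_algebra _ k) _ cB lB Bxi); exact: Ck_linear_in_class.
split; last by exists U, xih, etah, (fun y => linmap (B y)); split=> // x v Lx _; rewrite phiB.
have [_ LU _ xiE] := exi; have [_ _ _ etaE] := eeta; have [_ _ cB'] := hB.
have LU' x : L x -> U (e x) by move=> Lx; apply: LU; exact: imageP.
split=> [x v Lx xv|x a u v Lx xu xv|j c].
- by rewrite -etaE // phiB //; apply: Bxi; [exact: LU'|rewrite xiE].
- by rewrite phiB //; apply: linmapP; apply: lB; exact: LU'.
pose g (z : euclidean V * 'M[R]_(m, D)) : 'rV[R]_n * 'M[R]_(m, D) := (e z.1, z.2).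
apply: (@continuous_class_ext _ _
  (fun z => real_of_scalar (linmap (B (g z).1) (vec_of_real (g z).2) 0 j) 0 c)).
  by move=> z [Lz _]; rewrite phiB.
apply: Ck_class_comp_continuous (cB' j c) _ _ => [z [Lz xiz]|z _].
  by split; [exact: LU'|rewrite /= xiE].
have c1 : e z.1 @[z --> z] --> e z.1.
  apply: (@continuous_comp _ _ _ (@fst (euclidean V) 'M[R]_(m, D)) e); first exact: cvg_fst.
  exact: cte.
have h := cvg_pair c1 (@cvg_snd _ _ (nbhs z.1) (nbhs z.2) _).
exact: h.
Qed.

Lemma alg_matrix_morphism (X Z : set V) m p (xi : fibers R K V m) xit
    (eta : fibers R K V p) etat (B : V -> 'M[R]_(m * D, p * D)) phi :
  alg_extension X Z xi xit -> alg_extension X Z eta etat ->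
  mx_class (@regular_class R V) Z B -> (forall y, Z y -> scalar_linear (B y)) ->
  (forall y v, Z y -> xit y v -> etat y (linmap (B y) v)) ->
  (forall x, X x -> phi x = linmap (B x)) ->
  top_morphism X xi eta phi -> alg_morphism X xi eta phi.
Proof.
move=> exi eeta cB lB Bxi phiB tphi; split=> //.
exists Z, xit, etat, (fun y => linmap (B y)); split=> // [|x v Xx _]; last by rewrite phiB.
apply: (matrix_morphism (regular_function_algebra he) _ cB lB Bxi).
exact: regular_linear_in_class he K m.
Qed.

Lemma zariski_nbhdI (X Z Z' : set V) :
  zariski_nbhd_in_closure X Z -> zariski_nbhd_in_closure X Z' ->
  zariski_nbhd_in_closure X (Z `&` Z').
Proof.
move=> [XZ [W oW ZE]] [XZ' [W' oW' ZE']]; split.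
  by move=> x Xx; split; [exact: XZ|exact: XZ'].
by exists (W `&` W'); [exact: openI|rewrite ZE ZE' setIACA setIid].
Qed.

Lemma zariski_nbhd_setI (X Z W : set V) :
  zariski_nbhd_in_closure X Z -> open W -> X `<=` W ->
  zariski_nbhd_in_closure X (Z `&` W).
Proof.
move=> [XZ [W' oW' ZE]] oW XW; split=> [x Xx|]; first by split; [exact: XZ|exact: XW].
by exists (W' `&` W); [exact: openI|rewrite ZE setIAC].
Qed.

Lemma alg_extension_subset (X Z Z' : set V) m (xi : fibers R K V m) xit :
  alg_extension X Z xi xit -> zariski_nbhd_in_closure X Z' -> Z' `<=` Z ->
  alg_extension X Z' xi xit.
Proof.
move=> [_ hxit xitE] hZ' Z'Z; split=> //.
by apply: subbundle_sub hxit => //; exact: (cls_sub (regular_function_algebra he)).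
Qed.

Lemma alg_extension_sub (X Y Z : set V) m (xi : fibers R K V m) xit :
  Y `<=` X -> alg_extension X Z xi xit -> alg_extension Y (Z `&` closure Y) xi xit.
Proof.
move=> YX [[XZ [W oW ZE]] hxit xitE]; split.
- split=> [x Yx|]; first by split; [exact/XZ/YX|exact: subset_closure].
  exists W => //; rewrite ZE -setIA; congr (_ `&` _); apply/setIidPr.
  exact: closure_subset.
- apply: subbundle_sub hxit; last exact: subIsetl.
  exact: (cls_sub (regular_function_algebra he)).
- by move=> x /YX; exact: xitE.
Qed.

Lemma alg_bundle_sub (X Y : set V) m (xi : fibers R K V m) :
  Y `<=` X -> alg_bundle X xi -> alg_bundle Y xi.
Proof.
move=> YX [txi [Z [xit hZ]]]; split; first exact: top_bundle_sub txi.
by exists (Z `&` closure Y), xit; exact: alg_extension_sub hZ.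
Qed.


Section Isomorphism.
Variables (m p : nat) (xi : fibers R K V m) (eta : fibers R K V p).

(** Bijectivity is required at the points of [L] only: the formula for the inverse is of
    class [C^k] on the open set where the Gram matrix is invertible, which is a neighborhood
    of the image of [L]. *)
Lemma Ck_isomorphism k (L : set V) U xih U' etah W (G : 'rV[R]_n -> 'M[R]_(m * D, p * D)) :
  Ck_extension e k L U xi xih -> Ck_extension e k L U' eta etah ->
  open W -> e @` L `<=` W ->
  mx_class (@Ck_class R 'rV[R]_n k) W G -> (forall y, W y -> scalar_linear (G y)) ->
  (forall x, L x -> compress_good xi eta (G \o e) x) ->
  let phi x := linmap (compress xi eta (G \o e) x) in
  let psi x := linmap (uncompress xi eta (G \o e) x) in
  [/\ Ck_morphism e k L xi eta phi, Ck_morphism e k L eta xi psi & inverse_on L xi eta phi psi].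
Proof.
move=> exi eeta oW LW cG lG good phi psi; set O := U `&` U' `&` W.
have [oU LU hxih xiE] := exi; have [oU' LU' hetah etaE] := eeta.
have alg := Ck_function_algebra 'rV[R]_n k.
have oO : open O by apply: openI => //; exact: openI.
have LO : e @` L `<=` O by move=> y Ly; split; [split; [exact: LU|exact: LU']|exact: LW].
have eO : Ck_extension e k L O xi xih by apply: (Ck_extension_sub exi) => // y [[]].
have eO' : Ck_extension e k L O eta etah by apply: (Ck_extension_sub eeta) => // y [[]].
have [_ _ hO _] := eO; have [_ _ hO' _] := eO'.
have OW : O `<=` W by move=> y [].
have [[cC lC mC] [N [oN goodN [cD lD mD]]]] := compress_class alg hO hO'
  (mx_class_sub alg OW cG) (fun y Oy => lG y (OW y Oy)).
have LeO x : L x -> O (e x) by move=> Lx; apply: LO; exact: imageP.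
have CE x : L x -> compress xih etah G (e x) = compress xi eta (G \o e) x.
  by move=> Lx; rewrite /compress xiE // etaE.
have DE x : L x -> uncompress xih etah G (e x) = uncompress xi eta (G \o e) x.
  by move=> Lx; rewrite /uncompress CE // xiE.
have LO' : e @` L `<=` O `&` N.
  move=> _ [x Lx <-]; split; first exact: LeO.
  apply: goodN; first exact: LeO.
  by have := good x Lx; rewrite /compress_good CE // xiE // etaE.
have oOO' : open (O `&` N) by exact: openI.
split.
- by apply: (Ck_matrix_morphism eO eO' cC lC mC) => x Lx; rewrite CE.
- have eOO := Ck_extension_sub eO oOO' LO' (@subIsetl _ _ _).
  have eOO' := Ck_extension_sub eO' oOO' LO' (@subIsetl _ _ _).
  by apply: (Ck_matrix_morphism eOO' eOO cD lD mD) => x Lx; rewrite DE.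
have [_ oP _] := subbundle_oproj alg hO; have [_ oQ _] := subbundle_oproj alg hO'.
have oPx x : L x -> is_oproj (xi x) (oproj (xi x)).
  by move=> Lx; rewrite -xiE //; apply: oP; exact: LeO.
have oQx x : L x -> is_oproj (eta x) (oproj (eta x)).
  by move=> Lx; rewrite -etaE //; apply: oQ; exact: LeO.
by split=> x v Lx; [apply: uncompressK|apply: compressK]; auto.
Qed.

(** Although [G] need not be regular on any Zariski open set, agreement with a regular [H]
    on [X] suffices, because the extension lives on the part of the Zariski closure of [X]
    where the Gram matrix built from [H] is invertible. *)
Lemma alg_isomorphism (X : set V) (G H : V -> 'M[R]_(m * D, p * D)) :
  alg_bundle X xi -> alg_bundle X eta ->
  mx_class (@regular_class R V) [set: V] H -> (forall x, scalar_linear (H x)) ->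
  (forall x, X x -> H x = G x) ->
  (forall x, X x -> compress_good xi eta G x) ->
  let phi x := linmap (compress xi eta G x) in
  let psi x := linmap (uncompress xi eta G x) in
  top_morphism X xi eta phi -> top_morphism X eta xi psi ->
  alg_morphism X xi eta phi /\ alg_morphism X eta xi psi.
Proof.
move=> [_ [Z [xit exi]]] [_ [Z' [etat eeta]]] cH lH HG good phi psi tphi tpsi.
have alg := regular_function_algebra he.
have [nZ _ xiE] := exi; have [nZ' _ etaE] := eeta; set O := Z `&` Z'.
have nO := zariski_nbhdI nZ nZ'.
have eO : alg_extension X O xi xit by apply: (alg_extension_subset exi) => // y [].
have eO' : alg_extension X O eta etat by apply: (alg_extension_subset eeta) => // y [].
have [_ hO _] := eO; have [_ hO' _] := eO'; have [XO _] := nO.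
have [[cC lC mC] [W [oW goodW [cD lD mD]]]] := compress_class alg hO hO'
  (mx_class_sub alg (@subsetT _ O) cH) (fun x _ => lH x).
have CE x : X x -> compress xit etat H x = compress xi eta G x.
  by move=> Xx; rewrite /compress xiE // etaE // HG.
have DE x : X x -> uncompress xit etat H x = uncompress xi eta G x.
  by move=> Xx; rewrite /uncompress CE // xiE.
have XW : X `<=` W.
  move=> x Xx; apply: goodW; first exact: XO.
  by have := good x Xx; rewrite /compress_good CE // xiE // etaE.
have nOW := zariski_nbhd_setI nO oW XW.
split; first by apply: (alg_matrix_morphism eO eO' cC lC mC) => // x Xx; rewrite CE.
have eOW := alg_extension_subset eO nOW (@subIsetl _ _ _).
have eOW' := alg_extension_subset eO' nOW (@subIsetl _ _ _).
by apply: (alg_matrix_morphism eOW' eOW cD lD mD) => // x Xx; rewrite DE.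
Qed.

End Isomorphism.

End Extensions.

(** * Stratifications by zero sets *)

Section Stratifications.
Variables (R : realType) (V : real_algebraic_variety R).
Implicit Types (S : set (set V)) (g : V -> R).

Definition common_refinement S S' := [set A `&` B | A in S & B in S'].

Lemma stratification_refinement S S' :
  stratification S -> stratification S' -> stratification (common_refinement S S').
Proof.
move=> [fS lS tS cS] [fS' lS' tS' cS']; split.
- exact: finite_image2.
- move=> _ [A /lS[U [C [oU cC ->]]] [B /lS'[U' [C' [oU' cC' ->]]] <-]].
  exists (U `&` U'), (C `&` C'); split; [exact: openI|exact: closedI|exact: setIACA].
- move=> _ _ [A SA [B SB <-]] [A' SA' [B' SB' <-]] [x [[Ax Bx] [Ax' Bx']]] /=.
  have -> : A = A' by apply: tS => //; exists x.
  by have -> : B = B' by apply: tS' => //; exists x.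
apply/seteqP; split=> // x _.
have [A SA Ax] : (\bigcup_(A in S) A) x by rewrite cS.
have [B SB Bx] : (\bigcup_(A in S') A) x by rewrite cS'.
by exists (A `&` B) => //; exists A => //; exists B.
Qed.

Lemma stratificationT : stratification [set [set: V]].
Proof.
split; first exact: finite_set1.
- by move=> A ->; exists setT, setT; split; [exact: openT|exact: closedT|rewrite setIT].
- by move=> A B -> ->.
by rewrite bigcup_set1.
Qed.

(** Separating the zeros of the functions from the other points is enough to separate signs,
    once connected components are taken. *)
Fixpoint zero_strata (gs : seq (V -> R)) : set (set V) :=
  if gs is g :: gs' then
    common_refinement [set [set x | g x = 0]; [set x | g x <> 0]] (zero_strata gs')
  else [set [set: V]].

Lemma zero_strataP (n : nat) (e : V -> 'rV[R]_n) gs : biregular_onto_image e ->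
  (forall i, (i < size gs)%N -> @regular_class R V [set: V] (nth (fun=> 0) gs i)) ->
  stratification (zero_strata gs).
Proof.
move=> he; elim: gs => [|g gs IH] hgs; first exact: stratificationT.
apply: stratification_refinement; last by apply: IH => i; exact: (hgs i.+1).
have [W oW Wg] := cls_neq0 (regular_function_algebra he) (hgs 0%N isT).
have WE : W = [set x | g x <> 0].
  by apply/seteqP; split=> x => [/(Wg x I)/eqP|/eqP/(Wg x I)].
have gE : [set x | g x = 0] = ~` W.
  by rewrite WE; apply/seteqP; split=> x /=; [move=> -> []|move/contrapT].
split.
- by rewrite finite_setU; split; exact: finite_set1.
- move=> A [->|->]; last by exists W, setT; split=> //; rewrite setIT WE.
  by exists setT, (~` W); split; [exact: openT|exact: open_closedC|rewrite setTI gE].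
- by move=> A B [->|->] [->|->] //= [x []].
apply/seteqP; split=> // x _; case: (pselect (g x = 0)) => gx.
  by exists [set x | g x = 0] => //; left.
by exists [set x | g x <> 0] => //; right.
Qed.

Lemma zero_strata_eq0 gs A x y i : zero_strata gs A -> A x -> A y -> (i < size gs)%N ->
  nth (fun=> 0) gs i x = 0 -> nth (fun=> 0) gs i y = 0.
Proof.
elim: gs A i => [//|g gs IH] A i /= [B hB [C hC <-]] [Bx Cx] [By Cy].
case: i => [|i] /=; last by rewrite ltnS; exact: IH Cx Cy.
by case: hB By Bx => -> //= gy gx _ gx0.
Qed.

(** The values of the function on a component form an interval, and this interval contains
    zero only if the function vanishes on the whole stratum. *)
Lemma component_sign gs A (L : set V) x y i : zero_strata gs A -> (L `&` A) x ->
  (i < size gs)%N -> continuous (nth (fun=> 0) gs i : euclidean V -> R) ->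
  euclidean_component (L `&` A) x y ->
  (0 < nth (fun=> 0) gs i y) = (0 < nth (fun=> 0) gs i x).
Proof.
set g := nth _ gs i => hA LAx igs cg Cy.
set C := euclidean_component _ _ in Cy.
have CLA : C `<=` L `&` A by exact: (@connected_component_sub (euclidean V)).
have Cx : C x by exact: (@connected_component_refl (euclidean V)).
have zero u v : C u -> C v -> g u = 0 -> g v = 0.
  by move=> /CLA[_ Au] /CLA[_ Av]; exact: (zero_strata_eq0 hA Au Av igs).
have /connected_intervalP gC : connected (g @` C).
  apply: (@connected_continuous_connected (euclidean V) R C g).
    exact: (@component_connected (euclidean V)).
  exact: (@continuous_subspaceT (euclidean V) R C g cg).
have pos u v : C u -> C v -> 0 < g u -> 0 < g v.
  move=> Cu Cv gu; rewrite ltNge; apply/negP => gv.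
  have bnd : g v <= 0 <= g u by rewrite gv ltW.
  have [w Cw gw] := gC (g v) (g u) (imageP g Cv) (imageP g Cu) 0 bnd.
  by have gu0 := zero w u Cw Cu gw; rewrite gu0 ltxx in gu.
by apply/idP/idP; exact: pos.
Qed.

End Stratifications.

Section PiecewiseBundles.
Variables (R : realType) (K : scalar_kind) (V : real_algebraic_variety R).
Variables (n : nat) (e : V -> 'rV[R]_n).
Hypothesis he : biregular_onto_image e.

Lemma component_sub (X Y : set V) x :
  Y x -> Y `<=` X -> euclidean_component Y x `<=` euclidean_component X x.
Proof.
move=> Yx YX; apply: (@connected_component_max (euclidean V)).
- exact: (@connected_component_refl (euclidean V)).
- by apply: subset_trans YX; exact: (@connected_component_sub (euclidean V)).
exact: (@component_connected (euclidean V)).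
Qed.

Lemma pa_bundle_refinement (S S' : set (set V)) L m (xi : fibers R K V m) :
  pa_bundle S L xi -> pa_bundle (common_refinement S S') L xi.
Proof.
move=> [txi hxi]; split=> // _ x [A SA [B SB <-]] LABx.
have sLA : L `&` (A `&` B) `<=` L `&` A by move=> y [Ly []].
by apply: (alg_bundle_sub he (component_sub LABx sLA)); apply: hxi => //; exact: sLA.
Qed.

Lemma common_refinementC (S S' : set (set V)) :
  common_refinement S S' = common_refinement S' S.
Proof.
by apply/seteqP; split=> _ [A SA [B SB <-]]; exists B => //; exists A => //; rewrite setIC.
Qed.

End PiecewiseBundles.

(** * Piecewise polynomial bumps *)

Section CkOnOpenSets.
Variables (R : realType) (E : normedModType R).

Lemma Ck_open_local k (U : set E) (f : E -> R) :
  (forall x, U x -> exists W, [/\ open W, W x & Ck_open k (U `&` W) f]) -> Ck_open k U f.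
Proof.
elim: k f => [|k IH] f hf.
  by split=> // x Ux; have [W [_ Wx [cf _]]] := hf x Ux; exact: cf.
split=> [x Ux|v]; first by have [W [_ Wx [cf _]]] := hf x Ux; exact: cf.
split=> [x Ux|].
  by have [W [_ Wx [_ /(_ v)[df _]]]] := hf x Ux; exact: df.
by apply: IH => x Ux; have [W [oW Wx [_ /(_ v)[_ df]]]] := hf x Ux; exists W.
Qed.

Lemma Ck_class_open k (U : set E) (f : E -> R) : open U -> Ck_class k U f -> Ck_open k U f.
Proof.
move=> oU hf; apply: Ck_open_local => x Ux; have [W [g [oW Wx hg fg]]] := hf x Ux.
exists W; split=> //; apply: (@Ck_open_ext _ _ _ _ g); first exact: openI.
  by move=> y [Uy Wy]; rewrite fg.
by apply: Ck_open_sub hg; exact: subIsetr.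
Qed.

End CkOnOpenSets.

Section Bumps.
Variables (R : realType) (n : nat).
Implicit Types (c y : 'rV[R]_n) (p : 'rV[R]_n * R).

Definition sqdist c y : R := \sum_j (y 0 j - c 0 j) ^+ 2.

(** For a center and a radius [p], the polynomial [outer p] is positive on the support of
    the bump, a ball of twice that radius, and [inner p] is nonpositive on its plateau. *)
Definition outer p y : R := 4 * p.2 ^+ 2 - sqdist p.1 y.
Definition inner p y : R := sqdist p.1 y - p.2 ^+ 2.

Lemma sqdist_class (T : Type) opn (cls : fun_class R T) A (f : T -> 'rV[R]_n) c :
  function_algebra opn cls -> (forall j, cls A (fun x => f x 0 j)) ->
  cls A (fun x => sqdist c (f x)).
Proof.
move=> alg hf; apply: (cls_sum alg) => j.
have hd : cls A (fun x => f x 0 j - c 0 j).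
  by apply: (cls_add alg) => //; exact: (cls_cst alg).
by apply: (cls_ext alg _ (cls_mul alg hd hd)) => x _; rewrite expr2.
Qed.

Lemma outer_class (T : Type) opn (cls : fun_class R T) A (f : T -> 'rV[R]_n) p :
  function_algebra opn cls -> (forall j, cls A (fun x => f x 0 j)) ->
  cls A (fun x => outer p (f x)).
Proof.
move=> alg hf; apply: (cls_add alg); first exact: (cls_cst alg).
have := cls_mul alg (cls_cst alg A (-1)) (sqdist_class p.1 alg hf).
by apply: (cls_ext alg) => x _; rewrite mulN1r.
Qed.

Lemma inner_class (T : Type) opn (cls : fun_class R T) A (f : T -> 'rV[R]_n) p :
  function_algebra opn cls -> (forall j, cls A (fun x => f x 0 j)) ->
  cls A (fun x => inner p (f x)).
Proof.
by move=> alg hf; apply: (cls_add alg); [exact: sqdist_class alg hf|exact: (cls_cst alg)].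
Qed.

Lemma coord_Ck k j : Ck_class k [set: 'rV[R]_n] (fun y => y 0 j).
Proof.
move=> y _; exists setT, (fun y => y 0 j); split=> //; first exact: openT.
apply: Ck_open_linear => [|x v h]; first exact: coord_continuous.
by rewrite !mxE.
Qed.

Lemma pospow_class k f : (forall j, Ck_class j [set: 'rV[R]_n] f) ->
  Ck_class k [set: 'rV[R]_n] (fun y => pospow k.+1 (f y)).
Proof.
move=> hf y _; exists setT, (fun y => pospow k.+1 (f y)); split=> //; first exact: openT.
apply: Ck_open_pospow; first exact: openT.
by move=> j; apply: Ck_class_open; [exact: openT|exact: hf].
Qed.

Definition outer_bump k p y := pospow k.+1 (outer p y).
Definition inner_bump k p y := pospow k.+1 (inner p y).

Lemma outer_bump_class k p : Ck_class k [set: 'rV[R]_n] (outer_bump k p).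
Proof.
apply: pospow_class => j; have alg := Ck_function_algebra 'rV[R]_n j.
by apply: (outer_class (f := id)) alg _ => i; exact: coord_Ck.
Qed.

Lemma inner_bump_class k p : Ck_class k [set: 'rV[R]_n] (inner_bump k p).
Proof.
apply: pospow_class => j; have alg := Ck_function_algebra 'rV[R]_n j.
by apply: (inner_class (f := id)) alg _ => i; exact: coord_Ck.
Qed.

Lemma pospow_ge0 k (t : R) : 0 <= pospow k t.
Proof. by rewrite exprn_ge0 // le_max lexx. Qed.

Lemma pospow_gt0 k (t : R) : (0 < pospow k.+1 t) = (0 < t).
Proof.
rewrite /pospow; have [t0|t0] := ltP 0 t.
  by rewrite exprn_gt0.
by rewrite expr0n ltxx.
Qed.

Lemma bump_sum_gt0 k p y : 0 < p.2 -> 0 < outer_bump k p y + inner_bump k p y.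
Proof.
move=> p0; have [pos|npos] := ltP 0 (outer p y).
  by rewrite ltr_pwDl ?pospow_gt0 // pospow_ge0.
rewrite ltr_wpDl ?pospow_ge0 // pospow_gt0 /inner.
by move: npos; rewrite /outer; have := exprn_gt0 2 p0; lra.
Qed.

Lemma outer_gt0 p y : 0 < p.2 -> inner p y <= 0 -> 0 < outer p y.
Proof.
rewrite /inner /outer => p0; have := exprn_gt0 2 p0.
set x := _ ^+ 2; set z := sqdist _ _; lra.
Qed.

Lemma sqdist_continuous c : continuous (sqdist c).
Proof.
have := @sqdist_class _ _ _ setT id c (Ck_function_algebra 'rV[R]_n 0) (fun j => @coord_Ck 0 j).
by move/(Ck_class_open openT)=> /Ck_open_continuous h y; exact: h.
Qed.

Lemma sqdist_cc c : sqdist c c = 0.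
Proof. by rewrite /sqdist big1 // => j _; rewrite subrr expr0n. Qed.

(** The squared Euclidean distance is a polynomial, unlike the norm of the ambient space,
    but it defines the same neighborhoods. *)
Lemma nbhs_sqdist c (N : set 'rV[R]_n) : nbhs c N ->
  exists2 r : R, 0 < r & forall y, sqdist c y < 4 * r ^+ 2 -> N y.
Proof.
move=> /nbhs_ballP[r r0 rN]; rewrite /= in r0; exists (r / 4); first by rewrite divr_gt0.
move=> y yr; apply: rN; rewrite -ball_normE /=.
have r2 : 0 < r / 2 by rewrite divr_gt0.
apply: (@le_lt_trans _ _ (r / 2)); last by rewrite ltr_pdivrMr // ltr_pMr // ltr1n.
apply/mx_norm_leP; first exact: ltW.
move=> i j; rewrite !mxE ord1 distrC -ler_sqr ?nnegrE ?normr_ge0 ?(ltW r2) //.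
rewrite real_normK ?num_real //.
apply: le_trans (_ : sqdist c y <= _); last by apply: ltW; apply: lt_le_trans yr _; lra.
by rewrite /sqdist (bigD1 j) //= lerDl sumr_ge0 // => k _; exact: sqr_ge0.
Qed.

Lemma sqdist_ball_open p : open [set y | sqdist p.1 y < p.2 ^+ 2].
Proof.
by apply: (@open_comp _ _ (sqdist p.1) [set t | t < p.2 ^+ 2]) => [y _|];
  [exact: sqdist_continuous|exact: open_lt].
Qed.

(** Since the radius may depend on the center, smallness is expressed by a property of
    nearby points that holds around each center, without uniformity. *)
Lemma bump_cover (C : set 'rV[R]_n) (good : 'rV[R]_n -> 'rV[R]_n -> Prop) :
  compact C -> (forall c, C c -> \forall y \near c, good c y) ->
  exists pts : seq ('rV[R]_n * R),
    (forall p, p \in pts -> [/\ C p.1, 0 < p.2 & forall y, 0 < outer p y -> good p.1 y]) /\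
    (forall y, C y -> exists2 p, p \in pts & inner p y < 0).
Proof.
rewrite compact_cover => cC hgood.
have /choice[r hr] c : exists r : R,
    C c -> 0 < r /\ forall y, sqdist c y < 4 * r ^+ 2 -> good c y.
  case: (pselect (C c)) => [/hgood/nbhs_sqdist[r r0 hr]|nC]; first by exists r.
  by exists 0.
have [c _||D DC hD] := cC _ C (fun c => [set y | sqdist c y < r c ^+ 2]).
- exact: (@sqdist_ball_open (c, r c)).
- move=> c Cc; exists c => //=; rewrite sqdist_cc exprn_gt0 //.
  by have [] := hr c Cc.
exists [seq (c, r c) | c <- finmap.enum_fset D]; split=> [p /mapP[c cD ->]|y /hD[c cD cy]].
  have Cc : C c by move: (DC c cD); rewrite inE.
  by have [r0 hg] := hr c Cc; split=> // y; rewrite subr_gt0; exact: hg.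
by exists (c, r c); [exact: map_f|rewrite subr_lt0].
Qed.

End Bumps.

(** * Products of interpolated projections *)

Section SmallMatrices.
Variables (R : realType).

Definition small N (X : 'M[R]_N) := forall v : 'rV[R]_N, `|v *m X| <= 8^-1 * `|v|.

Lemma small_near n N (X : 'rV[R]_n -> 'M[R]_N) c :
  (forall i j, {for c, continuous (fun y => X y i j)}) -> X c = 0 ->
  \forall y \near c, small (X y).
Proof.
move=> cX Xc; pose d : R := (8 * N.+1%:R)^-1; have d0 : 0 < d by rewrite invr_gt0 mulr_gt0.
have : \forall y \near c, forall ij : 'I_N * 'I_N, `|X y ij.1 ij.2| <= d.
  apply: (@filter_forall _ _ (fun ij y => `|X y ij.1 ij.2| <= d) (nbhs c) (nbhs_filter c)).
  move=> -[i j] /=; have /cvgrPdist_le/(_ d d0) := cX i j.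
  by apply: filterS => y; rewrite Xc mxE sub0r normrN.
apply: filterS => y hX v; apply/mx_norm_leP; first by rewrite mulr_ge0 ?invr_ge0.
move=> i j; rewrite mxE; apply: le_trans (ler_norm_sum _ _ _) _.
have hv k : `|v i k * X y k j| <= `|v| * d.
  rewrite normrM ler_pM //; last exact: (hX (k, j)).
  by have /mx_norm_leP := lexx `|v|; apply.
apply: le_trans (ler_sum _ (fun k _ => hv k)) _.
rewrite sumr_const card_ord -[_ *+ N]mulr_natr -mulrA [leRHS]mulrC ler_wpM2l //.
rewrite /d invfM -mulrA ler_piMr ?invr_ge0 //.
by rewrite mulrC ler_pdivrMr ?ltr0n // mul1r ler_nat.
Qed.

Lemma rank_mul_inj p q r (A : 'M[R]_(p, q)) (B : 'M[R]_(q, r)) :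
  (forall v : 'rV_q, (v <= A)%MS -> v *m B = 0 -> v = 0) -> \rank (A *m B) = \rank A.
Proof.
move=> inj; apply/mxrank_injP; apply/eqP/row_matrixP => i; rewrite row0.
have : (row i (A :&: kermx B) <= A :&: kermx B)%MS by exact: row_sub.
by rewrite sub_capmx => /andP[/inj iA /sub_kermxP /iA].
Qed.

Section Cone.
Variables (N : nat) (P : 'M[R]_N).
Hypothesis PP : P *m P = P.
Implicit Types (Q : 'M[R]_N) (v : 'rV[R]_N).

Definition near_proj Q := small ((Q - P) *m P) /\ small ((Q - P) *m (1%:M - P)).

Lemma mul_complement : P *m (1%:M - P) = 0.
Proof. by rewrite mulmxBr mulmx1 PP subrr. Qed.

Lemma subr_complement Q : (Q - P) *m (1%:M - P) = Q *m (1%:M - P).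
Proof. by rewrite mulmxBl mul_complement subr0. Qed.

(** Unlike the image of [P], this cone around it is stable under interpolation between the
    identity and any projection that is near to [P], and it meets the kernel of [P] only at
    the origin. *)
Definition in_cone v := `|v *m (1%:M - P)| <= `|v *m P|.

Lemma norm_split v : `|v| <= `|v *m P| + `|v *m (1%:M - P)|.
Proof.
have e : v *m P + v *m (1%:M - P) = v by rewrite -mulmxDr subrKC mulmx1.
by rewrite -{1}e ler_normD.
Qed.

Lemma in_cone_eq0 v : in_cone v -> v *m P = 0 -> v = 0.
Proof.
by rewrite /in_cone => + vP; have := norm_split v; rewrite vP normr0 add0r => h1 h2;
  apply/eqP; rewrite -normr_le0 (le_trans h1).
Qed.

Lemma in_cone_image v : (v <= P)%MS -> in_cone v.
Proof.
by case/submxP=> u ->; rewrite /in_cone -!mulmxA mul_complement mulmx0 normr0.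
Qed.

Lemma in_cone_near Q v : near_proj Q -> v *m Q = v -> in_cone v.
Proof.
move=> [_ sQ] vQ; have := sQ v; have := norm_split v; rewrite /in_cone.
have -> : v *m ((Q - P) *m (1%:M - P)) = v *m (1%:M - P).
  by rewrite subr_complement mulmxA vQ.
have := normr_ge0 (v *m P); set x := `|v|; set y := `|_|; set z := `|_|; lra.
Qed.

(** For [Q = P], the component of [v] in the image of [P] is multiplied by [a + b] and the
    other one by [b]. The difference between [Q] and [P] changes each norm by at most a
    quarter of [a] times the norm of the first component. *)
Lemma in_cone_step Q (a b : R) v : 0 <= a -> 0 <= b -> 0 < a + b ->
  (0 < a -> near_proj Q) -> in_cone v -> v != 0 ->
  in_cone (v *m (b *: 1%:M + a *: Q)) /\ v *m (b *: 1%:M + a *: Q) != 0.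
Proof.
move=> a0 b0 ab hQ cv v0; set E := _ + _.
have vP0 : 0 < `|v *m P|.
  by rewrite normr_gt0; apply: contraNneq v0 => /(in_cone_eq0 cv) ->.
have v2 : `|v| <= 2 * `|v *m P|.
  by move: cv (norm_split v); rewrite /in_cone; set x := `|v|; set y := `|_|; set z := `|_|; lra.
pose t1 := v *m ((Q - P) *m P); pose t2 := v *m ((Q - P) *m (1%:M - P)).
have EP : v *m E *m P = (a + b) *: (v *m P) + a *: t1.
  rewrite /E /t1 mulmxDr mulmxDl -!scalemxAr -!scalemxAl mulmx1.
  rewrite [(Q - P) *m P]mulmxBl PP mulmxBr scalerBr scalerDl !mulmxA.
  by rewrite [a *: _ + b *: _]addrC -addrA subrKC.
have EP' : v *m E *m (1%:M - P) = b *: (v *m (1%:M - P)) + a *: t2.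
  rewrite /E /t2 [v *m (b *: _ + _)]mulmxDr mulmxDl -!scalemxAr -!scalemxAl mulmx1.
  congr (_ + _ *: _).
  by rewrite subr_complement mulmxA.
have small_t (t : 'rV[R]_N) : (0 < a -> `|t| <= 8^-1 * `|v|) -> `|a *: t| <= a / 4 * `|v *m P|.
  rewrite normrZ ger0_norm //; move: a0; rewrite le_eqVlt => /predU1P[<-|a0 /(_ a0) ht].
    by rewrite !mul0r.
  by rewrite -mulrA ler_pM2l //; move: ht v2; set x := `|v|; set y := `|_|; set z := `|_|; lra.
have h1 : `|a *: t1| <= a / 4 * `|v *m P| by apply: small_t => /hQ[sQ _]; exact: sQ.
have h2 : `|a *: t2| <= a / 4 * `|v *m P| by apply: small_t => /hQ[_ sQ]; exact: sQ.
have lo : (b + 3 / 4 * a) * `|v *m P| <= `|v *m E *m P|.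
  have := ler_normB (v *m E *m P) (a *: t1); rewrite EP addrK normrZ ger0_norm ?addr_ge0 //.
  by move: h1; set x := `|a *: t1|; set y := `|v *m P|; set z := `|_|; lra.
have up : `|v *m E *m (1%:M - P)| <= (b + a / 4) * `|v *m P|.
  rewrite EP'; apply: le_trans (ler_normD _ _) _; rewrite normrZ ger0_norm // mulrDl lerD //.
  exact: ler_wpM2l.
split.
  apply: le_trans up (le_trans _ lo); rewrite ler_pM2r //; lra.
apply: contraTneq lo => ->; rewrite mul0mx normr0 -ltNge mulr_gt0 //; lra.
Qed.

(** A vector of one image that is killed by the other projection would have norm at most an
    eighth of itself. *)
Lemma near_proj_rank Q : Q *m Q = Q -> near_proj Q -> \rank Q = \rank P.
Proof.
have imP (A : 'M[R]_N) v : A *m A = A -> (v <= A)%MS -> v *m A = v.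
  by move=> AA /submxP[u ->]; rewrite -mulmxA AA.
have eq0 v : `|v| <= 8^-1 * `|v| -> v = 0.
  by move=> h; apply/eqP; rewrite -normr_le0; move: h; set x := `|v|; lra.
move=> QQ [s1 s2]; apply/eqP; rewrite eqn_leq; apply/andP; split.
  rewrite -(@rank_mul_inj _ _ _ Q P) ?mxrankM_maxr // => v /(imP _ _ QQ) vQ vP.
  have := s2 v; rewrite subr_complement mulmxA vQ.
  by rewrite mulmxBr vP mulmx1 subr0; exact: eq0.
rewrite -(@rank_mul_inj _ _ _ P Q) ?mxrankM_maxr // => v /(imP _ _ PP) vP vQ.
by have := s1 v; rewrite mulmxA mulmxBr vQ vP sub0r mulNmx vP normrN; exact: eq0.
Qed.

End Cone.

Section Chain.
Variables (I : eqType) (N : nat) (Q : I -> 'M[R]_N).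
Implicit Types (a b : I -> R) (s : seq I).

(** Only the image of a chain matters, so the weights [a p] and [b p] of the projection and
    of the identity need not add up to one. *)
Fixpoint chain a b s : 'M[R]_N :=
  if s is p :: s' then (b p *: 1%:M + a p *: Q p) *m chain a b s' else 1%:M.

Lemma chain_cat a b s1 s2 : chain a b (s1 ++ s2) = chain a b s1 *m chain a b s2.
Proof. by elim: s1 => [|p s1 IH] /=; rewrite ?mul1mx // IH mulmxA. Qed.

Lemma eq_chain a b a' b' s : {in s, a =1 a'} -> {in s, b =1 b'} -> chain a b s = chain a' b' s.
Proof.
elim: s => //= p s IH ha hb; rewrite ha ?hb ?mem_head // IH // => q qs.
  by rewrite ha // in_cons qs orbT.
by rewrite hb // in_cons qs orbT.
Qed.

Section ChainImage.
Variables (P : 'M[R]_N) (a b : I -> R) (s : seq I).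
Hypotheses (PP : P *m P = P).
Hypotheses (QQ : forall p, p \in s -> Q p *m Q p = Q p).
Hypothesis ab : forall p, p \in s ->
  [/\ 0 <= a p, 0 <= b p, 0 < a p + b p & 0 < a p -> near_proj P (Q p)].

Lemma in_cone_chain s' v : {subset s' <= s} -> in_cone P v -> v != 0 ->
  in_cone P (v *m chain a b s') /\ v *m chain a b s' != 0.
Proof.
elim: s' v => [|p s' IH] v ss cv v0 /=; first by rewrite mulmx1.
have [a0 b0 ab0 hQ] := ab (ss p (mem_head _ _)).
have [cv' v0'] := in_cone_step PP a0 b0 ab0 hQ cv v0.
by rewrite mulmxA; apply: IH => // q qs; apply: ss; rewrite in_cons qs orbT.
Qed.

Lemma chain_inj s' v : {subset s' <= s} -> in_cone P v -> v *m chain a b s' = 0 -> v = 0.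
Proof.
move=> ss cv vM; apply/eqP; apply: contraT => v0.
by have [_] := in_cone_chain ss cv v0; rewrite vM eqxx.
Qed.

(** Invariance of the cone bounds the rank of the chain from below by that of [P]; a factor
    that is a multiple of a projection bounds it from above by the rank of this projection,
    which is the same. Hence the obvious inclusions between images are equalities, and in
    particular the image is the same for all such factors. *)
Lemma chain_image s1 p s2 : s = s1 ++ p :: s2 -> b p = 0 ->
  [/\ \rank (chain a b s) = \rank P, (chain a b s :=: Q p *m chain a b s2)%MS &
      forall v, (v <= chain a b s)%MS -> in_cone P v].
Proof.
move=> sE bp; have ps : p \in s by rewrite sE mem_cat mem_head orbT.
have [_ _ ap hQ] := ab ps; rewrite bp addr0 in ap; have {}hQ := hQ ap.
have rPM : \rank (P *m chain a b s) = \rank P.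
  by apply: rank_mul_inj => v /(in_cone_image PP) cv; exact: chain_inj.
have MQ : (chain a b s <= Q p *m chain a b s2)%MS.
  by rewrite sE chain_cat /= bp scale0r add0r -scalemxAl -scalemxAr scalemx_sub // submxMl.
have rQ : \rank (Q p *m chain a b s2) = \rank P.
  rewrite -(near_proj_rank PP (QQ ps) hQ); apply: rank_mul_inj => v /submxP[u ->].
  apply: chain_inj; first by move=> q qs; rewrite sE mem_cat in_cons qs !orbT.
  by apply: (in_cone_near PP hQ); rewrite -mulmxA QQ.
have rM : \rank (chain a b s) = \rank P.
  apply/eqP; rewrite eqn_leq -{1}rQ mxrankS //= -rPM; exact: mxrankM_maxr.
split=> // [|v].
  by apply/eqmxP; rewrite -(geq_leqif (mxrank_leqif_eq MQ)) rQ rM.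
have /eqmxP PM : (P *m chain a b s == chain a b s)%MS.
  by rewrite -(geq_leqif (mxrank_leqif_eq (submxMl _ _))) rM rPM.
rewrite -PM => /submxP[u ->]; rewrite mulmxA.
have [->|w0] := eqVneq (u *m P) 0; first by rewrite mul0mx /in_cone !mul0mx.
by have [] := in_cone_chain (s' := s) (fun _ h => h) (in_cone_image PP (submxMl u P)) w0.
Qed.

End ChainImage.


End Chain.
End SmallMatrices.

(** * Existence: approximation by piecewise-algebraic bundles *)

Lemma mem_cat_split (T : eqType) (x : T) s : x \in s -> exists s1 s2, s = s1 ++ x :: s2.
Proof. by case/splitPr=> s1 s2; exists s1, s2. Qed.

Section ChainFrames.
Variables (R : realType) (K : scalar_kind) (I : eqType) (m : nat).
Local Notation F := (scalar R K).
Local Notation D := (rdim K).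
Variable Q : I -> 'M[R]_(m * D).

Lemma chain_linear (a b : I -> R) s :
  (forall p, p \in s -> scalar_linear (Q p)) -> scalar_linear (chain Q a b s).
Proof.
elim: s => [|p s IH] hQ /=; first exact: scalar_linear1.
apply: scalar_linearM; last by apply: IH => q qs; apply: hQ; rewrite in_cons qs orbT.
apply: scalar_linearD; first exact/scalar_linearZ/scalar_linear1.
by apply/scalar_linearZ/hQ/mem_head.
Qed.

Definition chain_frame (a b : I -> R) s r (B : 'M[F]_(r, m)) : 'M[F]_(r, m) :=
  \matrix_i linmap (chain Q a b s) (row i B).

Lemma mx_class_chain (T : Type) opn (cls : fun_class R T) A (a b : T -> I -> R) s :
  function_algebra opn cls ->
  (forall p, p \in s -> cls A (a^~ p)) -> (forall p, p \in s -> cls A (b^~ p)) ->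
  mx_class cls A (fun x => chain Q (a x) (b x) s).
Proof.
move=> alg; elim: s => [|p s IH] ha hb /=; first exact: (mx_class_cst alg).
apply: (mx_classM alg); last first.
  by apply: IH => q qs; [apply: ha|apply: hb]; rewrite in_cons qs orbT.
apply: (mx_classD alg); apply: (mx_classZ alg); try exact: (mx_class_cst alg).
  by apply: hb; exact: mem_head.
by apply: ha; exact: mem_head.
Qed.

Lemma chain_frame_class (T : Type) opn (cls : fun_class R T) A (a b : T -> I -> R) s
    r (B : 'M[F]_(r, m)) i j c :
  function_algebra opn cls ->
  (forall p, p \in s -> cls A (a^~ p)) -> (forall p, p \in s -> cls A (b^~ p)) ->
  cls A (fun x => real_of_scalar (chain_frame (a x) (b x) s B i j) 0 c).
Proof.
move=> alg ha hb.
have := mx_classM alg (mx_class_cst alg A (rvec (row i B))) (mx_class_chain alg ha hb).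
move=> /(_ 0 (mxvec_index j c)); apply: (cls_ext alg) => x _.
by rewrite /chain_frame mxE /linmap cvecE.
Qed.

(** The factors that precede the multiple of a projection do not change the image and those
    that follow are injective on the cone, so a fixed basis of the image of that projection
    is carried to a basis of the image of the chain, with entries that are polynomial in
    the weights. *)
Lemma chain_frame_basis (P : 'M[R]_(m * D)) (a b : I -> R) s s1 p s2
    (W : set 'rV[F]_m) r (B : 'M[F]_(r, m)) :
  P *m P = P -> (forall q, q \in s -> Q q *m Q q = Q q) ->
  (forall q, q \in s -> [/\ 0 <= a q, 0 <= b q, 0 < a q + b q & 0 < a q -> near_proj P (Q q)]) ->
  (forall q, q \in s -> scalar_linear (Q q)) ->
  s = s1 ++ p :: s2 -> b p = 0 -> is_oproj W (Q p) -> is_basis B W ->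
  is_basis (chain_frame a b s2 B) [set v | (rvec v <= chain Q a b s)%MS].
Proof.
move=> PP QQ ab lQ sE bp [_ QQp WQ] [injB WB].
have ps : p \in s by rewrite sE mem_cat mem_head orbT.
have s2s : {subset s2 <= s} by move=> q qs; rewrite sE mem_cat in_cons qs !orbT.
have [_ _ ap hQ] := ab p ps; rewrite bp addr0 in ap; have {}hQ := hQ ap.
have lM : scalar_linear (chain Q a b s2) by apply: chain_linear => q /s2s/lQ.
have frameE (u : 'rV[F]_r) : rvec (u *m chain_frame a b s2 B) = rvec (u *m B) *m chain Q a b s2.
  by rewrite (scalar_linear_mx _ _ lM).
have [_ MQ _] := chain_image PP QQ ab sE bp.
split=> [u v uv|].
  apply: injB; apply/eqP; rewrite -subr_eq0 -mulmxBl; apply/eqP.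
  have WuvB : W ((u - v) *m B) by rewrite WB; exists (u - v).
  apply: (can_inj (@rvecK R K m)); rewrite rvec0.
  apply: (chain_inj PP ab s2s); first by apply: (in_cone_near PP hQ); apply/WQ.
  by rewrite -frameE mulmxBl uv subrr rvec0.
apply/seteqP; split=> [v /=|v [u _ <-] /=].
  rewrite MQ => /submxP[u vE].
  have : W (cvec (u *m Q p)) by apply/WQ; rewrite cvecK -mulmxA QQp.
  rewrite {1}WB => -[w _ wB]; exists w => //; apply: (can_inj (@rvecK R K m)).
  by rewrite frameE wB cvecK vE mulmxA.
have /WQ : W (u *m B) by rewrite WB; exists u.
by rewrite MQ frameE => <-; rewrite -mulmxA submxMl.
Qed.

End ChainFrames.

Section Existence.
Variables (R : realType) (K : scalar_kind) (V : real_algebraic_variety R).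
Variables (n : nat) (e : V -> 'rV[R]_n) (L : set V) (l k : nat).
Hypotheses (he : biregular_onto_image e) (cL : euclidean_compact L).
Local Notation F := (scalar R K).
Local Notation D := (rdim K).

Lemma image_compact : compact (e @` L).
Proof.
apply: (@continuous_compact (euclidean V)); last exact: cL.
exact: (@continuous_subspaceT (euclidean V) _ L e (embedding_continuous he)).
Qed.

Lemma Ck_class_le (E : normedModType R) i j (A : set E) f :
  (i <= j)%N -> Ck_class j A f -> Ck_class i A f.
Proof.
move=> ij hf a Aa; have [U [g [oU Ua hg fg]]] := hf a Aa.
by exists U, g; split=> //; exact: Ck_open_le hg.
Qed.

Lemma Ck_extension_le i j U m (xi : fibers R K V m) xih :
  (i <= j)%N -> Ck_extension e j L U xi xih -> Ck_extension e i L U xi xih.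
Proof.
move=> ij [oU LU hxi xiE]; split=> // y Uy.
have [W [r [s [oW Wy cs sb]]]] := hxi y Uy; exists W, r, s; split=> //.
by move=> a b c; exact: Ck_class_le (cs a b c).
Qed.

Lemma Ck_class_continuous j (U : set 'rV[R]_n) f y : open U -> U y ->
  Ck_class j U f -> {for y, continuous f}.
Proof. by move=> oU Uy /(Ck_class_open oU) hf; exact: (Ck_open_continuous hf Uy). Qed.

Section Approximation.
Variables (m : nat) (xi : fibers R K V m) (U : set 'rV[R]_n) (xih : fibers R K 'rV[R]_n m).
Hypothesis exi : Ck_extension e l L U xi xih.

Let Q (p : 'rV[R]_n * R) := oproj (xih p.1).

Definition close_fibers c y := U y /\ near_proj (oproj (xih y)) (oproj (xih c)).

Lemma close_fibers_near c : (e @` L) c -> \forall y \near c, close_fibers c y.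
Proof.
move=> Lc; have [oU LU hxi _] := exi; have Uc := LU c Lc.
have [cP oP _] := subbundle_oproj (Ck_function_algebra _ l) hxi.
have alg := Ck_function_algebra 'rV[R]_n l.
pose P y := oproj (xih y).
have cd : mx_class (@Ck_class R 'rV[R]_n l) U (fun y => P c - P y).
  by apply: (mx_classB alg); [exact: (mx_class_cst alg)|].
have c1 : mx_class (@Ck_class R 'rV[R]_n l) U (fun y => 1%:M - P y).
  by apply: (mx_classB alg); [exact: (mx_class_cst alg)|].
have UN : nbhs c U by exact: open_nbhs_nbhs.
have n1 : \forall y \near c, small ((P c - P y) *m P y).
  apply: small_near; last by rewrite subrr mul0mx.
  by move=> i j; apply: (Ck_class_continuous oU Uc (mx_classM alg cd cP i j)).
have n2 : \forall y \near c, small ((P c - P y) *m (1%:M - P y)).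
  apply: small_near; last by rewrite subrr mul0mx.
  by move=> i j; apply: (Ck_class_continuous oU Uc (mx_classM alg cd c1 i j)).
by apply: filterS (filterI UN (filterI n1 n2)) => y [Uy [h1 h2]].
Qed.

Variable pts : seq ('rV[R]_n * R).
Hypothesis hpts : forall p, p \in pts ->
  [/\ (e @` L) p.1, 0 < p.2 & forall y, 0 < outer p y -> close_fibers p.1 y].

Let a (y : 'rV[R]_n) (p : 'rV[R]_n * R) : R := outer_bump k p y.
Let b (y : 'rV[R]_n) (p : 'rV[R]_n * R) : R := inner_bump k p y.

(** The image of the product of the interpolated projections onto the fibers of [xih] at the
    centers: the factor of a bump is a multiple of the identity outside of its support and
    of the projection on its plateau. *)
Definition approx : fibers R K 'rV[R]_n m :=
  fun y => [set v | (rvec v <= chain Q (a y) (b y) pts)%MS].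

Definition on_plateau (y : 'rV[R]_n) (p : 'rV[R]_n * R) := p \in pts /\ inner p y <= 0.

Lemma outer_plateau y p : on_plateau y p -> 0 < outer p y.
Proof. by move=> [/hpts[_ p0 _]]; exact: outer_gt0. Qed.

Lemma inner_bump_plateau y p : on_plateau y p -> b y p = 0.
Proof. by move=> [_ ?]; rewrite /b /inner_bump /pospow max_l // expr0n. Qed.

Lemma U_plateau y p : on_plateau y p -> U y.
Proof. by move=> h; have [/hpts[_ _ /(_ y (outer_plateau h))[]]] := h. Qed.

Lemma oproj_U y : U y -> is_oproj (xih y) (oproj (xih y)) /\ scalar_linear (oproj (xih y)).
Proof.
have [_ _ hxi _] := exi.
by have [_ oP lP] := subbundle_oproj (Ck_function_algebra _ l) hxi; auto.
Qed.

Lemma oproj_pts p : p \in pts -> is_oproj (xih p.1) (Q p) /\ scalar_linear (Q p).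
Proof. by move=> /hpts[Lp _ _]; apply: oproj_U; have [_ LU _ _] := exi; exact: LU. Qed.

Lemma bump_conditions y p : p \in pts ->
  [/\ 0 <= a y p, 0 <= b y p, 0 < a y p + b y p &
      0 < a y p -> near_proj (oproj (xih y)) (Q p)].
Proof.
move=> /hpts[_ p0 hp]; split; [exact: pospow_ge0|exact: pospow_ge0|exact: bump_sum_gt0|].
by rewrite pospow_gt0 => /hp[].
Qed.

Lemma idempotent_pts p : p \in pts -> Q p *m Q p = Q p.
Proof. by move=> /oproj_pts[[]]. Qed.

Lemma approx_frame y p s1 s2 r (B : 'M[F]_(r, m)) : on_plateau y p ->
  pts = s1 ++ p :: s2 -> is_basis B (xih p.1) ->
  is_basis (chain_frame Q (a y) (b y) s2 B) (approx y).
Proof.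
move=> hp ptsE hB; have [ps _] := hp.
have [[_ PP _] _] := oproj_U (U_plateau hp).
apply: (chain_frame_basis PP idempotent_pts (bump_conditions y) _ ptsE) => //.
- by move=> q /oproj_pts[].
- exact: inner_bump_plateau.
- exact: (proj1 (oproj_pts ps)).
exact: hB.
Qed.

Lemma plateau_basis p : p \in pts -> exists r (B : 'M[F]_(r, m)), is_basis B (xih p.1).
Proof.
move=> /hpts[Lp _ _]; have [_ LU hxi _] := exi.
have [W [r [s [_ Wp _ sb]]]] := hxi p.1 (LU _ Lp).
by exists r, (s p.1); apply: sb => //; exact: LU.
Qed.

Definition plateaux : set 'rV[R]_n := [set y | exists2 p, p \in pts & inner p y < 0].

Lemma approx_subbundle : subbundle open (@Ck_class R 'rV[R]_n k) plateaux approx.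
Proof.
move=> y [p ps py]; have [r [B hB]] := plateau_basis ps.
have [s1 [s2 ptsE]] := mem_cat_split ps.
exists [set z | inner p z < 0], r, (fun z => chain_frame Q (a z) (b z) s2 B); split=> //.
- rewrite (_ : [set z | _] = [set z | sqdist p.1 z < p.2 ^+ 2]); first exact: sqdist_ball_open.
  by apply/seteqP; split=> z /=; rewrite subr_lt0.
- move=> i j c.
  apply: (@chain_frame_class R K _ m Q _ open (@Ck_class R _ k) _ a b s2 r B i j c
    (Ck_function_algebra _ k)) => q _.
    exact: (cls_sub (Ck_function_algebra _ k) _ (outer_bump_class k q)).
  exact: (cls_sub (Ck_function_algebra _ k) _ (inner_bump_class k q)).
by move=> z _ pz; apply: approx_frame ptsE hB; split=> //; exact: ltW.
Qed.

Lemma open_plateaux : open plateaux.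
Proof.
rewrite (_ : plateaux = \bigcup_(p in [set p | p \in pts]) [set y | sqdist p.1 y < p.2 ^+ 2]).
  by apply: bigcup_open => p _; exact: sqdist_ball_open.
by apply/seteqP; split=> y [p ps py]; exists p => //; move: py; rewrite /= subr_lt0.
Qed.

Hypothesis cover : e @` L `<=` plateaux.

Definition approx_bundle : fibers R K V m := fun x => approx (e x).

Lemma approx_extension : Ck_extension e k L plateaux approx_bundle approx.
Proof. by split; [exact: open_plateaux|exact: cover|exact: approx_subbundle|]. Qed.

(** The image of the chain lies in the cone around the fiber of [xi] and has the same
    dimension as this fiber, so orthogonal projection between them is bijective. *)
Lemma approx_good x : L x -> compress_good xi approx_bundle (fun=> 1%:M) x.
Proof.
move=> Lx; have [p ps px] := cover (imageP e Lx).
have hp : on_plateau (e x) p by split=> //; exact: ltW.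
have [_ _ _ xiE] := exi; have := oproj_U (U_plateau hp).
rewrite /compress_good /compress mulmx1 xiE //.
set P := oproj (xi x) => -[[PT PP _] _].
have [s1 [s2 ptsE]] := mem_cat_split ps.
have bc q : q \in pts -> _ := bump_conditions (e x) (p := q).
rewrite xiE // -/P in bc.
have [rM _ cM] := chain_image PP idempotent_pts bc ptsE (inner_bump_plateau hp).
have [r [B hB]] := plateau_basis ps.
have [_ /oprojP[HT HH WH]] := oproj_basis (approx_frame hp ptsE hB).
rewrite -/(approx_bundle x) in HT HH WH; set H := oproj (approx_bundle x) in HT HH WH *.
have inM (v : 'rV[R]_(m * D)) : v *m H = v -> (v <= chain Q (a (e x)) (b (e x)) pts)%MS.
  move=> vH; have := (WH (@cvec R K m v)).2; rewrite cvecK => /(_ vH).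
  by rewrite /approx_bundle /approx /= cvecK.
have HM : (H :=: chain Q (a (e x)) (b (e x)) pts)%MS.
  apply/eqmxP/andP; split; apply/row_subP => i.
    by apply: inM; rewrite -row_mul HH.
  have /WH : approx_bundle x (cvec (row i (chain Q (a (e x)) (b (e x)) pts))).
    by rewrite /approx_bundle /approx /= cvecK row_sub.
  by rewrite cvecK => <-; rewrite submxMl.
have rHP : \rank (H *m P) = \rank H.
  by apply: rank_mul_inj => v; rewrite HM => /cM; exact: in_cone_eq0.
have rPH : \rank (P *m H) = \rank (H *m P) by rewrite -mxrank_tr trmx_mul PT HT.
by rewrite rPH rHP HM rM.
Qed.

End Approximation.
End Existence.

Section PiecewisePowers.
Variables (R : realType) (V : real_algebraic_variety R).
Variables (n : nat) (e : V -> 'rV[R]_n).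
Hypothesis he : biregular_onto_image e.

(** On any set where these functions have constant signs, all the bumps are polynomial. *)
Definition bump_functions (pts : seq ('rV[R]_n * R)) : seq (V -> R) :=
  flatten [seq [:: (fun x => outer p (e x)); (fun x => inner p (e x))] | p <- pts].

Lemma outer_regular A p : @regular_class R V A (fun x => outer p (e x)).
Proof. by apply: (outer_class p (regular_function_algebra he)) => j; exact: regular_coord. Qed.

Lemma inner_regular A p : @regular_class R V A (fun x => inner p (e x)).
Proof. by apply: (inner_class p (regular_function_algebra he)) => j; exact: regular_coord. Qed.

Lemma bump_functions_regular pts i : (i < size (bump_functions pts))%N ->
  @regular_class R V [set: V] (nth (fun=> 0) (bump_functions pts) i).
Proof.
elim: pts i => [//|p pts IH] [|[|i]] /=.
- by move=> _; exact: outer_regular.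
- by move=> _; exact: inner_regular.
by rewrite !ltnS; exact: IH.
Qed.

Lemma outer_continuous p : continuous (fun x : euclidean V => outer p (e x)).
Proof.
move=> x; apply: (@continuous_comp (euclidean V) _ _ e (outer p)).
  exact: embedding_continuous.
by apply: continuousB; [exact: cst_continuous|exact: sqdist_continuous].
Qed.

Lemma inner_continuous p : continuous (fun x : euclidean V => inner p (e x)).
Proof.
move=> x; apply: (@continuous_comp (euclidean V) _ _ e (inner p)).
  exact: embedding_continuous.
by apply: continuousB; [exact: sqdist_continuous|exact: cst_continuous].
Qed.

Lemma bump_stratification pts : stratification (zero_strata (bump_functions pts)).
Proof. by apply: (zero_strataP he); exact: bump_functions_regular. Qed.

Lemma bump_sign pts A (L : set V) x y p :
  zero_strata (bump_functions pts) A -> (L `&` A) x ->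
  euclidean_component (L `&` A) x y -> p \in pts ->
  (0 < outer p (e y)) = (0 < outer p (e x)) /\ (0 < inner p (e y)) = (0 < inner p (e x)).
Proof.
move=> hA LAx Cy ppts.
have [i [ilt io ii]] : exists i, [/\ (i.+1 < size (bump_functions pts))%N,
    nth (fun=> 0) (bump_functions pts) i = (fun x => outer p (e x)) &
    nth (fun=> 0) (bump_functions pts) i.+1 = (fun x => inner p (e x))].
  elim: pts ppts {hA} => [//|q pts IH]; rewrite in_cons => /predU1P[->|/IH[i [h1 h2 h3]]].
    by exists 0%N.
  by exists i.+2; split.
split.
  have := component_sign hA LAx (ltnW ilt) _ Cy; rewrite io; apply; exact: outer_continuous.
have := component_sign hA LAx ilt _ Cy; rewrite ii; apply; exact: inner_continuous.
Qed.

(** The polynomial that agrees with [pospow k] where its argument has the sign of [s]. *)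
Definition signed_pow k (s t : R) : R := if 0 < s then t ^+ k else 0.

Lemma pospow_signed k (s t : R) : (0 < t) = (0 < s) -> pospow k.+1 t = signed_pow k.+1 s t.
Proof.
move=> ts; rewrite /pospow /signed_pow -ts; case: ltP => //.
by rewrite expr0n.
Qed.

Lemma signed_pow_regular k s A g : @regular_class R V A g ->
  @regular_class R V A (fun x => signed_pow k s (g x)).
Proof.
move=> hg; have alg := regular_function_algebra he; rewrite /signed_pow.
case: (0 < s); last exact: (cls_cst alg).
elim: k => [|k IH]; first by apply: (cls_ext alg _ (cls_cst alg A 1)) => x _; rewrite expr0.
by apply: (cls_ext alg _ (cls_mul alg hg IH)) => x _; rewrite exprS.
Qed.

End PiecewisePowers.

Section ExistenceTheorem.
Variables (R : realType) (K : scalar_kind) (V : real_algebraic_variety R).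
Variables (n : nat) (e : V -> 'rV[R]_n) (L : set V) (l k : nat).
Hypotheses (he : biregular_onto_image e) (lk : (l <= k)%N).
Local Notation F := (scalar R K).
Local Notation D := (rdim K).
Variables (m : nat) (xi : fibers R K V m) (U : set 'rV[R]_n) (xih : fibers R K 'rV[R]_n m).
Hypothesis exi : Ck_extension e l L U xi xih.
Variable pts : seq ('rV[R]_n * R).
Hypothesis hpts : forall p, p \in pts ->
  [/\ (e @` L) p.1, 0 < p.2 & forall y, 0 < outer p y -> close_fibers U xih p.1 y].
Hypothesis cover : e @` L `<=` plateaux pts.

Let eta := approx_bundle e k xih pts.

(** On a component of a stratum, a base point [x0] decides on which plateau the whole
    component lies and which polynomials the bumps are. The resulting frame is regular on
    all of [V], and remains a frame where its Gram determinant does not vanish. *)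
Lemma approx_pa_bundle : pa_bundle (zero_strata (bump_functions e pts)) L eta.
Proof.
have tL := Ck_top_bundle he (approx_extension k exi hpts cover).
split=> // A x0 hA LAx0; set S := euclidean_component _ _.
have SLA : S `<=` L `&` A by exact: (@connected_component_sub (euclidean V)).
have SL : S `<=` L by move=> x /SLA[].
split; first exact: top_bundle_sub tL.
have Lx0 : L x0 by have [] := LAx0.
have [p ps px] := cover (imageP e Lx0).
have [r [B hB]] := plateau_basis exi hpts ps.
have [s1 [s2 ptsE]] := mem_cat_split ps.
have alg := regular_function_algebra he.
pose a x q := signed_pow k.+1 (outer q (e x0)) (outer q (e x)).
pose b x q := signed_pow k.+1 (inner q (e x0)) (inner q (e x)).
pose s x := chain_frame (fun p => oproj (xih p.1)) (a x) (b x) s2 B.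
have cs X i j c : @regular_class R V X (fun x => real_of_scalar (s x i j) 0 c).
  apply: (@chain_frame_class R K _ m _ _ open (@regular_class R V) _ a b s2 r B i j c alg) => q _.
    by apply: (signed_pow_regular he); exact: (outer_regular he).
  by apply: (signed_pow_regular he); exact: (inner_regular he).
have sE x : S x -> is_basis (s x) (eta x).
  move=> Sx.
  have hp : on_plateau pts (e x) p.
    split=> //; rewrite leNgt; have [_ ->] := bump_sign he hA LAx0 Sx ps.
    by rewrite -leNgt ltW.
  rewrite (_ : s x = chain_frame (fun p => oproj (xih p.1))
      (fun q => outer_bump k q (e x)) (fun q => inner_bump k q (e x)) s2 B).
    exact: (approx_frame k exi hpts hp ptsE hB).
  rewrite /s /chain_frame; congr (\matrix_i linmap _ (row i B)).
  do 2 apply/funext => _; apply: eq_chain => q qs2;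
    have qs : q \in pts by rewrite ptsE mem_cat in_cons qs2 !orbT.
    by have [h _] := bump_sign he hA LAx0 Sx qs; rewrite /outer_bump (pospow_signed k h).
  by have [_ h] := bump_sign he hA LAx0 Sx qs; rewrite /inner_bump (pospow_signed k h).
have cS X := mx_class_real alg (cs X).
have [W oW XW] := cls_neq0 alg
  (cls_det alg (mx_classM alg (cS [set: V]) (mx_class_tr alg (cS [set: V])))).
have SW : S `<=` W.
  move=> x Sx; apply/(XW x I); rewrite -unitfE -unitmxE.
  by have [] := oproj_basis (sE x Sx).
exists (W `&` closure S), (fun x => [set u *m s x | u in [set: 'rV[F]_r]]); split.
- by split=> [x Sx|]; [split; [exact: SW|exact: subset_closure]|exists W].
- move=> x [Wx _]; exists W, r, s; split=> // y _ Wy; split=> //.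
  by apply/basis_injP/gram_unit; rewrite unitmxE unitfE; exact/(XW y I).
by move=> x /sE[_ ->].
Qed.

Lemma approx_Ckpa : Ckpa_bundle e k L eta.
Proof.
exists (zero_strata (bump_functions e pts)); first exact: bump_stratification.
split; first exact: approx_pa_bundle.
have ext := approx_extension k exi hpts cover.
by split; [exact: Ck_top_bundle ext|exists (plateaux pts), (approx k xih pts)].
Qed.

Lemma approx_isomorphic : Ck_isomorphic e l L xi eta.
Proof.
have ext := Ck_extension_le lk (approx_extension k exi hpts cover).
have alg := Ck_function_algebra 'rV[R]_n l.
have [h1 h2 h3] := Ck_isomorphism (G := fun=> 1%:M) he exi ext openT (@subsetT _ _)
  (mx_class_cst alg [set: 'rV[R]_n] 1%:M) (fun _ _ => @scalar_linear1 R K m)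
  (approx_good k exi hpts cover).
by eexists; eexists; split; [exact: h1|exact: h2|exact: h3].
Qed.

End ExistenceTheorem.

Lemma exists_Ckpa_bundle (R : realType) (K : scalar_kind) (V : real_algebraic_variety R)
    (n : nat) (e : V -> 'rV[R]_n) (L : set V) (l k m : nat) (xi : fibers R K V m) :
  biregular_onto_image e -> euclidean_compact L -> (l <= k)%N -> Ck_bundle e l L xi ->
  exists (p : nat) (eta : fibers R K V p), Ckpa_bundle e k L eta /\ Ck_isomorphic e l L xi eta.
Proof.
move=> he cL lk [_ [U [xih exi]]].
have [pts [hpts cover]] := bump_cover (@image_compact _ _ _ _ _ he cL) (close_fibers_near exi).
exists m, (approx_bundle e k xih pts); split; first exact: (approx_Ckpa k he exi hpts cover).
exact: (approx_isomorphic he lk exi hpts cover).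
Qed.

(** * Uniqueness: averaging a continuous isomorphism *)

Section MatrixOfMorphism.
Variables (R : realType) (K : scalar_kind).
Local Notation F := (scalar R K).
Local Notation D := (rdim K).

Lemma real_scalar (c : R) : exists s : F, forall m (t : 'rV[R]_(m * D)),
  cvec (c *: t) = s *: cvec t :> 'rV[F]_m.
Proof.
have [s hs] : exists s : F, lscal_mx s = c%:M.
  rewrite /lscal_mx /real_unit; case: K.
  - exists c; apply/matrixP => i j; rewrite !mxE !ord1 /= mxE.
    by rewrite [inord 0]ord1 eqxx /= mulr1n mulr1.
  - exists (complex.Complex c 0); apply/matrixP => i j; rewrite !mxE.
    case: i => [[|[|i]] //= Hi]; case: j => [[|[|j]] //= Hj];
      rewrite -?val_eqE /= ?inordK //= ?eqxx /= ?mxE -?val_eqE /= ?inordK //=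
        ?mulr1n ?mulr0n; ring.
  exists (Quaternion c 0 0 0); apply/matrixP => i j; rewrite !mxE.
  case: i => [[|[|[|[|i]]]] //= Hi]; case: j => [[|[|[|[|j]]]] //= Hj];
    rewrite -?val_eqE /= ?inordK //= ?eqxx /= ?mxE -?val_eqE /= ?inordK //= ?mulr1n ?mulr0n; ring.
exists s => m t; apply: (can_inj (@rvecK R K m)); apply: rvec_eq => i d.
rewrite cvecK rvecE [in RHS]mxE real_of_scalarMl hs mul_mx_scalar !mxE.
by rewrite scalar_of_realK !mxE.
Qed.

Variables (m p : nat) (W : set 'rV[F]_m) (P : 'M[R]_(m * D)) (f : 'rV[F]_m -> 'rV[F]_p).
Hypotheses (hP : is_oproj W P) (lP : scalar_linear P).
Hypothesis lf : forall (a : F) u v, W u -> W v -> f (a *: u + v) = a *: f u + f v.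

(** Precomposing with the projection extends [f] by zero to the orthogonal complement. *)
Definition morphism_mx : 'M[R]_(m * D, p * D) := \matrix_i rvec (f (cvec (row i P))).

Lemma image_oproj (t : 'rV[R]_(m * D)) : W (cvec (t *m P)).
Proof. by have [_ PP WP] := hP; apply/WP; rewrite cvecK -mulmxA PP. Qed.

Lemma image_oproj0 : W 0.
Proof. by have := image_oproj 0; rewrite mul0mx -(rvec0 R K m) rvecK. Qed.

Lemma linear_on0 : f 0 = 0.
Proof.
by have := lf (-1) image_oproj0 image_oproj0; rewrite scaler0 addr0 scaleN1r addNr.
Qed.

Lemma mul_morphism_mx (t : 'rV[R]_(m * D)) :
  t *m morphism_mx = rvec (f (cvec (t *m P))).
Proof.
rewrite [t *m morphism_mx]mulmx_sum_row [t *m P]mulmx_sum_row.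
have Wrow i : W (cvec (row i P)) by rewrite rowE; exact: image_oproj.
have cvecD q : {morph @cvec R K q : u v / u + v}.
  by move=> u v; apply: (can_inj (@rvecK R K q)); rewrite rvecD !cvecK.
have Wsum s : W (cvec (\sum_(i <- s) t 0 i *: row i P)).
  have -> : \sum_(i <- s) t 0 i *: row i P = (\sum_(i <- s) t 0 i *: delta_mx 0 i) *m P.
    by rewrite mulmx_suml; apply: eq_bigr => i _; rewrite -scalemxAl -rowE.
  exact: image_oproj.
elim: (index_enum _) => [|i s IH].
  by rewrite !big_nil -(rvec0 R K m) rvecK linear_on0 rvec0.
rewrite !big_cons cvecD IH rowK.
have [c hc] := real_scalar (t 0 i).
rewrite hc lf // rvecD; congr (_ + _).
by rewrite -[rvec (f _) in LHS]cvecK -[LHS]cvecK hc rvecK rvecK.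
Qed.

Lemma oproj_morphism_mx : P *m morphism_mx = morphism_mx.
Proof.
have [_ PP _] := hP; apply/row_matrixP => i.
by rewrite row_mul [in RHS]rowE !mul_morphism_mx -row_mul PP -rowE.
Qed.

Lemma morphism_mx_linear : scalar_linear morphism_mx.
Proof.
move=> a; apply/row_matrixP => i; rewrite !row_mul !mul_morphism_mx !rowE -!mulmxA.
have -> : cvec (delta_mx 0 i *m (scale_mx m a *m P)) = a *: cvec (delta_mx 0 i *m P) :> 'rV[F]_m.
  by apply: (can_inj (@rvecK R K m)); rewrite rvecZ !cvecK -mulmxA lP.
have := lf a (image_oproj (delta_mx 0 i)) image_oproj0.
rewrite !addr0 linear_on0 addr0 => ->.
by rewrite rvecZ mulmxA mul_morphism_mx.
Qed.

Lemma rvec_morphism v : W v -> rvec (f v) = rvec v *m morphism_mx.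
Proof. by have [_ _ WP] := hP => /WP vP; rewrite mul_morphism_mx vP rvecK. Qed.

End MatrixOfMorphism.

Section MatrixOfCkMorphism.
Variables (R : realType) (K : scalar_kind) (V : real_algebraic_variety R).
Variables (n : nat) (e : V -> 'rV[R]_n) (L : set V) (l : nat).
Local Notation D := (rdim K).

Definition mx_continuous_at (B : set 'rV[R]_n) q r (A : 'rV[R]_n -> 'M[R]_(q, r)) :=
  forall y i j, B y -> {for y, continuous (fun z => A z i j)}.

(** Continuity is all that is asked of the matrix of a morphism, because the isomorphism
    that it describes only has to be approximated. *)
Lemma Ck_morphism_matrix m p (xi : fibers R K V m) (eta : fibers R K V p) phi :
  Ck_morphism e l L xi eta phi ->
  exists2 A : 'rV[R]_n -> 'M[R]_(m * D, p * D),
    mx_continuous_at (e @` L) A &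
    forall x, L x -> [/\ scalar_linear (A (e x)),
      is_oproj (xi x) (oproj (xi x)), is_oproj (eta x) (oproj (eta x)),
      oproj (xi x) *m A (e x) = A (e x) &
      forall v, xi x v -> eta x (phi x v) /\ rvec (phi x v) = rvec v *m A (e x)].
Proof.
move=> [[mphi _ _] [U [xih [etah [phih [exi eeta mor phiE]]]]]].
have [oU LU hxi xiE] := exi; have [_ _ heta etaE] := eeta; have [m1 m2 m3] := mor.
have alg := Ck_function_algebra 'rV[R]_n l.
have [cP oP lP] := subbundle_oproj alg hxi; have [_ oQ _] := subbundle_oproj alg heta.
pose A y := morphism_mx (oproj (xih y)) (phih y).
exists A => [y i0 j0 Ly|x Lx].
  have Uy := LU y Ly; case/mxvec_indexP: j0 => j c.
  pose t z := vec_mx (row i0 (oproj (xih z))) : 'M[R]_(m, D).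
  have ct : {for y, continuous t}.
    apply: mx_continuous => a b; rewrite (_ : (fun z => t z a b) =
        fun z => oproj (xih z) i0 (mxvec_index a b)); last by apply/funext => z; rewrite !mxE.
    by have := Ck_class_open oU (cP i0 (mxvec_index a b)) => /Ck_open_continuous; exact.
  have tot z : U z -> total_space U xih (z, t z).
    move=> Uz; split=> //; have [_ PP WP] := oP z Uz; apply/WP.
    by rewrite -[vec_of_real _]/(cvec _) cvecK -row_mul PP.
  have := m3 j c (y, t y) (tot y Uy) => -[N [g [oN Ny hg Fg]]].
  pose h (z : 'rV[R]_n) := (z, t z).
  have ch : {for y, continuous h}.
    have hp := cvg_pair (@cvg_id _ (nbhs y)) ct; exact: hp.
  have near_eq : \forall z \near y, g (h z) = A z i0 (mxvec_index j c).
    have nU : nbhs y U by exact: open_nbhs_nbhs.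
    have nN : \forall z \near y, N (h z) by apply: ch; exact: open_nbhs_nbhs.
    apply: filterS (filterI nU nN) => z [Uz Nz].
    by rewrite -Fg //; [rewrite mxE rvecE|exact: tot].
  have eq_y : g (h y) = A y i0 (mxvec_index j c) by exact: (nbhs_singleton near_eq).
  have cgh : {for y, continuous (g \o h)}.
    by apply: continuous_comp => //; exact: (Ck_open_continuous hg).
  rewrite /prop_for /continuous_at -eq_y.
  apply: (cvg_trans (near_eq_cvg near_eq)).
  exact: cgh.
have Ux : U (e x) by apply: LU; exact: imageP.
have lf (a : scalar R K) u v : xih (e x) u -> xih (e x) v ->
  phih (e x) (a *: u + v) = a *: phih (e x) u + phih (e x) v by move=> xu xv; exact: m2.
split.
- by apply: (morphism_mx_linear (oP _ Ux) (lP _ Ux) lf).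
- by rewrite -xiE //; exact: oP.
- by rewrite -etaE //; exact: oQ.
- by rewrite -xiE //; exact: (oproj_morphism_mx (oP _ Ux) lf).
move=> v xv; split; first exact: mphi.
by rewrite -phiE //; apply: (rvec_morphism (oP _ Ux) lf); rewrite xiE.
Qed.

End MatrixOfCkMorphism.

Section Uniqueness.
Variables (R : realType) (K : scalar_kind) (V : real_algebraic_variety R).
Variables (n : nat) (e : V -> 'rV[R]_n) (L : set V) (l k : nat).
Local Notation D := (rdim K).

Lemma mx_continuousM (B : set 'rV[R]_n) p q r (A : 'rV[R]_n -> 'M[R]_(p, q))
    (C : 'rV[R]_n -> 'M[R]_(q, r)) :
  mx_continuous_at B A -> mx_continuous_at B C -> mx_continuous_at B (fun y => A y *m C y).
Proof.
move=> cA cC y i j By; rewrite (_ : (fun z => _) = fun z => \sum_a A z i a * C z a j); last first.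
  by apply/funext => z; rewrite mxE.
elim: (index_enum _) => [|a s IH].
  rewrite (_ : (fun z => _) = fun=> 0); first exact: cst_continuous.
  by apply/funext => z; rewrite big_nil.
rewrite (_ : (fun z => _) = (fun z => A z i a * C z a j) \+
    (fun z => \sum_(a <- s) A z i a * C z a j)); last first.
  by apply/funext => z; rewrite big_cons.
by apply: continuousD => //; apply: continuousM; [exact: cA|exact: cC].
Qed.

(** Both matrices vanish on orthogonal complements, hence their products are the orthogonal
    projections rather than identities. *)
Definition continuous_iso m p (xi : fibers R K V m) (eta : fibers R K V p)
    (A : 'rV[R]_n -> 'M[R]_(m * D, p * D)) (B : 'rV[R]_n -> 'M[R]_(p * D, m * D)) :=
  [/\ mx_continuous_at (e @` L) A, mx_continuous_at (e @` L) B &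
   forall x, L x -> [/\ scalar_linear (A (e x)), A (e x) *m B (e x) = oproj (xi x),
     B (e x) *m A (e x) = oproj (eta x), A (e x) *m oproj (eta x) = A (e x) &
     B (e x) *m oproj (xi x) = B (e x)]].

Lemma Ck_isomorphic_matrices m p (xi : fibers R K V m) (eta : fibers R K V p) :
  Ck_isomorphic e l L xi eta -> exists A B, continuous_iso xi eta A B.
Proof.
move=> [phi [psi [hphi hpsi [psiphi phipsi]]]].
have [A cA hA] := Ck_morphism_matrix hphi; have [B cB hB] := Ck_morphism_matrix hpsi.
exists A, B; split=> // x Lx.
have [lA oP oQ PA phiA] := hA x Lx; have [lB _ _ QB psiB] := hB x Lx.
have [_ PP WP] := oP; have [_ QQ WQ] := oQ.
have Pin (t : 'rV_(m * D)) : xi x (cvec (t *m oproj (xi x))).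
  by apply/WP; rewrite cvecK -mulmxA PP.
have Qin (t : 'rV_(p * D)) : eta x (cvec (t *m oproj (eta x))).
  by apply/WQ; rewrite cvecK -mulmxA QQ.
have AE i : row i (A (e x)) = rvec (phi x (cvec (row i (oproj (xi x))))).
  have [|_ ->] := phiA (cvec (row i (oproj (xi x)))); rewrite ?cvecK -?row_mul ?PA // rowE.
  exact: Pin.
have BE i : row i (B (e x)) = rvec (psi x (cvec (row i (oproj (eta x))))).
  have [|_ ->] := psiB (cvec (row i (oproj (eta x)))); rewrite ?cvecK -?row_mul ?QB // rowE.
  exact: Qin.
have Prow i : xi x (cvec (row i (oproj (xi x)))) by rewrite rowE; exact: Pin.
have Qrow i : eta x (cvec (row i (oproj (eta x)))) by rewrite rowE; exact: Qin.
split=> //; apply/row_matrixP => i; rewrite row_mul ?AE ?BE.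
- have [e1 _] := phiA _ (Prow i); have [_ <-] := psiB _ e1.
  by rewrite psiphi // cvecK.
- have [e1 _] := psiB _ (Qrow i); have [_ <-] := phiA _ e1.
  by rewrite phipsi // cvecK.
- by have [e1 _] := phiA _ (Prow i); apply/WQ.
- by have [e1 _] := psiB _ (Qrow i); apply/WP.
Qed.

Lemma continuous_iso_comp m p q (xi : fibers R K V m) (eta : fibers R K V p)
    (zeta : fibers R K V q) A B A' B' :
  continuous_iso xi eta A B -> continuous_iso eta zeta A' B' ->
  continuous_iso xi zeta (fun y => A y *m A' y) (fun y => B' y *m B y).
Proof.
move=> [cA cB h] [cA' cB' h']; split; [exact: mx_continuousM|exact: mx_continuousM|].
move=> x Lx; have [lA AB BA AQ BP] := h x Lx; have [lA' AB' BA' AQ' BP'] := h' x Lx.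
split; first exact: scalar_linearM.
- by rewrite mulmxA -[_ *m A' _ *m _]mulmxA AB' AQ AB.
- by rewrite mulmxA -[_ *m B _ *m _]mulmxA BA BP' BA'.
- by rewrite -mulmxA AQ'.
- by rewrite -mulmxA BP.
Qed.

Section TwoBundles.
Variables (p1 p2 : nat) (eta1 : fibers R K V p1) (eta2 : fibers R K V p2).
Variables (U1 U2 : set 'rV[R]_n).
Variables (eta1h : fibers R K 'rV[R]_n p1) (eta2h : fibers R K 'rV[R]_n p2).
Hypotheses (ex1 : Ck_extension e k L U1 eta1 eta1h) (ex2 : Ck_extension e k L U2 eta2 eta2h).
Variables (A : 'rV[R]_n -> 'M[R]_(p1 * D, p2 * D)) (B : 'rV[R]_n -> 'M[R]_(p2 * D, p1 * D)).
Hypothesis iAB : continuous_iso eta1 eta2 A B.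

Let P1 y := oproj (eta1h y).
Let P2 y := oproj (eta2h y).

(** The difference vanishes at [y = c]; freezing [A] at a center makes it constant, hence
    algebraic, at the price of this small error. *)
Definition close_matrices c y := small (P1 y *m A c *m P2 y *m B y - P1 y).

Lemma extension_oproj_continuous m (xi : fibers R K V m) U xih :
  Ck_extension e k L U xi xih -> mx_continuous_at (e @` L) (fun y => oproj (xih y)).
Proof.
move=> [oU LU hxi _] y i j /LU Uy; have alg := Ck_function_algebra 'rV[R]_n k.
have [cP _ _] := subbundle_oproj alg hxi.
exact: (Ck_class_continuous oU Uy (cP i j)).
Qed.

Lemma close_matrices_near c : (e @` L) c -> \forall y \near c, close_matrices c y.
Proof.
move=> Lc; have [_ cB hAB] := iAB.
have c1 := extension_oproj_continuous ex1; have c2 := extension_oproj_continuous ex2.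
have cA : mx_continuous_at (e @` L) (fun=> A c) by move=> y i j _; exact: cst_continuous.
have cM := mx_continuousM (mx_continuousM (mx_continuousM c1 cA) c2) cB.
apply: small_near => [i j|].
  rewrite (_ : (fun y => _) = (fun y => (P1 y *m A c *m P2 y *m B y) i j) -
      (fun y => P1 y i j)); last first.
    by apply/funext => y; rewrite [LHS]mxE [X in _ + X = _]mxE.
  by apply: continuousB; [exact: cM|exact: c1].
have [x Lx <-] := Lc; have [_ _ _ e1] := ex1; have [_ _ _ e2] := ex2.
rewrite /P1 /P2 e1 // e2 //; have [_ AB _ AQ _] := hAB x Lx.
rewrite -[oproj _ *m _ *m _]mulmxA AQ -mulmxA AB.
have [_ LU hxi _] := ex1.
have [_ oP _] := subbundle_oproj (Ck_function_algebra 'rV[R]_n k) hxi.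
have := oP (e x) (LU _ (imageP _ Lx)); rewrite e1 // => -[_ PP _].
by rewrite PP subrr.
Qed.

Variable pts : seq ('rV[R]_n * R).
Hypothesis hpts : forall p, p \in pts ->
  [/\ (e @` L) p.1, 0 < p.2 & forall y, 0 < outer p y -> close_matrices p.1 y].
Hypothesis cover : e @` L `<=` plateaux pts.

Definition average y : 'M[R]_(p1 * D, p2 * D) :=
  \sum_(p <- pts) outer_bump k p y *: A p.1.

Lemma mx_class_sum (T : Type) opn (cls : fun_class R T) X q r (s : seq ('rV[R]_n * R))
    (f : T -> 'rV[R]_n * R -> R) (M : 'rV[R]_n * R -> 'M[R]_(q, r)) :
  function_algebra opn cls -> (forall p, cls X (f^~ p)) ->
  mx_class cls X (fun x => \sum_(p <- s) f x p *: M p).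
Proof.
move=> alg hf; elim: s => [|p s IH].
  by apply: (mx_class_ext alg _ (mx_class_cst alg X 0)) => x _; rewrite big_nil.
apply: (mx_class_ext alg _ (mx_classD alg (mx_classZ alg (hf p) (mx_class_cst alg X (M p))) IH)).
by move=> x _; rewrite big_cons.
Qed.

Lemma weighted_sum_linear (w : 'rV[R]_n * R -> R) :
  scalar_linear (\sum_(p <- pts) w p *: A p.1).
Proof.
rewrite big_seq; apply: (big_ind (@scalar_linear R K p1 p2)).
- exact: scalar_linear0.
- by move=> M N; exact: scalar_linearD.
move=> p /hpts[[x Lx xp] _ _]; apply: scalar_linearZ; rewrite -xp.
by have [_ _ /(_ x Lx)[]] := iAB.
Qed.

(** Composed with [B], the compression of the average is a positive multiple of a small
    perturbation of the identity, hence it is injective on the fibers of [eta1]. *)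
Lemma average_good x : L x -> compress_good eta1 eta2 (average \o e) x.
Proof.
move=> Lx; have [_ _ hAB] := iAB; have [_ AB BA AQ BP] := hAB x Lx.
have [_ _ _ e1] := ex1; have [_ _ _ e2] := ex2.
have [_ LU1 hx1 _] := ex1.
have [_ oP _] := subbundle_oproj (Ck_function_algebra 'rV[R]_n k) hx1.
have := oP (e x) (LU1 _ (imageP _ Lx)); rewrite e1 // => -[PT PP _].
have r12 : \rank (oproj (eta1 x)) = \rank (oproj (eta2 x)).
  apply/eqP; rewrite eqn_leq; apply/andP; split.
    rewrite -PP -{1}AB -AQ -mulmxA; apply: leq_trans (mxrankM_maxl _ _) _.
    exact: mxrankM_maxr.
  have QQ : oproj (eta2 x) *m oproj (eta2 x) = oproj (eta2 x).
    by rewrite -{1}BA -mulmxA AQ.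
  rewrite -QQ -{1}BA -BP -mulmxA; apply: leq_trans (mxrankM_maxl _ _) _.
  exact: mxrankM_maxr.
rewrite /compress_good -r12.
suff -> : \rank (compress eta1 eta2 (average \o e) x) = \rank (oproj (eta1 x)) by [].
rewrite /compress -mulmxA; apply: rank_mul_inj => v /submxP[u vu] /= vG.
have vP : v *m oproj (eta1 x) = v by rewrite vu -mulmxA PP.
pose w (p : 'rV[R]_n * R) := outer_bump k p (e x).
pose X (p : 'rV[R]_n * R) := P1 (e x) *m A p.1 *m P2 (e x) *m B (e x) - P1 (e x).
have wX p : p \in pts -> `|w p *: (v *m X p)| <= w p * (8^-1 * `|v|).
  move=> /hpts[_ _ hp]; rewrite normrZ ger0_norm ?pospow_ge0 //.
  have [pos|npos] := ltP 0 (outer p (e x)).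
    by rewrite ler_wpM2l ?pospow_ge0 //; exact: hp.
  by rewrite (_ : w p = 0) ?mul0r // /w /outer_bump /pospow max_l // expr0n.
(* a vector killed by the compression is balanced by the sum of the errors *)
have sumX : \sum_(p <- pts) w p *: (v *m X p) = - (\sum_(p <- pts) w p) *: v.
  have : v *m (average (e x) *m oproj (eta2 x)) *m B (e x) = 0 by rewrite vG mul0mx.
  rewrite /average mulmx_suml mulmx_sumr mulmx_suml => s0.
  apply/eqP; rewrite -subr_eq0 scaleNr opprK scaler_suml -big_split /=; apply/eqP.
  rewrite -[RHS]s0; apply: eq_bigr => p _.
  rewrite /X /P1 /P2 e1 // e2 // -scalerDr -!scalemxAl -!scalemxAr -!scalemxAl; congr (_ *: _).
  by rewrite mulmxBr vP addrNK !mulmxA vP.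
have w0 p : 0 <= w p by exact: pospow_ge0.
have [p ps px] := cover (imageP e Lx).
have sw : 0 < \sum_(q <- pts) w q.
  rewrite big_seq; have [s1 [s2 ptsE]] := mem_cat_split ps.
  rewrite -big_seq ptsE big_cat big_cons /= ltr_wpDl ?sumr_ge0 // ltr_pwDl ?sumr_ge0 //.
  by rewrite pospow_gt0; have [_ p0 _] := hpts ps; apply: outer_gt0 => //; exact: ltW.
have : (\sum_(q <- pts) w q) * `|v| <= (\sum_(q <- pts) w q) * (8^-1 * `|v|).
  rewrite -{1}(gtr0_norm sw) -normrZ -normrN -scaleNr -sumX mulr_suml.
  apply: le_trans (ler_norm_sum _ _ _) _.
  by rewrite big_seq [leRHS]big_seq; apply: ler_sum => q; exact: wX.
rewrite ler_pM2l // => hv; apply/eqP; rewrite -normr_le0; move: hv; set z := `|v|; lra.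
Qed.

End TwoBundles.
End Uniqueness.

Section PiecewiseIsomorphism.
Variables (R : realType) (K : scalar_kind) (V : real_algebraic_variety R).
Variables (n : nat) (e : V -> 'rV[R]_n) (L : set V) (k : nat).
Local Notation D := (rdim K).
Hypotheses (he : biregular_onto_image e) (cL : euclidean_compact L).
Variables (p1 p2 : nat) (eta1 : fibers R K V p1) (eta2 : fibers R K V p2).

(** The compression of the average of the matrix [A] is of class [C^k], and it is algebraic
    on the components of any stratification that refines those of the two bundles and the
    zero sets of the polynomials defining the bumps. *)
Lemma Ckpa_isomorphism A B :
  Ckpa_bundle e k L eta1 -> Ckpa_bundle e k L eta2 ->
  continuous_iso e L eta1 eta2 A B -> Ckpa_isomorphic e k L eta1 eta2.
Proof.
move=> [S1 hS1 [pa1 Ck1]] [S2 hS2 [pa2 Ck2]] iAB.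
have [_ [U1 [eta1h ex1]]] := Ck1; have [_ [U2 [eta2h ex2]]] := Ck2.
have [pts [hpts cover]] := bump_cover (@image_compact _ _ _ _ _ he cL)
  (close_matrices_near ex1 ex2 iAB).
have alg := Ck_function_algebra 'rV[R]_n k; have algV := regular_function_algebra he.
pose G y := average k A pts y.
have cG : mx_class (@Ck_class R 'rV[R]_n k) [set: 'rV[R]_n] G.
  apply: (mx_class_sum pts (f := fun y p => outer_bump k p y) (fun p => A p.1) alg) => p.
  exact: outer_bump_class.
have lG y : scalar_linear (G y) := weighted_sum_linear iAB hpts (fun p => outer_bump k p y).
have good x : L x -> compress_good eta1 eta2 (G \o e) x.
  exact: (average_good ex1 ex2 iAB hpts cover).
have [h1 h2 h3] := Ck_isomorphism he ex1 ex2 openT (@subsetT _ _) cG (fun y _ => lG y) good.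
set phi := (X in Ck_morphism e k L eta1 eta2 X) in h1.
set psi := (X in Ck_morphism e k L eta2 eta1 X) in h2.
pose S3 := zero_strata (bump_functions e pts).
pose S := common_refinement (common_refinement S1 S2) S3.
have hS : stratification S.
  apply: stratification_refinement; first exact: stratification_refinement.
  exact: bump_stratification.
have paS1 : pa_bundle S L eta1 by do 2 apply: (pa_bundle_refinement he).
have paS2 : pa_bundle S L eta2.
  apply: (pa_bundle_refinement he); rewrite common_refinementC.
  exact: (pa_bundle_refinement he).
have morph A0 x0 : S A0 -> (L `&` A0) x0 ->
    alg_morphism (euclidean_component (L `&` A0) x0) eta1 eta2 phi /\
    alg_morphism (euclidean_component (L `&` A0) x0) eta2 eta1 psi.
  move=> SA0 LAx0; set X := euclidean_component _ _.
  have XL : X `<=` L.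
    by move=> x /(@connected_component_sub (euclidean V))[].
  have [_ /(_ A0 x0 SA0 LAx0) b1] := paS1; have [_ /(_ A0 x0 SA0 LAx0) b2] := paS2.
  pose s p := outer p (e x0).
  pose H x := \sum_(p <- pts) signed_pow k.+1 (s p) (outer p (e x)) *: A p.1.
  have cH : mx_class (@regular_class R V) [set: V] H.
    apply: (mx_class_sum pts (f := fun x p => signed_pow k.+1 (s p) (outer p (e x)))
      (fun p => A p.1) algV) => p.
    by apply: (signed_pow_regular he); exact: (outer_regular he).
  have lH x : scalar_linear (H x).
    exact: (weighted_sum_linear iAB hpts (fun p => signed_pow k.+1 (s p) (outer p (e x)))).
  have HG x : X x -> H x = (G \o e) x.
    move=> Xx; rewrite /H /G /= /average big_seq [RHS]big_seq; apply: eq_bigr => p ps.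
    have [A12 _ [A3 S3A A0E]] := SA0.
    have X3 : X `<=` euclidean_component (L `&` A3) x0.
      by apply: component_sub LAx0 _; rewrite -A0E => y [Ly []].
    have LA3 : (L `&` A3) x0 by move: LAx0; rewrite -A0E => -[Lx0 [_ A3x0]].
    have [sgn _] := bump_sign he S3A LA3 (X3 x Xx) ps.
    by rewrite /outer_bump (pospow_signed k sgn).
  have [t1 _] := h1; have [t2 _] := h2.
  apply: (alg_isomorphism he b1 b2 cH lH HG) => [x /XL||]; first exact: good.
  - exact: top_morphism_sub t1.
  - exact: top_morphism_sub t2.
exists phi, psi; split=> //; exists S => //; split=> //; split;
  try by [have [] := h1|have [] := h2].
- by move=> A0 x0 SA0 LAx0; have [] := morph A0 x0 SA0 LAx0.
- by move=> A0 x0 SA0 LAx0; have [] := morph A0 x0 SA0 LAx0.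
Qed.

End PiecewiseIsomorphism.

Theorem theorem4p3 (R : realType) (K : scalar_kind)
    (V : real_algebraic_variety R) (n : nat) (e : V -> 'rV[R]_n)
    (L : set V) (l k : nat) :
  algebraic_embedding e ->
  euclidean_compact L ->
  (l <= k)%N ->
  forall (m : nat) (xi : fibers R K V m), Ck_bundle e l L xi ->
    (exists (p : nat) (eta : fibers R K V p),
       Ckpa_bundle e k L eta /\ Ck_isomorphic e l L xi eta) /\
    (forall (p1 p2 : nat) (eta1 : fibers R K V p1) (eta2 : fibers R K V p2),
       Ckpa_bundle e k L eta1 -> Ck_isomorphic e l L xi eta1 ->
       Ckpa_bundle e k L eta2 -> Ck_isomorphic e l L xi eta2 ->
       Ckpa_isomorphic e k L eta1 eta2).
Proof.
move=> [_ he] cL lk m xi hxi; split; first exact: exists_Ckpa_bundle lk hxi.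
move=> p1 p2 eta1 eta2 pa1 [phi [psi [hphi hpsi inv]]] pa2 iso2.
have [A1 [B1 i1]] : exists A B, continuous_iso e L eta1 xi A B.
  apply: (@Ck_isomorphic_matrices _ _ _ _ _ _ l); exists psi, phi; split=> //.
  by have [h1 h2] := inv; split.
have [A2 [B2 i2]] := Ck_isomorphic_matrices iso2.
exact: (Ckpa_isomorphism he cL pa1 pa2 (continuous_iso_comp i1 i2)).
Qed.
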